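(* Let $\mathbb{Q}(i)\subset L\subset E$ be number fields with $E/\mathbb{Q}(i)$ cyclic, $[E:\mathbb{Q}(i)]=6$, $[E:L]=3$ and $\mathrm{Gal}(E/L)=\langle\sigma\rangle$, and let $\gamma\in\mathcal{O}_L\setminus\{0\}$. If $(E/L,\sigma,\gamma)$ is a cyclic division algebra, then its natural order satisfies $$\mathrm{Nm}_{\mathbb{Z}[i]}(\mathrm{disc}(\mathcal{O}_{\mathrm{nat}}/\mathbb{Z}[i]))\ge 3^{18}\cdot 13^{12}.$$ The lower bound is achieved for $L=\mathbb{Q}(\zeta_{12})$, $E=L(\beta)$ and $\gamma=\frac{1+i\sqrt3}{2}\in\mathcal{O}_L^\times$, where $\zeta_{12}$ is a primitive $12$th root of unity and $\beta$ is a root of $f(X)=X^3-(1+i)X^2+5iX-(1+4i)$.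
   Context: $\mathcal{O}_K$ denotes the ring of integers of a number field $K$. For a cyclic extension $E/L$ of number fields of degree $m$ with $\mathrm{Gal}(E/L)=\langle\sigma\rangle$ and $\gamma\in L^\times$, the cyclic algebra of index $m$ is $(E/L,\sigma,\gamma)=\bigoplus_{j=0}^{m-1}u^jE$, with multiplication determined by $xu=u\sigma(x)$ for all $x\in E$ and $u^m=\gamma$. For $\gamma\in\mathcal{O}_L\setminus\{0\}$ its natural order is $\mathcal{O}_{\mathrm{nat}}=\bigoplus_{j=0}^{m-1}u^j\mathcal{O}_E$. The discriminant $\mathrm{disc}(\mathcal{O}_{\mathrm{nat}}/\mathbb{Z}[i])$ is the ideal of $\mathbb{Z}[i]$ generated by $\det\left(\mathrm{Tr}_{L/\mathbb{Q}(i)}(\mathrm{tr}(x_jx_k))\right)_{j,k}$, where $(x_j)$ is a $\mathbb{Z}[i]$-basis of $\mathcal{O}_{\mathrm{nat}}$ and $\mathrm{tr}$ is the reduced trace of $(E/L,\sigma,\gamma)$ over $L$. $\mathrm{Nm}_{\mathbb{Z}[i]}$ of a nonzero ideal $\mathfrak a$ of $\mathbb{Z}[i]$ is its absolute norm $|\mathbb{Z}[i]/\mathfrak a|$. *)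

(* Defs.v *)
From HB Require Import structures.
From mathcomp Require Import all_boot all_order all_algebra all_fingroup.
From mathcomp Require Import all_solvable all_field.
From mathcomp Require Import finmap.
From mathcomp Require Import boolp classical_sets functions cardinality.

Set Implicit Arguments.
Unset Strict Implicit.
Unset Printing Implicit Defensive.

Import GRing.Theory.
Local Open Scope ring_scope.
Local Open Scope classical_set_scope.

(* |R / I| for an ideal I of a ring R, both given as subsets of an ambient
   ring; the value is 0 when the quotient is infinite. *)
Definition ideal_norm (T : nzRingType) (R I : set T) : nat :=
  #|` fset_set [set [set w | R w /\ I (w - z)] | z in R] |.

Definition gaussian (R : nzRingType) (i : R) : set R :=
  [set z | exists a b : int, z = a%:~R + b%:~R * i].

Definition alg_integer (E : fieldType) (x : E) : Prop :=
  integralOver (fun a : int => a%:~R : E) x.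

Section CyclicAlgebra.

(* A row vector x : 'rV[E]_m stands for the element \sum_(j < m) u^j x_j of the
   cyclic algebra (E/L, s, g).  From a u^k = u^k s^k(a) one gets
     (u^j a) (u^k b) = u^(j + k) s^k(a) b,
   and u^(j + k) = u^((j + k) %% m) g^((j + k) %/ m) as u^m = g. *)
Variables (E : fieldType) (s : E -> E) (g : E) (m : nat).

Definition cyc_one : 'rV[E]_m := \row_(j < m) (j == 0 :> nat)%N%:R.

Definition cyc_mul (x y : 'rV[E]_m) : 'rV[E]_m :=
  \row_(l < m) \sum_(j < m) \sum_(k < m | ((j + k) %% m == l)%N)
     g ^+ ((j + k) %/ m)%N * iter k s (x 0 j) * y 0 k.

Definition cyc_division : Prop :=
  forall x : 'rV[E]_m, x != 0 ->
    exists2 y, cyc_mul x y = cyc_one & cyc_mul y x = cyc_one.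

(* The algebra is a right E-vector space with basis (u^k), on which it acts by
   left multiplication; as E is a maximal subfield, this E-linear action
   realises the splitting (E/L, s, g) (x)_L E = M_m(E), and the reduced trace is
   the trace of the resulting matrix. *)
Definition cyc_splitting (x : 'rV[E]_m) : 'M[E]_m :=
  \matrix_(l < m, k < m) cyc_mul x (delta_mx 0 k) 0 l.

Definition reduced_trace (x : 'rV[E]_m) : E := \tr (cyc_splitting x).

Definition natural_order : set 'rV[E]_m :=
  [set x | forall j, alg_integer (x 0 j)].

End CyclicAlgebra.

(* The elements of R are scalars of the centre, hence act on coordinates. *)
Definition is_basis_over (E : fieldType) (m n : nat) (R : set E)
    (M : set 'rV[E]_m) (x : 'I_n -> 'rV[E]_m) : Prop :=
  (forall y, M y <->
     exists2 c : 'I_n -> E, forall j, R (c j) & y = \sum_j c j *: x j) /\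
  (forall c : 'I_n -> E, (forall j, R (c j)) ->
     \sum_j c j *: x j = 0 -> forall j, c j = 0).

Section Discriminant.

(* F plays the role of Q(i); galTrace 1 L is the field trace Tr_(L/F) only when
   L/F is Galois, which holds for every L when E/F is abelian. *)
Variables (F : fieldType) (E : splittingFieldType F) (i : F).
Variables (L : {subfield E}) (s : E -> E) (g : E) (m : nat).

Definition trace_det (n : nat) (x : 'I_n -> 'rV[E]_m) : E :=
  \det (\matrix_(j < n, k < n)
     galTrace 1 L (reduced_trace s g (cyc_mul s g (x j) (x k)))).

(* disc(O_nat / Z[i]), as a subset of the copy of Z[i] in E.  Two bases give
   determinants differing by the square of a unit of Z[i], so the ideal does not
   depend on the basis. *)
Definition disc_natural_order : set E :=
  [set z | exists n (x : 'I_n -> 'rV[E]_m),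
     is_basis_over (gaussian i%:A) (@natural_order E m) x /\
     exists2 a, gaussian i%:A a & z = a * trace_det x].

Definition disc_norm : nat := ideal_norm (gaussian i%:A) disc_natural_order.

End Discriminant.

Definition cubic_f (F : fieldType) (i : F) : {poly F} :=
  'X^3 - (1 + i) *: 'X^2 + (5%:R * i) *: 'X - (1 + 4%:R * i)%:P.

(* Main.v *)
Require Import Defs.
From HB Require Import structures.
From mathcomp Require Import all_boot all_order all_algebra all_fingroup.
From mathcomp Require Import all_solvable all_field.
From mathcomp Require Import finmap boolp classical_sets functions cardinality ring lra zify.

(** Write E for the sextic field, L and K for its subfields of degree 2 and 3
    over Q(i), s for the automorphism of order 3 (which fixes L) and t for the
    one of order 2 (which fixes K), and d for the discriminant of O_E over
    Z[i].

    In the basis (u^j x_a) of the natural order, with x a basis of O_E, the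
    trace form only pairs u^j with u^(-j mod 3); this gives disc = N(g)^2 d^3,
    where N is the norm from E to Q(i) (tdet_nat_basis, disc_normE). As N(g)
    is a nonzero Gaussian integer, both claims about the natural order are
    claims about d: its norm is at least 3^6 13^4 for every cyclic sextic
    field (lower_bound), and equal to it in the example (nm_disc_example),
    where g is a unit.

    The lower bound. Minimising discriminants and rounding in Z[i] gives a
    generator th of O_L; its discriminant dl = (th - t th)^2 is a nonsquare of
    the form e^2 - 4 n, so its norm is at least 9 and neither 13 nor 26
    (zi_class), and dl^3 divides d. In the same way, O_K has a basis 1, ka, s
    ka; the rounding now takes place in the Eisenstein integers over Z[i], and
    the quantity to minimise is the norm of the quadratic form f = fK ka. The
    product of the differences of the conjugates of ka is k f, with 4 f = m^2
    + 27 k^2, and f^4 divides k^2 d (f4_dvd). Replacing ka by u ka + v s ka,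
    where u + v w is a unit of Z[i][w] and w a cube root of 1, keeps N(f) and
    moves k, so the best choice satisfies 25 N(k)^2 <= 2 N(f) (f_lower). Hence
    N(d) is large enough unless k and f lie in a finite list. For each of its
    members, either N(f) = 81 and N(f)^4 divides N(d), or a prime p of norm 13
    or at least 37 has p^4 dividing d. If p does not divide dl, then p^4 dl^3
    divides d. If it does, d dl being a square yields p^5 (ramified_parity).
    Either way d is large enough.

    The example. The lattice spanned by the g^j b^k has discriminant of norm
    3^6 13^4, which the lower bound forces to be that of O_E. The algebra is a
    division algebra because g is not a norm from E (cyc_divisionP: a singular
    left multiplication produces a semilinearly invariant line, on which g
    acts as a norm). To see that g is not a norm, write E = L(R) with R a
    Lagrange resolvent of b; then R^3 is vpi times an element prime to vpi,
    where vpi is a prime of L above 13, modulo which g is congruent to 4, not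
    a cube. An infinite descent on the norm equation concludes (descent). The
    field itself is built as a tower, first adjoining a root of X^2 - i X - 1,
    which is a primitive 12th root of unity, then a root of the cubic, whose
    other roots are polynomials in it (next_root). *)

Set Implicit Arguments.
Unset Strict Implicit.
Unset Printing Implicit Defensive.

Import Order.TTheory GRing.Theory Num.Theory.
Local Open Scope ring_scope.

(** * Gaussian integers inside a field *)

Lemma small_multiple (n x y : nat) (k : int) : (x < n)%N -> (y < n)%N ->
  x%:Z - y%:Z = k * n%:Z -> x = y.
Proof.
move=> xn yn e; have [k0|[k1|k1]] : k = 0 \/ (1 <= k) \/ (k <= -1) by lia.
- by move: e; rewrite k0 mul0r; lia.
- have : n%:Z <= k * n%:Z by rewrite -[leLHS]mul1r ler_wpM2r //; lia.
  by rewrite -e; lia.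
- have : k * n%:Z <= - n%:Z by rewrite -mulN1r ler_wpM2r //; lia.
  by rewrite -e; lia.
Qed.

(** The embedding of the rationals is part of the data because the fields at hand
    are declared as algebras over extensions of Q(i), not over Q. *)
Record gaussian_field := GaussianField {
  gf_sort :> fieldType;
  gf_rat : {rmorphism rat -> gf_sort};
  gf_i : gf_sort;
  gf_i2 : gf_i ^+ 2 = -1 }.

Section Gauss.
Variable E : gaussian_field.
Local Notation phi := (@gf_rat E).
Local Notation I := (@gf_i E).

Definition cplx (a b : rat) : E := phi a + phi b * I.
Definition qi : {pred E} := fun x => `[< exists a b, x = cplx a b >].
Definition zi : {pred E} := fun x => `[< gaussian I x >].
Definition oE : {pred E} := fun x => `[< alg_integer x >].

Lemma qiP x : reflect (exists a b, x = cplx a b) (x \in qi).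
Proof. exact: asboolP. Qed.
Lemma ziP x : reflect (exists a b : int, x = cplx a%:~R b%:~R) (x \in zi).
Proof.
apply: (iffP (asboolP _)) => -[a [b ->]]; exists a, b; by rewrite /cplx !rmorph_int.
Qed.
Lemma oEP x : reflect (alg_integer x) (x \in oE).
Proof. exact: asboolP. Qed.

Lemma gf_i2E : I * I = -1. Proof. by rewrite -expr2 gf_i2. Qed.

Lemma cplxB a b c d : cplx a b - cplx c d = cplx (a - c) (b - d).
Proof. by rewrite /cplx !rmorphB; ring. Qed.
Lemma cplxD a b c d : cplx a b + cplx c d = cplx (a + c) (b + d).
Proof. by rewrite /cplx !rmorphD; ring. Qed.
Lemma cplxM a b c d : cplx a b * cplx c d = cplx (a * c - b * d) (a * d + b * c).
Proof. by rewrite /cplx !(rmorphB, rmorphD, rmorphM) /=; ring: gf_i2E. Qed.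

Lemma phi_eq0 a : (phi a == 0) = (a == 0). Proof. exact: fmorph_eq0. Qed.

Lemma cplx_eq0 a b : cplx a b = 0 -> a = 0 /\ b = 0.
Proof.
move=> h; have : phi (a ^+ 2 + b ^+ 2) = 0.
  rewrite -(mul0r (cplx a (- b))) -h /cplx !(rmorphD, rmorphXn, rmorphN) /=.
  by ring: gf_i2E.
move/eqP; rewrite phi_eq0 paddr_eq0 ?sqr_ge0 // !sqrf_eq0.
by case/andP => /eqP-> /eqP->.
Qed.

Lemma cplx_inj a b c d : cplx a b = cplx c d -> a = c /\ b = d.
Proof.
move/eqP; rewrite -subr_eq0 cplxB => /eqP/cplx_eq0[/eqP + /eqP].
by rewrite !subr_eq0 => /eqP -> /eqP ->.
Qed.

Lemma natrE_neq0 n : (n.+1%:R : E) != 0.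
Proof. by rewrite -(rmorph_nat phi) phi_eq0 pnatr_eq0. Qed.

Lemma cplx1 : cplx 1 0 = 1.
Proof. by rewrite /cplx rmorph1 rmorph0 mul0r addr0. Qed.
Lemma cplxi : cplx 0 1 = I.
Proof. by rewrite /cplx rmorph1 rmorph0 mul1r add0r. Qed.

Lemma zi_subring : subring_closed zi.
Proof.
split.
- by apply/ziP; exists 1, 0; rewrite cplx1.
- move=> x y /ziP[a [b ->]] /ziP[c [d ->]]; apply/ziP; exists (a - c), (b - d).
  by rewrite cplxB !rmorphB.
- move=> x y /ziP[a [b ->]] /ziP[c [d ->]]; apply/ziP.
  exists (a * c - b * d), (a * d + b * c).
  by rewrite cplxM !(rmorphB, rmorphD, rmorphM).
Qed.
HB.instance Definition _ := GRing.isSubringClosed.Build E zi zi_subring.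

Lemma qi_divring : divring_closed qi.
Proof.
have D x y : x \in qi -> y \in qi -> x * y \in qi.
  by case/qiP=> a [b ->] /qiP[c [d ->]]; rewrite cplxM; apply/qiP; do 2 eexists.
split.
- by apply/qiP; exists 1, 0; rewrite cplx1.
- by move=> x y /qiP[a [b ->]] /qiP[c [d ->]]; rewrite cplxB; apply/qiP; do 2 eexists.
- move=> x y qx /qiP[c [d ->]]; apply: D => //.
  have [->|n0] := eqVneq (cplx c d) 0.
    by rewrite invr0; apply/qiP; exists 0, 0; rewrite /cplx !rmorph0 mul0r addr0.
  have n1 : c ^+ 2 + d ^+ 2 != 0.
    apply: contra n0; rewrite paddr_eq0 ?sqr_ge0 // !sqrf_eq0.
    by case/andP => /eqP-> /eqP->; rewrite /cplx !rmorph0 mul0r addr0.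
  apply/qiP; exists (c / (c ^+ 2 + d ^+ 2)), (- d / (c ^+ 2 + d ^+ 2)).
  apply: (mulfI n0); rewrite divff // cplxM -cplx1; congr cplx; field => //.
Qed.
HB.instance Definition _ := GRing.isDivringClosed.Build E qi qi_divring.

Lemma oE_subring : subring_closed oE.
Proof.
split.
- exact/oEP/(@integral1 _ _ intr).
- move=> x y /oEP hx /oEP hy; exact/oEP/(@integral_sub _ _ intr).
- move=> x y /oEP hx /oEP hy; exact/oEP/(@integral_mul _ _ intr).
Qed.
HB.instance Definition _ := GRing.isSubringClosed.Build E oE oE_subring.

Lemma zi_qi x : x \in zi -> x \in qi.
Proof. by case/ziP=> a [b ->]; apply/qiP; do 2 eexists. Qed.
Lemma i_zi : I \in zi.
Proof. by apply/ziP; exists 0, 1; rewrite cplxi. Qed.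
Lemma i_oE : I \in oE.
Proof.
apply/oEP; exists ('X^2 + 1); first by rewrite monicE lead_coefDl ?lead_coefXn // size_polyXn size_poly1.
by rewrite rmorphD /= map_polyXn rmorph1 /root !hornerE gf_i2 addNr.
Qed.
Lemma zi_oE x : x \in zi -> x \in oE.
Proof.
case/ziP=> a [b ->]; rewrite /cplx !rmorph_int rpredD ?rpredM ?rpred_int //; exact: i_oE.
Qed.

Lemma cplxP x : x \in qi -> {ab : rat * rat | x = cplx ab.1 ab.2}.
Proof. by move=> /qiP h; apply: cid; case: h => a [b ->]; exists (a, b). Qed.

(** Coordinates over the rationals are chosen classically; Nm_cplx shows that
    the choice is immaterial. *)
Definition Nm (x : E) : rat :=
  if pselect (x \in qi) is left h then
    let: exist ab _ := cplxP h in ab.1 ^+ 2 + ab.2 ^+ 2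
  else 0.

Lemma Nm_cplx a b : Nm (cplx a b) = a ^+ 2 + b ^+ 2.
Proof.
rewrite /Nm; case: pselect => [h|[]]; last by apply/qiP; do 2 eexists.
by case: cplxP => -[c d] /= /cplx_inj[-> ->].
Qed.

Lemma NmM x y : x \in qi -> y \in qi -> Nm (x * y) = Nm x * Nm y.
Proof.
by case/qiP=> a [b ->] /qiP[c [d ->]]; rewrite cplxM !Nm_cplx; ring.
Qed.

Lemma Nm_ge0 x : 0 <= Nm x.
Proof. by rewrite /Nm; case: pselect => // h; case: cplxP => ? _; rewrite addr_ge0 ?sqr_ge0. Qed.

Lemma Nm_eq0 x : x \in qi -> (Nm x == 0) = (x == 0).
Proof.
case/qiP=> a [b ->]; rewrite Nm_cplx paddr_eq0 ?sqr_ge0 // !sqrf_eq0.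
apply/andP/eqP => [[/eqP-> /eqP->]|/cplx_eq0[-> ->] //].
by rewrite /cplx !rmorph0 mul0r addr0.
Qed.

Lemma Nm1 : Nm 1 = 1. Proof. by rewrite -cplx1 Nm_cplx; ring. Qed.
Lemma Nmi : Nm I = 1. Proof. by rewrite -cplxi Nm_cplx; ring. Qed.
Lemma NmX x n : x \in qi -> Nm (x ^+ n) = Nm x ^+ n.
Proof.
move=> qx; elim: n => [|n IH]; first by rewrite !expr0 Nm1.
by rewrite !exprS NmM ?rpredX // IH.
Qed.
Lemma Nm_int (n : int) : Nm n%:~R = n%:~R ^+ 2.
Proof. by rewrite -(rmorph_int phi) -[phi _]addr0 -(mul0r I) -(rmorph0 phi) Nm_cplx; ring. Qed.
Lemma NmN x : x \in qi -> Nm (- x) = Nm x.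
Proof.
by case/qiP=> a [b ->]; rewrite /cplx opprD -mulNr -!rmorphN -!/(cplx _ _) !Nm_cplx !sqrrN.
Qed.
Lemma Nm_nat n : Nm n%:R = n%:R ^+ 2. Proof. exact: (Nm_int n). Qed.

Definition nm (x : E) : nat := `|numq (Nm x)|%N.

Lemma nmE x : x \in zi -> Nm x = (nm x)%:R.
Proof.
case/ziP=> a [b ->]; rewrite /nm Nm_cplx -!rmorphXn -rmorphD /= numq_int.
by rewrite -[RHS]/((`|_|%N : int)%:~R) gez0_abs // addr_ge0 ?sqr_ge0.
Qed.
Lemma nm_cplx (a b : int) : nm (cplx a%:~R b%:~R) = absz (a ^+ 2 + b ^+ 2).
Proof. by rewrite /nm Nm_cplx -!rmorphXn -rmorphD /= numq_int. Qed.

Lemma nmM x y : x \in zi -> y \in zi -> nm (x * y) = (nm x * nm y)%N.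
Proof.
move=> zx zy; apply/eqP; rewrite -(eqr_nat rat) -nmE ?rpredM // NmM ?zi_qi //.
by rewrite natrM !nmE.
Qed.
Lemma nm1 : nm 1 = 1%N. Proof. by rewrite /nm Nm1. Qed.
Lemma nmX x n : x \in zi -> nm (x ^+ n) = (nm x ^ n)%N.
Proof.
move=> zx; elim: n => [|n IH]; first by rewrite expr0 nm1.
by rewrite exprS nmM ?rpredX // IH expnS.
Qed.
Lemma nm_eq0 x : x \in zi -> (nm x == 0%N) = (x == 0).
Proof. by move=> zx; rewrite -Nm_eq0 ?zi_qi // nmE // pnatr_eq0. Qed.
Lemma nm_gt0 x : x \in zi -> x != 0 -> (0 < nm x)%N.
Proof. by move=> zx; rewrite lt0n nm_eq0. Qed.
Lemma nmi : nm I = 1%N. Proof. by rewrite /nm Nmi. Qed.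
Lemma nm_nat n : nm n%:R = (n ^ 2)%N.
Proof. by apply/eqP; rewrite -(eqr_nat rat) -nmE ?rpred_nat // Nm_nat natrX. Qed.
Lemma nmN x : x \in zi -> nm (- x) = nm x.
Proof. by move=> zx; rewrite /nm NmN ?zi_qi. Qed.

Lemma nm_unit x : x \in zi -> nm x = 1%N -> x^-1 \in zi.
Proof.
case/ziP=> a [b ->]; rewrite nm_cplx => h.
have e : a ^+ 2 + b ^+ 2 = 1.
  by rewrite -[LHS]gez0_abs ?h // addr_ge0 ?sqr_ge0.
apply/ziP; exists a, (- b).
have x0 : cplx a%:~R b%:~R != 0.
  apply/eqP=> /cplx_eq0[/eqP + /eqP]; rewrite !intr_eq0 => /eqP a0 /eqP b0.
  by move: e; rewrite a0 b0.
apply: (mulfI x0); rewrite divff // cplxM -cplx1.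
have er : a%:~R ^+ 2 + b%:~R ^+ 2 = 1 :> rat by rewrite -!rmorphXn -rmorphD /= e.
by rewrite rmorphN; congr cplx; [rewrite -[LHS]er|]; ring.
Qed.

Lemma qi_denom (x : E) : x \in qi -> exists2 n : nat, n != 0%N & n%:R * x \in zi.
Proof.
case/qiP=> a [b ->]; exists (absz (denq a * denq b)); first by rewrite absz_eq0 mulf_neq0 ?denq_neq0.
apply/ziP; exists (numq a * denq b), (numq b * denq a).
have -> : (absz (denq a * denq b))%:R = cplx (denq a * denq b)%:~R 0.
  rewrite /cplx rmorph0 mul0r addr0 rmorph_int -[LHS]/((absz _ : int)%:~R).
  by rewrite gez0_abs // mulr_ge0 ?denq_ge0.
by rewrite cplxM; congr cplx; rewrite !rmorphM /= !numqE; ring.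
Qed.

Lemma rat_round (a : rat) : exists n : int, -1/2%:R <= a - n%:~R <= 1/2%:R.
Proof.
exists (Num.floor (a + 1/2%:R)); have /andP[] := floor_itv (a + 1/2%:R).
by rewrite intrD; lra.
Qed.

Lemma zi_round x : x \in qi -> exists2 y, y \in zi & Nm (x - y) < 1.
Proof.
case/qiP=> a [b ->]; have [n /andP[n1 n2]] := rat_round a; have [m /andP[m1 m2]] := rat_round b.
exists (cplx n%:~R m%:~R); first by apply/ziP; do 2 eexists.
rewrite cplxB Nm_cplx; nra.
Qed.

(** Monic rational roots are integers: an algebraic integer of algC which is
    rational is an integer. *)
Lemma rat_int (r : rat) (p : {poly int}) : p \is monic -> root (map_poly intr p) r ->
  exists n : int, r = n%:~R.
Proof.
move=> mp rp; have /Cint_rat_Aint : (ratr r : algC) \in Crat by apply: Crat_rat.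
case/(_ _)/intrP => [|n rn].
  apply: (@root_monic_Aint (map_poly intr p)); last 2 first.
  - exact: monic_map.
  - by apply/polyOverP => i; rewrite coef_map /= intr_int.
  have -> : map_poly intr p = map_poly (ratr : rat -> algC) (map_poly intr p).
    by rewrite -map_poly_comp; apply: eq_map_poly => x /=; rewrite ratr_int.
  by rewrite (mapf_root (ratr : {rmorphism rat -> algC})).
by exists n; apply: (fmorph_inj (ratr : {rmorphism rat -> algC})); rewrite /= rn ratr_int.
Qed.

Lemma phi_oE r : phi r \in oE -> exists n : int, r = n%:~R.
Proof.
case/oEP=> p mp rp; apply: (rat_int mp).
rewrite -(fmorph_root phi) -map_poly_comp.
by congr (is_true (root _ _)): rp; apply: eq_map_poly => x /=; rewrite rmorph_int.
Qed.

(** Evaluating an integer polynomial commutes with complex conjugation, so the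
    conjugate of a root is a root. *)
Lemma conj_oE a b : cplx a b \in oE -> cplx a (- b) \in oE.
Proof.
case/oEP=> p mp /rootP rp; apply/oEP; exists p => //; apply/rootP.
suff [c [d [e1 e2]]] : exists c d, (map_poly intr p).[cplx a b] = cplx c d /\
    (map_poly intr p).[cplx a (- b)] = cplx c (- d).
  move: e2; rewrite e1 in rp; have [-> ->] := cplx_eq0 rp => ->.
  by rewrite oppr0 /cplx !rmorph0 mul0r addr0.
elim/poly_ind: (p) => [|q c [u [v [e1 e2]]]].
  by exists 0, 0; rewrite !rmorph0 !horner0 oppr0 /cplx !rmorph0 mul0r addr0.
exists (u * a - v * b + c%:~R), (u * b + v * a).
have cc : (c%:~R : E) = cplx c%:~R 0 by rewrite /cplx rmorph0 mul0r addr0 rmorph_int.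
rewrite !rmorphD !rmorphM /= !map_polyX !map_polyC /= !hornerE e1 e2 cc !cplxM !cplxD.
by split; congr cplx; ring.
Qed.

(** Z[i] is integrally closed. For x = a + b i integral, 2 a, 2 b and a^2 + b^2
    are rational algebraic integers, hence integers m, n, k with
    m^2 + n^2 = 4 k, which forces m and n to be even. *)
Lemma qi_oE_zi x : x \in qi -> x \in oE -> x \in zi.
Proof.
case/qiP=> a [b ->] ox; have oc := conj_oE ox.
have oi := i_oE.
have [m em] : exists n : int, a + a = n%:~R.
  apply: phi_oE; have := rpredD ox oc; rewrite cplxD subrr.
  by rewrite /cplx rmorph0 mul0r addr0.
have [n en] : exists n : int, b + b = n%:~R.
  apply: phi_oE; have := rpredM (rpredB oc ox) oi; rewrite cplxB subrr.
  rewrite /cplx rmorph0 add0r -mulrA gf_i2E mulrN1 -rmorphN.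
  by have -> : - (- b - b) = b + b by ring.
have [k ek] : exists n : int, a ^+ 2 + b ^+ 2 = n%:~R.
  apply: phi_oE; have := rpredM ox oc; rewrite cplxM.
  have -> : a * - b + b * a = 0 by ring.
  rewrite /cplx rmorph0 mul0r addr0.
  by have -> : a * a - b * - b = a ^+ 2 + b ^+ 2 by ring.
have e : m ^+ 2 + n ^+ 2 = 4 * k.
  apply: (@intr_inj rat); rewrite !(rmorphD, rmorphM, rmorphXn) /= -em -en -ek; ring.
have [[m' Em] [n' En]] : (exists m', m = 2 * m') /\ exists n', n = 2 * n'.
  have [p [r [Ep hr]]] : exists p r, m = 2 * p + r /\ (r = 0 \/ r = 1).
    by exists (m %/ 2)%Z, (m %% 2)%Z; lia.
  have [q [t [Eq ht]]] : exists q t, n = 2 * q + t /\ (t = 0 \/ t = 1).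
    by exists (n %/ 2)%Z, (n %% 2)%Z; lia.
  move: e; rewrite Ep Eq !expr2.
  case: hr ht => -> [] -> e; [by split; [exists p|exists q]; lia|exfalso; lia..].
apply/ziP; exists m', n'; congr cplx.
  by have := em; rewrite Em rmorphM /=; lra.
by have := en; rewrite En rmorphM /=; lra.
Qed.

Lemma sqr_oE x : x ^+ 2 \in oE -> x \in oE.
Proof.
move=> /oEP o; apply/oEP; apply: (@integral_root_monic _ _ intr x ('X^2 - (x ^+ 2)%:P)).
- by rewrite monicE lead_coefDl ?lead_coefXn // size_polyXn size_polyN size_polyC ltnS; case: (_ != 0).
- by rewrite /root !hornerE subrr.
apply/integral_poly => i; rewrite coefB coefXn coefC.
by apply/oEP; rewrite rpredB ?rpred_nat //; case: ifP => _; rewrite ?rpred0 //; apply/oEP.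
Qed.

Definition zdvd (a b : E) := exists2 c, c \in zi & b = c * a.

Lemma ex_min (A : Type) (P : A -> Prop) (mu : A -> nat) : (exists a, P a) ->
  exists2 a, P a & forall b, P b -> (mu a <= mu b)%N.
Proof.
case=> a0 Pa0; have ex : exists n, `[< exists2 a, P a & mu a = n >].
  by exists (mu a0); apply/asboolP; exists a0.
case: (ex_minnP ex) => n /asboolP[a Pa <-] mn; exists a => // b Pb.
by apply: mn; apply/asboolP; exists b.
Qed.

Lemma zdvd_nm a b : a \in zi -> b \in zi -> zdvd a b -> (nm a %| nm b)%N.
Proof. by move=> za zb [c zc ->]; rewrite nmM // dvdn_mull. Qed.

Lemma zdvd_le a b : a \in zi -> b \in zi -> b != 0 -> zdvd a b -> (nm a <= nm b)%N.
Proof. by move=> za zb b0 /(zdvd_nm za zb) /dvdn_leq -> //; rewrite nm_gt0. Qed.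

Lemma zdvdP a b : a != 0 -> zdvd a b <-> b / a \in zi.
Proof.
move=> a0; split=> [[c zc ->]|z]; first by rewrite mulfK.
by exists (b / a); rewrite // divfK.
Qed.

Definition zcop (a b : E) := exists u v, [/\ u \in zi, v \in zi & u * a + v * b = 1].

Lemma zcopC a b : zcop a b -> zcop b a.
Proof. by case=> u [v [zu zv e]]; exists v, u; rewrite addrC. Qed.

Lemma zcopM a b c : a \in zi -> b \in zi -> c \in zi -> zcop a b -> zcop a c -> zcop a (b * c).
Proof.
move=> za zb zc [u [v [zu zv e]]] [x [y [zx zy e']]].
exists (u * x * a + u * y * c + v * b * x), (v * y).
rewrite !(rpredD, rpredM) //; split=> //.
by rewrite -[RHS]mulr1 -[X in _ = X * _]e -[X in _ = _ * X]e'; ring.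
Qed.

Lemma zcopX a b m n : a \in zi -> b \in zi -> zcop a b -> zcop (a ^+ m) (b ^+ n).
Proof.
move=> za zb ab; have h1 k c d : c \in zi -> d \in zi -> zcop c d -> zcop c (d ^+ k).
  move=> zc zd cd; elim: k => [|k IH]; last by rewrite exprS; apply: zcopM; rewrite ?rpredX.
  by exists 0, 1; rewrite rpred0 rpred1 mul0r add0r mulr1.
by apply/h1/zcopC/h1/zcopC; rewrite ?rpredX.
Qed.

Lemma zcop_dvd a b x : x \in zi -> zcop a b -> zdvd a x -> zdvd b x -> zdvd (a * b) x.
Proof.
move=> zx [u [v [zu zv e]]] [c zc ec] [d zd ed]; exists (d * u + c * v).
  by rewrite rpredD ?rpredM.
transitivity (u * a * x + v * b * x); first by rewrite -mulrDl e mul1r.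
by rewrite {1}ed ec; ring.
Qed.

Lemma zcop_gauss a b x : x \in zi -> a \in zi -> zcop a b -> zdvd a (b * x) -> zdvd a x.
Proof.
move=> zx za [u [v [zu zv e]]] [c zc ec]; exists (u * x + v * c).
  by rewrite rpredD ?rpredM.
transitivity (u * a * x + v * (b * x)); first by rewrite mulrA -mulrDl e mul1r.
by rewrite ec; ring.
Qed.

Definition zprime (p : E) := [/\ p \in zi, p != 0 &
  forall d, d \in zi -> zdvd d p -> nm d = 1%N \/ nm d = nm p].

(** Bezout: a combination u p + v c of least norm divides p and c, by rounding
    the quotients to Gaussian integers. *)
Lemma zprime_cop p c : zprime p -> c \in zi -> ~ zdvd p c -> zcop p c.
Proof.
move=> [zp p0 pr] zc npc.
pose P d := d != 0 /\ exists u v, [/\ u \in zi, v \in zi & d = u * p + v * c].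
have [|d [d0 [u [v [zu zv ed]]]] dmin] := @ex_min E P nm.
  by exists p; split=> //; exists 1, 0; rewrite rpred1 rpred0 mul1r mul0r addr0.
have zd : d \in zi by rewrite ed rpredD ?rpredM.
have dv x y : x \in zi -> y \in zi -> zdvd d (x * p + y * c).
  move=> zx zy; set e := _ + _; have ze : e \in zi by rewrite rpredD ?rpredM.
  have [q zq hq] := zi_round (rpred_div (zi_qi ze) (zi_qi zd)).
  exists q => //; apply/eqP; rewrite -subr_eq0; apply/negPn/negP => r0.
  have /dmin : P (e - q * d).
    split=> //; exists (x - q * u), (y - q * v); rewrite !(rpredB, rpredM) //; split=> //.
    by rewrite ed /e; ring.
  apply/negP; rewrite -ltnNge -(ltr_nat rat) -!nmE ?rpredB ?rpredM //.
  have -> : e - q * d = (e / d - q) * d by rewrite mulrBl divfK.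
  have qq : e / d - q \in qi by rewrite rpredB ?rpred_div ?zi_qi.
  rewrite NmM ?(zi_qi zd) //.
  by rewrite -[ltRHS]mul1r ltr_pM2r // lt_def Nm_ge0 Nm_eq0 ?zi_qi // d0.
have dp : zdvd d p by have := dv 1 0; rewrite mul1r mul0r addr0; apply; rewrite ?rpred0 ?rpred1.
have dc : zdvd d c by have := dv 0 1; rewrite mul1r mul0r add0r; apply; rewrite ?rpred0 ?rpred1.
case: (pr _ zd dp) => nd.
  have zi' := nm_unit zd nd; exists (d^-1 * u), (d^-1 * v).
  by rewrite !rpredM // -!mulrA -mulrDr -ed mulVf.
case: npc; case: dp dc => w zw ew [y zy ey]; have zw' : w^-1 \in zi.
  apply: nm_unit => //; apply/eqP; rewrite -(@eqn_pmul2r (nm d)) ?nm_gt0 //.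
  by rewrite -nmM // -ew nd mul1n.
have w0 : w != 0 by apply: contra p0 => /eqP w0; rewrite ew w0 mul0r.
by exists (y * w^-1); rewrite ?rpredM // ey ew -mulrA mulKf.
Qed.

(** Irreducibility is tested on norms, which are sums of two squares. *)
Lemma zprime_of p : p \in zi -> nm p != 0%N ->
  (forall a b : int, (absz (a ^+ 2 + b ^+ 2)%R %| nm p)%N ->
    absz (a ^+ 2 + b ^+ 2) = 1%N \/ absz (a ^+ 2 + b ^+ 2) = nm p) -> zprime p.
Proof.
move=> zp np h; split=> //; first by rewrite -nm_eq0.
move=> d zd /(zdvd_nm zd zp); case/ziP: zd => a [b ->]; rewrite nm_cplx; exact: h.
Qed.

Lemma prime_zprime p : p \in zi -> prime (nm p) -> zprime p.
Proof.
move=> zp pp; apply: zprime_of => //; first by rewrite -lt0n prime_gt0.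
by move=> a b; have [_ h] := primeP pp => /h /orP[] /eqP ->; [left|right].
Qed.

Lemma cplx_zi_dvd (D z : E) : D \in zi -> D != 0 ->
  [set z | exists2 a, gaussian I a & z = a * D]%classic z <-> z / D \in zi.
Proof.
move=> zD D0; rewrite -zdvdP //; split=> -[c zc e]; exists c => //; exact/asboolP.
Qed.

(** The multiples of D = p + q i, with gn = gcd(p, q), form the lattice of the
    plane spanned by (hn, 0) and (c, gn), where hn gn = N(D). A fundamental
    domain is the rectangle of size hn by gn, whose points represent each class
    exactly once. *)
Lemma ideal_norm_zi (D : E) : D \in zi -> D != 0 ->
  ideal_norm (gaussian I) [set z | exists2 a, gaussian I a & z = a * D]%classic = nm D.
Proof.
move=> zD D0; have /ziP[p [q eD]] := zD.
pose gn := gcdn `|p| `|q|; pose g : int := gn.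
have [p' ep] : exists p', p = g * p'.
  by exists (p %/ g)%Z; rewrite mulrC divzK // dvdzE dvdn_gcdl.
have [q' eq] : exists q', q = g * q'.
  by exists (q %/ g)%Z; rewrite mulrC divzK // dvdzE dvdn_gcdr.
have [u [v bez]] : exists u v, u * p + v * q = g.
  by have [u [v e]] := Bezoutz p q; exists u, v; rewrite e.
have g0 : (0 < gn)%N.
  rewrite gcdn_gt0 !absz_gt0; apply/negPn; rewrite negb_or !negbK; apply/negP => /andP[/eqP p0 /eqP q0].
  by move: D0; rewrite eD p0 q0 /cplx !rmorph0 mul0r addr0 eqxx.
pose hn := absz (g * (p' ^+ 2 + q' ^+ 2)); pose h : int := hn.
have s0 : 0 <= p' ^+ 2 + q' ^+ 2 by rewrite addr_ge0 ?sqr_ge0.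
have eh : h = g * (p' ^+ 2 + q' ^+ 2) by rewrite /h /hn gez0_abs // mulr_ge0.
have h0 : h != 0.
  rewrite eh mulf_neq0 //; first by rewrite /g; lia.
  apply: contra D0; rewrite paddr_eq0 ?sqr_ge0 // !sqrf_eq0 => /andP[/eqP a0 /eqP b0].
  by rewrite eD ep eq a0 b0 !mulr0 /cplx !rmorph0 mul0r addr0.
have enm : nm D = (hn * gn)%N.
  rewrite eD nm_cplx ep eq.
  have -> : (g * p') ^+ 2 + (g * q') ^+ 2 = h * g by rewrite eh; ring.
  by rewrite abszM.
pose w x y : E := cplx (x%:~R) (y%:~R).
have wz x y : w x y \in zi by apply/ziP; exists x, y.
have wB x y x' y' : w x y - w x' y' = w (x - x') (y - y') by rewrite /w cplxB !rmorphB.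
have mulD a b : w a b * D = w (a * p - b * q) (a * q + b * p).
  by rewrite eD /w cplxM !(rmorphB, rmorphD, rmorphM).
have latP x y : w x y / D \in zi <-> exists a b, x = a * p - b * q /\ y = a * q + b * p.
  split=> [/ziP[a [b e]]|[a [b [-> ->]]]].
    exists a, b; have : w x y = w (a * p - b * q) (a * q + b * p).
      by rewrite -mulD /w -e divfK.
    by case/cplx_inj => /intr_inj -> /intr_inj ->.
  by rewrite -mulD mulfK.
have lat1 k : w (k * h) 0 / D \in zi.
  apply/latP; exists (k * p'), (- (k * q')); rewrite eh ep eq; split; ring.
pose c := v * p - u * q.
have lat2 k : w (k * c) (k * g) / D \in zi.
  by apply/latP; exists (k * v), (k * u); rewrite /c -bez; split; ring.
pose F (xy : 'I_hn * 'I_gn) : set E :=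
  [set z | gaussian I z /\ exists2 a, gaussian I a & z - w (xy.1 : nat) (xy.2 : nat) = a * D]%classic.
pose dv z := z / D \in zi.
have FP xy z : F xy z <-> z \in zi /\ dv (z - w (xy.1 : nat) (xy.2 : nat)).
  rewrite /F /= /dv; split=> -[/asboolP zz h1]; split=> //.
    by apply/(cplx_zi_dvd _ zD D0).
  by apply/(cplx_zi_dvd (z - _) zD D0).
have dvB z z' : dv z -> dv z' -> dv (z - z') by rewrite /dv mulrBl => *; rewrite rpredB.
have dvD z z' : dv z -> dv z' -> dv (z + z') by rewrite /dv mulrDl => *; rewrite rpredD.
have Finj : injective F.
  move=> [x y] [x' y'] e.
  have : F (x, y) (w (x : nat) (y : nat)).
    by apply/FP; split=> //=; rewrite subrr /dv mul0r rpred0.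
  rewrite e => /FP[_ /=]; rewrite wB /dv => /latP[a [b [e1 e2]]].
  have yy : y = y'.
    apply/val_inj => /=; have [k ek] : exists k, (y : nat)%:Z - (y' : nat)%:Z = k * g.
      by exists (a * q' + b * p'); rewrite e2 ep eq; ring.
    exact: small_multiple (ltn_ord y) (ltn_ord y') ek.
  rewrite yy subrr in e2 *; congr (_, _); apply/val_inj => /=.
  have [k ek] : exists k, (x : nat)%:Z - (x' : nat)%:Z = k * h.
    have e3 : a * q' + b * p' = 0.
      have g1 : g != 0 by rewrite /g; lia.
      by apply: (mulfI g1); rewrite mulr0 [RHS]e2 ep eq; ring.
    have cop : u * p' + v * q' = 1.
      have g1 : g != 0 by rewrite /g; lia.
      by apply: (mulfI g1); rewrite mulr1 -[RHS]bez ep eq; ring.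
    exists (a * u - b * v); rewrite e1 eh ep eq.
    have Ea : a = (a * u - b * v) * p'.
      transitivity (a * (u * p' + v * q') - v * (a * q' + b * p')); first by rewrite cop e3; ring.
      ring.
    have Eb : b = - (a * u - b * v) * q'.
      transitivity (b * (u * p' + v * q') - u * (a * q' + b * p')); first by rewrite cop e3; ring.
      ring.
    rewrite {1}Ea {2}Eb; ring.
  exact: small_multiple (ltn_ord x) (ltn_ord x') ek.
rewrite /ideal_norm.
set S := (X in fset_set X).
have SE : S = (F @` [set: 'I_hn * 'I_gn])%classic.
  rewrite eqEsubset; split=> X /=.
    case=> z /asboolP/ziP[x [y ->]] <-.
    pose k := (y %/ g)%Z; pose x1 := x - k * c; pose l := (x1 %/ h)%Z.
    have g1 : 0 < g by rewrite /g ltz_nat.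
    have h1 : 0 < h by move: h0; rewrite /h; case: (hn).
    have yb : (absz (y %% g)%Z < gn)%N.
      by rewrite -ltz_nat gez0_abs ?modz_ge0 ?ltz_pmod // gt_eqF.
    have xb : (absz (x1 %% h)%Z < hn)%N.
      by rewrite -ltz_nat gez0_abs ?modz_ge0 ?ltz_pmod.
    exists (Ordinal xb, Ordinal yb) => //.
    have ez : dv (w x y - w (absz (x1 %% h)%Z) (absz (y %% g)%Z)).
      rewrite !gez0_abs ?modz_ge0 //; last by rewrite gt_eqF.
      rewrite wB; have -> : w (x - (x1 %% h)%Z) (y - (y %% g)%Z) = w (k * c) (k * g) + w (l * h) 0.
        rewrite /w cplxD -!rmorphD /= addr0; congr cplx; congr (_%:~R).
          by rewrite [in RHS]/l; have := divz_eq x1 h; move: (x1 %% h)%Z (x1 %/ h)%Z => r r'; rewrite /x1 => e; rewrite -[x in LHS](subrK (k * c)) e; ring.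
        by rewrite {1}(divz_eq y g) -/k; ring.
      by apply: dvD; [exact: lat2|exact: lat1].
    rewrite eqEsubset; split=> t /=.
      move/FP => /= [zt ht]; split; first exact/asboolP.
      apply/(cplx_zi_dvd _ zD D0).
      by have := dvB _ _ ht ez; rewrite /dv opprB addrA subrK.
    case=> /asboolP zt /(cplx_zi_dvd _ zD D0) ht; apply/FP; split=> //=.
    by have := dvD _ _ ht ez; rewrite /dv addrA subrK.
  case=> xy _ <-; exists (w (xy.1 : nat) (xy.2 : nat)); first exact/asboolP/wz.
  by [].
have -> : fset_set S = (F @` fset_set [set: 'I_hn * 'I_gn])%fset.
  by rewrite SE fset_set_image //; exact: finite_finset.
rewrite card_imfset //= enm.
have -> : fset_set [set: 'I_hn * 'I_gn] = [fset x | x in {: 'I_hn * 'I_gn}]%fset.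
  apply/fsetP => x; rewrite in_fset_set; last exact: finite_finset.
  by rewrite in_setT; apply/esym/imfsetP; exists x.
by rewrite card_imfset //= -cardE card_prod !card_ord.
Qed.
End Gauss.
Arguments qi {E}.
Arguments zi {E}.
Arguments oE {E}.

(** * Determinants and elementary numerical bounds *)

Lemma rpred_det (R : comNzRingType) (S : subringClosed R) n (A : 'M[R]_n) :
  (forall i j, A i j \in S) -> \det A \in S.
Proof.
by move=> h; apply: rpred_sum => u _; rewrite rpredM ?rpredX ?rpredN1 // rpred_prod.
Qed.

Lemma det3 (R : comNzRingType) (A : 'M[R]_3) (F : nat -> nat -> R) :
  (forall i j : 'I_3, A i j = F i j) ->
  \det A = F 0 0 * (F 1 1 * F 2 2 - F 1 2 * F 2 1) - F 0 1 * (F 1 0 * F 2 2 - F 1 2 * F 2 0)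
           + F 0 2 * (F 1 0 * F 2 1 - F 1 1 * F 2 0).
Proof.
move=> h; rewrite (expand_det_row _ 0) !big_ord_recl big_ord0 /cofactor.
rewrite !(expand_det_row _ 0) !big_ord_recl !big_ord0 /cofactor !det_mx11 !mxE !h /= /bump /=.
ring.
Qed.

Lemma det_swap (R : comNzRingType) n :
  \det (block_mx 0 1%:M 1%:M 0 : 'M[R]_(n + n)) = (-1) ^+ n.
Proof.
have -> : block_mx 0 1%:M 1%:M 0 = block_mx 1%:M 1%:M 0 1%:M *m block_mx (- 1%:M) 0 1%:M 1%:M
    *m block_mx 1%:M (- 1%:M) 0 1%:M :> 'M[R]_(n + n).
  rewrite !mulmx_block !mulmx1 !mul1mx !mul0mx !mulmx0 !add0r !addr0 addNr.
  by rewrite ?mulNmx ?mul0mx ?mulmxN ?mulmx1 ?mul1mx ?oppr0 ?add0r ?addNr ?opprK.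
rewrite !det_mulmx !det_ublock det_lblock !det1 -scaleN1r detZ det1.
by rewrite !mulr1 !mul1r.
Qed.

Lemma sqr_bound (k a b : int) : 0 <= k -> a ^+ 2 + b ^+ 2 < (k + 1) ^+ 2 ->
  - k <= a <= k /\ - k <= b <= k.
Proof.
have h (x y : int) : 0 <= k -> x ^+ 2 + y ^+ 2 < (k + 1) ^+ 2 -> - k <= x <= k.
  rewrite !expr2 => k0 hk; have y0 : 0 <= y * y by rewrite -expr2 sqr_ge0.
  have {hk} : x * x < (k + 1) * (k + 1) by apply: le_lt_trans hk; rewrite lerDl.
  nia.
by move=> k0 hk; split; [apply: (h a b)|apply: (h b a); rewrite 1?addrC].
Qed.

(** The four shapes are the residues modulo 4 of the squares of Gaussian
    integers; the excluded pairs (a, b) are the squares of norm at most 4. *)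
Lemma square_class_int (A B a b : int) :
  (a = 4 * A /\ b = 4 * B) \/ (a = 4 * A - 1 /\ b = 4 * B) \/
    (a = 4 * A + 1 /\ b = 4 * B) \/ (a = 4 * A /\ b = 4 * B + 2) ->
  ~ (a = 0 /\ b = 0) -> ~ (a = 1 /\ b = 0) -> ~ (a = -1 /\ b = 0) ->
  ~ (a = 0 /\ b = 2) -> ~ (a = 0 /\ b = -2) ->
  [/\ 9 <= a ^+ 2 + b ^+ 2, a ^+ 2 + b ^+ 2 <> 13 & a ^+ 2 + b ^+ 2 <> 26].
Proof.
move=> cls n0 n1 n2 n3 n4; split.
- rewrite leNgt; apply/negP => /(@sqr_bound 2 _ _ isT) h; lia.
- clear n0 n1 n2 n3 n4 => e; have [] := @sqr_bound 3 a b isT; first by rewrite e.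
  move=> ha hb; have {cls} : a = 0 \/ b = 0 by lia.
  have {}hb : b = -3 \/ b = -2 \/ b = -1 \/ b = 0 \/ b = 1 \/ b = 2 \/ b = 3 by lia.
  have {}ha : a = -3 \/ a = -2 \/ a = -1 \/ a = 0 \/ a = 1 \/ a = 2 \/ a = 3 by lia.
  case=> z; move: e; rewrite z.
    by case: hb => [->|[->|[->|[->|[->|[->|->]]]]]].
  by case: ha => [->|[->|[->|[->|[->|[->|->]]]]]].
- clear n0 n1 n2 n3 n4 => e; have [] := @sqr_bound 5 a b isT; first by rewrite e; lia.
  move=> ha hb; have {cls}hb : b = -4 \/ b = -2 \/ b = 0 \/ b = 2 \/ b = 4 by lia.
  have {}ha : a = -5 \/ a = -4 \/ a = -3 \/ a = -2 \/ a = -1 \/ a = 0 \/ a = 1 \/ a = 2 \/ a = 3 \/ a = 4 \/ a = 5 by lia.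
  move: e; case: ha => [->|[->|[->|[->|[->|[->|[->|[->|[->|[->|->]]]]]]]]]];
    case: hb => [->|[->|[->|[->|->]]]] //.
Qed.

(** When the origin is too far, the next vertex in the direction of the larger
    coordinate is near enough. *)
Lemma hex_round1 (x y : rat) : 0 <= x <= 1/2%:R -> 0 <= y <= 1/2%:R ->
  exists m n : int, (x - m%:~R) ^+ 2 + (x - m%:~R) * (y - n%:~R) + (y - n%:~R) ^+ 2 < 1/2%:R.
Proof.
move=> /andP[x0 x1] /andP[y0 y1].
have [h|h] := ltrP (x ^+ 2 + x * y + y ^+ 2) (1/2%:R).
  by exists 0, 0; rewrite !subr0.
case: (lerP y x) => xy.
  by exists 1, 0; rewrite subr0 mulr1z; nra.
by exists 0, 1; rewrite subr0 mulr1z; nra.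
Qed.

Lemma hex_round (x y : rat) :
  exists m n : int, (x - m%:~R) ^+ 2 - (x - m%:~R) * (y - n%:~R) + (y - n%:~R) ^+ 2 < 1/2%:R.
Proof.
have [a /andP[a1 a2]] := rat_round x; have [b /andP[b1 b2]] := rat_round y.
set u := x - a%:~R in a1 a2; set v := y - b%:~R in b1 b2.
suff [m [n h]] : exists m n : int,
    (u - m%:~R) ^+ 2 - (u - m%:~R) * (v - n%:~R) + (v - n%:~R) ^+ 2 < 1/2%:R.
  exists (a + m), (b + n); rewrite !rmorphD /= !opprD !addrA; exact: h.
case: (lerP 0 u) => u0; case: (lerP 0 v) => v0.
- exists 0, 0; rewrite !subr0; nra.
- have [||m [n h]] := @hex_round1 u (- v); try lra.
  by exists m, (- n); rewrite rmorphN; apply: le_lt_trans h; lra.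
- have [||m [n h]] := @hex_round1 (- u) v; try lra.
  by exists (- m), n; rewrite rmorphN; apply: le_lt_trans h; lra.
- exists 0, 0; rewrite !subr0; nra.
Qed.

(** Euclidean division for Z[i][w], w a primitive cube root of 1: with P1 and
    P2 the hexagonal forms of the real and the imaginary parts, the relative norm
    has norm at most (P1 + P2)^2, and rounding makes both forms less than 1/2. *)
Lemma eisenstein_round (E : gaussian_field) (a b : E) : a \in qi -> b \in qi ->
  exists z w, [/\ z \in zi, w \in zi &
    Nm ((a - z) ^+ 2 - (a - z) * (b - w) + (b - w) ^+ 2) < 1].
Proof.
case/qiP=> a1 [a2 ->] /qiP[b1 [b2 ->]].
have [m1 [n1 h1]] := hex_round a1 b1; have [m2 [n2 h2]] := hex_round a2 b2.
exists (cplx E m1%:~R m2%:~R), (cplx E n1%:~R n2%:~R); split; try (by apply/ziP; do 2 eexists).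
rewrite !cplxB; set x1 := a1 - _ in h1 *; set y1 := b1 - _ in h1 *.
set x2 := a2 - _ in h2 *; set y2 := b2 - _ in h2 *.
rewrite !expr2 !cplxM cplxB cplxD Nm_cplx.
set P1 := x1 ^+ 2 - x1 * y1 + y1 ^+ 2 in h1; set P2 := x2 ^+ 2 - x2 * y2 + y2 ^+ 2 in h2.
have p1 : 0 <= P1 by rewrite /P1; nra.
have p2 : 0 <= P2 by rewrite /P2; nra.
set N := (X in X < 1).
have -> : N = (P1 + P2) ^+ 2 - 3%:R * (x1 * y2 - x2 * y1) ^+ 2 by rewrite /N /P1 /P2; ring.
have := sqr_ge0 (x1 * y2 - x2 * y1); move: (_ ^+ 2) => D D0.
nra.
Qed.

(** A primitive cube root of 1 in Q(i) would be (w - 1) / 2 for such a w. *)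
Lemma three_nonsq (E : gaussian_field) (w : E) : w \in qi -> w ^+ 2 <> - 3%:R.
Proof.
case/qiP=> a [b ->]; rewrite expr2 cplxM => e.
have : cplx E (a * a - b * b) (a * b + b * a) = cplx E (-3%:R) 0.
  by rewrite e /cplx rmorph0 mul0r addr0 rmorphN rmorph_nat.
case/cplx_inj => e1 e2; have /eqP : a * b = 0 by lra.
rewrite mulf_eq0 => /orP[] /eqP z; last by move: e1; rewrite z; nra.
have eb : b ^+ 2 = 3%:R by move: e1; rewrite z; lra.
have [n en] : exists n : int, b = n%:~R.
  apply: (@rat_int _ ('X^2 - 3%:R)).
    by rewrite monicE lead_coefDl ?lead_coefXn // size_polyXn size_polyN -polyC_natr size_polyC.
  by rewrite rmorphB /= map_polyXn rmorph_nat /root !hornerE eb subrr.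
have : n ^+ 2 = 3 by apply: (@intr_inj rat); rewrite rmorphXn /= -en eb.
rewrite expr2 => h; have : -2 <= n <= 2 by nia.
move=> hn; have : n = -2 \/ n = -1 \/ n = 0 \/ n = 1 \/ n = 2 by lia.
by case=> [hh|[hh|[hh|[hh|hh]]]]; rewrite hh in h; lia.
Qed.

(** With q = x^2 + y^2, the right-hand side is q^2 + 54 q + 729 - 108 x^2, and
    the hypotheses say 10 |x| <= 23 + q. *)
Lemma unit_move_bound (x y : rat) :
  2%:R <= (5%:R + x) ^+ 2 + y ^+ 2 -> 2%:R <= (5%:R - x) ^+ 2 + y ^+ 2 ->
  200%:R <= (27%:R - (x ^+ 2 - y ^+ 2)) ^+ 2 + (2%:R * x * y) ^+ 2.
Proof.
move=> h1 h2; pose q := x ^+ 2 + y ^+ 2.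
have q0 : 0 <= q by rewrite addr_ge0 ?sqr_ge0.
have xq : x ^+ 2 <= q by rewrite lerDl sqr_ge0.
have -> : (27%:R - (x ^+ 2 - y ^+ 2)) ^+ 2 + (2%:R * x * y) ^+ 2 =
    q ^+ 2 + 54%:R * q + 729%:R - 108%:R * x ^+ 2 by rewrite /q; ring.
have b1 : 0 <= 23%:R + q - 10%:R * x by rewrite /q; lra.
have b2 : 0 <= 23%:R + q + 10%:R * x by rewrite /q; lra.
have := mulr_ge0 b1 b2; clear -q0 xq; move=> b.
have hx : 100%:R * x ^+ 2 <= (23%:R + q) ^+ 2.
  by rewrite -subr_ge0; apply: le_trans b _; rewrite le_eqVlt; apply/orP; left; apply/eqP; ring.
clearbody q.
have [h|h] := lerP 200%:R ((q - 27%:R) ^+ 2); nra.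
Qed.

Lemma scale_bound (a b : rat) : a * 200%:R <= 4%:R ^+ 2 * b -> 25%:R * a <= b * 2%:R.
Proof. lra. Qed.

(** All solutions of 4 f = m^2 + 27 k^2 in Gaussian integers for a given
    k^2 = u + v i and |Re m|, |Im m| <= 9, tested against P by computation. *)
Definition norm_eq_check (P : int -> int -> bool) (u v : int) : bool :=
  all (fun i => all (fun j => let a := Posz i - 9 in let b := Posz j - 9 in
    let x := a ^+ 2 - b ^+ 2 + 27 * u in let y := 2 * a * b + 27 * v in
    [&& (4 %| x)%Z & (4 %| y)%Z] ==> P (x %/ 4)%Z (y %/ 4)%Z) (iota 0 19)) (iota 0 19).

Lemma norm_eq_checkP P u v a b f1 f2 : norm_eq_check P u v -> 
  `|a| <= 9 -> `|b| <= 9 ->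
  4 * f1 = a ^+ 2 - b ^+ 2 + 27 * u -> 4 * f2 = 2 * a * b + 27 * v -> P f1 f2.
Proof.
move=> h ha hb e1 e2.
have [i [hi ei]] : exists i : nat, (i < 19)%N /\ a = Posz i - 9 by exists (absz (a + 9)); lia.
have [j [hj ej]] : exists j : nat, (j < 19)%N /\ b = Posz j - 9 by exists (absz (b + 9)); lia.
move/allP: h => /(_ i); rewrite mem_iota hi => /(_ isT)/allP/(_ j).
rewrite mem_iota hj => /(_ isT) /=.
rewrite -ei -ej -e1 -e2 ![4 * _]mulrC !dvdz_mull //= !mulzK //.
Qed.

(** Here f = f1 + f2 i, m = a + b i and k^2 = u + v i, with kappa the norm of
    k; the bound f1^2 + f2^2 < 96 makes N(m) at most 99, which leaves finitely
    many cases. *)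
Lemma norm_eq_enum (kappa : nat) (u v f1 f2 a b : int) :
  4 * f1 = a ^+ 2 - b ^+ 2 + 27 * u -> 4 * f2 = 2 * a * b + 27 * v ->
  (kappa = 1%N /\ v = 0 /\ (u = 1 \/ u = -1)) \/ (kappa = 2%N /\ u = 0 /\ (v = 2 \/ v = -2)) ->
  25 * (kappa%:Z ^+ 2) <= 2 * (f1 ^+ 2 + f2 ^+ 2) ->
  f1 ^+ 2 + f2 ^+ 2 < 96 ->
  if kappa == 1%N then 67 < f1 ^+ 2 + f2 ^+ 2 \/ f1 ^+ 2 + f2 ^+ 2 \in [:: 13; 37; 49; 61]
  else f1 ^+ 2 + f2 ^+ 2 \in [:: 52; 81].
Proof.
move=> e1 e2 hk low up.
have [hf1 hf2] : - 9 <= f1 <= 9 /\ - 9 <= f2 <= 9.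
  by apply: sqr_bound => //; apply: lt_trans up _.
have [ha hb] : - 9 <= a <= 9 /\ - 9 <= b <= 9.
  apply: sqr_bound => //; clear low.
  have e : (a ^+ 2 + b ^+ 2) ^+ 2 = (4 * f1 - 27 * u) ^+ 2 + (4 * f2 - 27 * v) ^+ 2.
    by rewrite e1 e2; ring.
  rewrite ltNge; apply/negP => h.
  have : 100 ^+ 2 <= (a ^+ 2 + b ^+ 2) ^+ 2 by rewrite ler_sqr // nnegrE addr_ge0 ?sqr_ge0.
  rewrite e; clear e e1 e2 h.
  case: hk => [[_ [-> [->|->]]]|[_ [-> [->|->]]]] h; move: h up; rewrite !expr2; nia.
rewrite -!ler_norml in ha hb.
case: hk => [[-> [ev eu]]|[-> [eu ev]]] in low *; rewrite /=.
  have : (f1 ^+ 2 + f2 ^+ 2 < 13) || (67 < f1 ^+ 2 + f2 ^+ 2) || (f1 ^+ 2 + f2 ^+ 2 \in [:: 13; 37; 49; 61]).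
    apply: (@norm_eq_checkP (fun f1 f2 => (f1 ^+ 2 + f2 ^+ 2 < 13) || (67 < f1 ^+ 2 + f2 ^+ 2) || (f1 ^+ 2 + f2 ^+ 2 \in [:: 13; 37; 49; 61])) u v a b) => //.
    by rewrite ev; case: eu => ->; vm_compute.
  move=> /orP[/orP[h|h]|h]; [exfalso|by left|by right].
  by clear -low h; lia.
have : (f1 ^+ 2 + f2 ^+ 2 < 50) || (95 < f1 ^+ 2 + f2 ^+ 2) || (f1 ^+ 2 + f2 ^+ 2 \in [:: 52; 81]).
  apply: (@norm_eq_checkP (fun f1 f2 => (f1 ^+ 2 + f2 ^+ 2 < 50) || (95 < f1 ^+ 2 + f2 ^+ 2) || (f1 ^+ 2 + f2 ^+ 2 \in [:: 52; 81])) u v a b) => //.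
  by rewrite eu; case: ev => ->; vm_compute.
move=> /orP[/orP[h|h]|//]; exfalso; [clear -low h; lia|clear -up h; lia].
Qed.

(** The comparisons that close the cases of lower_bound; each is a lemma of its own
    so that no larger goal has to compute with these unary numerals. *)
Lemma num37 : (3 ^ 6 * 13 ^ 4 <= 37 ^ 5)%N. Proof. lia. Qed.
Lemma num13 : (3 ^ 6 * 13 ^ 4 <= 13 ^ 5 * 4 ^ 3)%N. Proof. lia. Qed.
Lemma num68 : (3 ^ 6 * 13 ^ 4 <= 68 ^ 4)%N. Proof. lia. Qed.
Lemma num96 : (4 * (3 ^ 6 * 13 ^ 4) <= 96 ^ 4)%N. Proof. lia. Qed.
Lemma num81 : (3 ^ 6 * 13 ^ 4 <= 81 ^ 4)%N. Proof. lia. Qed.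
Lemma num200 : (2 * (3 ^ 6 * 13 ^ 4) <= 25 * 200 ^ 3)%N. Proof. lia. Qed.

Lemma sum_sq_not3 (a b : int) (k : nat) : absz (a ^+ 2 + b ^+ 2) <> (4 * k + 3)%N.
Proof.
have [p [r [-> hr]]] : exists p r, a = 2 * p + r /\ (r = 0 \/ r = 1).
  by exists (a %/ 2)%Z, (a %% 2)%Z; lia.
have [q [u [-> hu]]] : exists q u, b = 2 * q + u /\ (u = 0 \/ u = 1).
  by exists (b %/ 2)%Z, (b %% 2)%Z; lia.
rewrite !expr2; have := sqr_ge0 (2 * p + r); have := sqr_ge0 (2 * q + u); rewrite !expr2.
by case: hr hu => -> [] ->; lia.
Qed.

(** Here k, f and n are the norms of k, f and d: n >= f^4 / k^2, which is
    at least 25 f^3 / 2, and k >= 4 gives f >= 200. *)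
Lemma disc_bound_large_k (B c k f n : nat) : (2 * B <= 25 * c ^ 3)%N -> c = 200%N ->
  (25 * k ^ 2 <= 2 * f)%N -> (4 <= k)%N -> (f ^ 4 <= k ^ 2 * n)%N -> (B <= n)%N.
Proof.
move=> hB ec h k4 hn; have f200 : (c <= f)%N by rewrite ec; clear -h k4; nia.
have f3 : (c ^ 3 <= f ^ 3)%N by rewrite leq_exp2r.
have k0 : (0 < k ^ 2)%N by rewrite expn_gt0 (leq_trans _ k4).
rewrite -(leq_pmul2l (isT : 0 < 2)%N) -(leq_pmul2l k0).
apply: leq_trans (_ : k ^ 2 * (25 * c ^ 3) <= _)%N; first by rewrite leq_mul2l hB orbT.
apply: leq_trans (_ : (25 * k ^ 2) * f ^ 3 <= _)%N.
  by rewrite mulnCA mulnA leq_mul2l f3 orbT.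
apply: leq_trans (_ : (2 * f) * f ^ 3 <= _)%N; first by rewrite leq_mul2r h orbT.
by rewrite -mulnA -expnS mulnCA leq_mul2l hn orbT.
Qed.

Lemma disc_bound_large_f (B c k f n : nat) : (4 * B <= c ^ 4)%N -> (c <= f)%N -> (k < 4)%N -> k <> 3%N ->
  (f ^ 4 <= k ^ 2 * n)%N -> (B <= n)%N.
Proof.
move=> hB cf k4 k3 hn; rewrite -(leq_pmul2l (isT : 0 < 4)%N); apply: leq_trans hB _.
have : (c ^ 4 <= f ^ 4)%N by rewrite leq_exp2r.
move/leq_trans; apply; apply: leq_trans hn _; rewrite leq_mul2r.
by case: k k4 k3 => [|[|[|[|]]]] // _ _; rewrite orbT.
Qed.

Lemma even_pair (f1 f2 : int) : f1 ^+ 2 + f2 ^+ 2 = 52 -> exists g1 g2, f1 = 2 * g1 /\ f2 = 2 * g2.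
Proof.
have [p [r [-> hr]]] : exists p r, f1 = 2 * p + r /\ (r = 0 \/ r = 1).
  by exists (f1 %/ 2)%Z, (f1 %% 2)%Z; lia.
have [q [u [-> hu]]] : exists q u, f2 = 2 * q + u /\ (u = 0 \/ u = 1).
  by exists (f2 %/ 2)%Z, (f2 %% 2)%Z; lia.
move=> e; exists p, q; move: e; rewrite !expr2.
by case: hr hu => -> [] ->; lia.
Qed.

Lemma unit_cases (kappa : nat) (k1 k2 : int) : (0 < kappa)%N -> (kappa < 4)%N -> kappa <> 3%N ->
  kappa = absz (k1 ^+ 2 + k2 ^+ 2) ->
  (kappa = 1%N /\ 2 * k1 * k2 = 0 /\ (k1 ^+ 2 - k2 ^+ 2 = 1 \/ k1 ^+ 2 - k2 ^+ 2 = -1)) \/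
  (kappa = 2%N /\ k1 ^+ 2 - k2 ^+ 2 = 0 /\ (2 * k1 * k2 = 2 \/ 2 * k1 * k2 = -2)).
Proof.
move=> k0 k4 k3 e.
have e' : k1 ^+ 2 + k2 ^+ 2 = kappa%:Z by rewrite e gez0_abs // addr_ge0 ?sqr_ge0.
have [h1 h2] : - 1 <= k1 <= 1 /\ - 1 <= k2 <= 1 by apply: sqr_bound => //; rewrite e'; lia.
clear e; have {}h1 : k1 = -1 \/ k1 = 0 \/ k1 = 1 by lia.
have {}h2 : k2 = -1 \/ k2 = 0 \/ k2 = 1 by lia.
by case: h1 e' => [->|[->|->]]; case: h2 => [->|[->|->]]; rewrite !expr2; lia.
Qed.

Lemma norm_eq_coords (E : gaussian_field) (f1 f2 a b k1 k2 : int) :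
  4%:R * cplx E f1%:~R f2%:~R = cplx E a%:~R b%:~R ^+ 2 + 27%:R * cplx E k1%:~R k2%:~R ^+ 2 ->
  4 * f1 = a ^+ 2 - b ^+ 2 + 27 * (k1 ^+ 2 - k2 ^+ 2) /\
  4 * f2 = 2 * a * b + 27 * (2 * k1 * k2).
Proof.
have nE n : n%:R = cplx E n%:R 0 by rewrite /cplx rmorph0 mul0r addr0 rmorph_nat.
rewrite !expr2 !nE !cplxM cplxD => /cplx_inj[e1 e2].
split; apply: (@intr_inj rat); rewrite !(rmorphD, rmorphB, rmorphM, rmorphXn) /=; [move: e1|move: e2]; lra.
Qed.

(** * Arithmetic of cyclic sextic extensions of Q(i) *)

Section Sextic.
Variables (E : gaussian_field) (s t : {rmorphism E -> E}).
Hypothesis s3 : forall x, s (s (s x)) = x.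
Hypothesis t2 : forall x, t (t x) = x.
Hypothesis st : forall x, s (t x) = t (s x).
Hypothesis fixst : forall x, s x = x -> t x = x -> x \in qi.
Hypothesis sI : s (gf_i E) = gf_i E.
Hypothesis tI : t (gf_i E) = gf_i E.
Hypothesis s_nid : exists x, s x <> x.
Hypothesis t_nid : exists x, t x <> x.

Lemma oE_map (f : {rmorphism E -> E}) x : x \in oE -> f x \in oE.
Proof.
case/oEP=> p mp rp; apply/oEP; exists p => //.
have -> : map_poly intr p = map_poly f (map_poly intr p).
  by rewrite -map_poly_comp; apply: eq_map_poly => n /=; rewrite rmorph_int.
by rewrite fmorph_root.
Qed.

Lemma phi_fix (f : {rmorphism E -> E}) (r : rat) : f (gf_rat E r) = gf_rat E r.
Proof.
have d0 : (gf_rat E (denq r)%:~R) != 0 by rewrite phi_eq0 intr_eq0 denq_neq0.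
apply: (mulIf d0); rewrite -rmorphM -numqE !rmorph_int -[X in _ * X](rmorph_int f).
by rewrite -rmorphM -(rmorph_int (gf_rat E) (denq r)) -rmorphM -numqE !rmorph_int.
Qed.
Lemma s_qi x : x \in qi -> s x = x.
Proof. by case/qiP=> a [b ->]; rewrite /cplx rmorphD rmorphM !phi_fix sI. Qed.
Lemma t_qi x : x \in qi -> t x = x.
Proof. by case/qiP=> a [b ->]; rewrite /cplx rmorphD rmorphM !phi_fix tI. Qed.
Lemma fix_zi x : x \in oE -> s x = x -> t x = x -> x \in zi.
Proof. by move=> o /fixst h /h q; apply: qi_oE_zi. Qed.

Definition trL (x : E) : E := x + s x + s (s x).
Definition Tr (x : E) : E := trL x + t (trL x).
Definition nL (x : E) : E := x * s x * s (s x).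
Definition Nr (x : E) : E := nL x * t (nL x).

Lemma s_trL x : s (trL x) = trL x.
Proof. by rewrite /trL !rmorphD s3; ring. Qed.
Lemma s_nL x : s (nL x) = nL x.
Proof. by rewrite /nL !rmorphM s3; ring. Qed.
Lemma Tr_qi x : Tr x \in qi.
Proof.
by apply: fixst; rewrite /Tr rmorphD; [rewrite st s_trL|rewrite t2 addrC].
Qed.
Lemma Nr_qi x : Nr x \in qi.
Proof.
by apply: fixst; rewrite /Nr rmorphM; [rewrite st s_nL|rewrite t2 mulrC].
Qed.
Lemma Tr_zi x : x \in oE -> Tr x \in zi.
Proof.
by move=> o; apply: qi_oE_zi (Tr_qi x) _; rewrite rpredD ?oE_map // !rpredD ?oE_map.
Qed.
Lemma Nr_zi x : x \in oE -> Nr x \in zi.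
Proof.
by move=> o; apply: qi_oE_zi (Nr_qi x) _; rewrite rpredM ?oE_map // !rpredM ?oE_map.
Qed.

(** The six conjugates, indexed so that the block structure of the Galois group,
    a power of s followed or not by t, is visible on the index. *)
Definition cj (a : 'I_(3 + 3)) (x : E) : E :=
  match fintype.split a with inl k => iter k s x | inr k => t (iter k s x) end.

Lemma cj_l k x : cj (lshift 3 k) x = iter k s x.
Proof. by rewrite /cj (unsplitK (inl k)). Qed.
Lemma cj_r k x : cj (rshift 3 k) x = t (iter k s x).
Proof. by rewrite /cj (unsplitK (inr k)). Qed.

Lemma sum_cj x : \sum_a cj a x = Tr x.
Proof.
rewrite big_split_ord !big_ord_recl !big_ord0 /= !cj_l !cj_r /= /Tr /trL !rmorphD.
by rewrite !addr0 !addrA.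
Qed.
Lemma prod_cj x : \prod_a cj a x = Nr x.
Proof.
rewrite big_split_ord !big_ord_recl !big_ord0 /= !cj_l !cj_r /= /Nr /nL !rmorphM.
by rewrite !mulr1 !mulrA.
Qed.
Lemma cjM a x y : cj a (x * y) = cj a x * cj a y.
Proof.
have iM k : iter k s (x * y) = iter k s x * iter k s y.
  by elim: k => //= k ->; rewrite rmorphM.
by rewrite /cj; case: (fintype.split a) => k; rewrite iM ?rmorphM.
Qed.
Lemma cjD a x y : cj a (x + y) = cj a x + cj a y.
Proof.
have iM k : iter k s (x + y) = iter k s x + iter k s y.
  by elim: k => //= k ->; rewrite rmorphD.
by rewrite /cj; case: (fintype.split a) => k; rewrite iM ?rmorphD.
Qed.
Lemma cj_qi a x : x \in qi -> cj a x = x.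
Proof.
move=> q; have i k : iter k s x = x by elim: k => //= k ->; rewrite s_qi.
by rewrite /cj; case: (fintype.split a) => k; rewrite i ?t_qi.
Qed.
Lemma cj0 a : cj a 0 = 0. Proof. by rewrite cj_qi ?rpred0. Qed.
Lemma cj_sum a (J : finType) (F : J -> E) : cj a (\sum_j F j) = \sum_j cj a (F j).
Proof. by apply: (big_morph (cj a)) => [x y|]; rewrite ?cjD ?cj0. Qed.

Definition W (x : 'I_6 -> E) : 'M[E]_(6, 3 + 3) := \matrix_(j, a) cj a (x j).
Definition disc x := \det (W x : 'M_6) ^+ 2.

(** A product W D W^T with D diagonal gathers conjugates into traces. *)
Lemma W_twist d x y :
  (W x : 'M_6) *m diag_mx (\row_a cj a d) *m (W y : 'M_6)^T = \matrix_(j, k) Tr (d * (x j * y k)).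
Proof.
apply/matrixP=> j k; rewrite !mxE -sum_cj; apply: eq_bigr => a _.
rewrite mul_mx_diag !mxE !cjM; ring.
Qed.
Lemma WW x y : (W x : 'M_6) *m (W y : 'M_6)^T = \matrix_(j, k) Tr (x j * y k).
Proof.
apply/matrixP=> j k; rewrite !mxE -sum_cj; apply: eq_bigr => a _.
by rewrite !mxE !cjM.
Qed.

Lemma disc_trace x : \det (\matrix_(j < 6, k < 6) Tr (x j * x k)) = disc x.
Proof. by rewrite -WW det_mulmx det_tr. Qed.

Lemma det_twist d x y :
  \det (\matrix_(j < 6, k < 6) Tr (d * (x j * y k))) = \det (W x : 'M_6) * Nr d * \det (W y : 'M_6).
Proof.
rewrite -W_twist !det_mulmx det_tr det_diag -prod_cj; congr (_ * _ * _).
by apply: eq_bigr => a _; rewrite mxE.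
Qed.

Lemma disc_zi x : (forall j, x j \in oE) -> disc x \in zi.
Proof. by move=> ox; rewrite -disc_trace; apply: rpred_det => i j; rewrite mxE Tr_zi ?rpredM. Qed.

(** An element d of the inverse different gives divisors of the discriminant:
    the twisted trace form has integral entries and determinant disc * N(d). *)
Lemma disc_twist d x : (forall y, y \in oE -> Tr (d * y) \in zi) ->
  (forall j, x j \in oE) -> disc x * Nr d \in zi.
Proof.
move=> hd ox; have -> : disc x * Nr d = \det (\matrix_(j < 6, k < 6) Tr (d * (x j * x k))).
  by rewrite det_twist /disc; ring.
by apply: rpred_det => i j; rewrite mxE hd ?rpredM.
Qed.

(** The three columns of W that do not involve t; the others are their images
    under t. *)
Definition half_W (x : 'I_6 -> E) : 'M[E]_(6, 3) := \matrix_(j, k) iter k s (x j).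
Lemma W_row_mx x : W x = row_mx (half_W x) (map_mx t (half_W x)).
Proof.
apply/matrixP=> j a; rewrite -(splitK a); case: (fintype.split a) => k /=.
  by rewrite row_mxEl !mxE cj_l.
by rewrite row_mxEr !mxE cj_r.
Qed.

(** t exchanges the two blocks of three columns, an odd permutation. *)
Lemma t_detW x : t (\det (W x : 'M_6)) = - \det (W x : 'M_6).
Proof.
rewrite -det_map_mx.
have -> : map_mx t (W x : 'M_6) = (W x : 'M_6) *m (block_mx 0 1%:M 1%:M 0 : 'M_(3+3)).
  rewrite W_row_mx (mul_row_block (half_W x)) !mulmx1 !mulmx0 addr0 add0r.
  rewrite (map_row_mx t (half_W x)); have -> // : map_mx t (map_mx t (half_W x)) = half_W x.
  by apply/matrixP=> i j; rewrite !mxE t2.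
by rewrite det_mulmx (det_swap E 3) -signr_odd expr1 mulrN1.
Qed.

(** s permutes the columns by two 3-cycles, an even permutation. *)
Lemma s_detW x : s (\det (W x : 'M_6)) = \det (W x : 'M_6).
Proof.
rewrite -det_map_mx.
pose C : 'M[E]_3 := \matrix_(i, j) ((i == ordS j)%:R).
have sP : map_mx s (half_W x) = half_W x *m C.
  apply/matrixP=> i j; rewrite !mxE (bigD1 (ordS j)) //= big1 => [|k /negPf nk]; last first.
    by rewrite !mxE nk mulr0.
  rewrite addr0 !mxE eqxx mulr1.
  by case: j => -[|[|[|]]] //= ?; rewrite s3.
have -> : map_mx s (W x : 'M_6) = (W x : 'M_6) *m (block_mx C 0 0 C : 'M_(3+3)).
  rewrite W_row_mx (mul_row_block (half_W x)) !mulmx0 addr0 add0r.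
  rewrite (map_row_mx s (half_W x)) sP.
  have -> : map_mx s (map_mx t (half_W x)) = map_mx t (map_mx s (half_W x)).
    by apply/matrixP=> i j; rewrite !mxE st.
  rewrite sP map_mxM; have -> // : map_mx t C = C.
  by apply/matrixP=> i j; rewrite !mxE rmorph_nat.
rewrite det_mulmx (det_ublock C 0 C).
suff -> : \det C = 1 by rewrite !mulr1.
rewrite (@det3 _ C (fun i j => (i == (j.+1 %% 3))%N%:R)) /=; first by ring.
by move=> i j; rewrite mxE -val_eqE.
Qed.

(** The coordinates are the values of the trace form against the dual basis. *)
Lemma coords x y : \det (W x : 'M_6) != 0 ->
  exists2 c : 'I_6 -> E, forall j, c j \in qi & y = \sum_j c j * x j.
Proof.
move=> dW; pose T := \matrix_(j < 6, k < 6) Tr (x j * x k).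
have uT : T \in unitmx by rewrite unitmxE unitfE disc_trace expf_neq0.
pose Y : 'rV[E]_6 := \row_k Tr (y * x k); pose c := Y *m invmx T.
have fixY (f : {rmorphism E -> E}) : (forall z, z \in qi -> f z = z) -> map_mx f c = c.
  move=> fq; rewrite /c map_mxM map_invmx; congr (_ *m invmx _); apply/matrixP=> i j.
    by rewrite !mxE fq ?Tr_qi.
  by rewrite !mxE fq ?Tr_qi.
exists (c 0) => [j|].
  by apply: fixst; [move/matrixP/(_ 0 j): (fixY _ s_qi)|move/matrixP/(_ 0 j): (fixY _ t_qi)]; rewrite mxE.
have uW : (W x : 'M_6)^T \in unitmx by rewrite unitmx_tr unitmxE unitfE.
have : c *m (W x : 'M_6) = \row_a cj a y.
  apply: (can_inj (mulmxK uW)); rewrite -mulmxA WW /c mulmxKV //.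
  apply/rowP => k; rewrite !mxE -sum_cj; apply: eq_bigr => a _.
  by rewrite !mxE cjM.
move/rowP/(_ (lshift 3 (0 : 'I_3))); rewrite !mxE cj_l /= => <-.
by apply: eq_bigr => j _; congr (_ * _); rewrite mxE cj_l.
Qed.

Lemma W_indep x (c : 'I_6 -> E) : \det (W x : 'M_6) != 0 -> (forall j, c j \in qi) ->
  \sum_j c j * x j = 0 -> forall j, c j = 0.
Proof.
move=> dW qc e j; have uW : (W x : 'M_6) \in unitmx by rewrite unitmxE unitfE.
have : (\row_j c j) *m (W x : 'M_6) = 0.
  apply/rowP => a; rewrite !mxE; transitivity (cj a (\sum_j c j * x j)); last by rewrite e cj0.
  rewrite cj_sum; apply: eq_bigr => k _.
  by rewrite !mxE cjM (cj_qi _ (qc k)).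
move/(canRL (mulmxK uW)); rewrite mul0mx => /rowP/(_ j); by rewrite !mxE.
Qed.

Definition subst_at (j0 : 'I_6) y (x : 'I_6 -> E) j := if j == j0 then y else x j.

Lemma detW_subst x (c : 'I_6 -> E) j0 : (forall j, c j \in qi) ->
  \det (W (subst_at j0 (\sum_j c j * x j) x) : 'M_6) = c j0 * \det (W x : 'M_6).
Proof.
move=> qc; pose M : 'M[E]_6 := \matrix_(i, j) if i == j0 then c j else (i == j)%:R.
have -> : (W (subst_at j0 (\sum_j c j * x j) x) : 'M_6) = M *m (W x : 'M_6).
  apply/matrixP=> i a; rewrite !mxE /subst_at; have [ij|ij] := eqVneq i j0.
    by rewrite cj_sum; apply: eq_bigr => j _; rewrite !mxE ij eqxx cjM (cj_qi _ (qc j)).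
  rewrite (bigD1 i) //= !mxE (negPf ij) eqxx mul1r big1 ?addr0 // => k ki.
  by rewrite !mxE (negPf ij) eq_sym (negPf ki) mul0r.
rewrite det_mulmx; congr (_ * _).
rewrite (expand_det_col _ j0) (bigD1 j0) //= big1 ?addr0; last first.
  by move=> i ij; rewrite mxE (negPf ij) mul0r.
rewrite mxE eqxx /cofactor -signr_odd addnn odd_double mul1r.
suff -> : row' j0 (col' j0 M) = 1%:M by rewrite det1 mulr1.
by apply/matrixP=> i k; rewrite !mxE eq_sym (negPf (neq_lift _ _)) (inj_eq lift_inj).
Qed.

Definition oE_basis (x : 'I_6 -> E) := [/\ forall j, x j \in oE, \det (W x : 'M_6) != 0 &
  forall y, y \in oE -> exists2 c : 'I_6 -> E, forall j, c j \in zi & y = \sum_j c j * x j].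

(** A family of integers of least discriminant spans: otherwise, some coordinate
    is not in Z[i], and replacing one vector by the remainder after rounding
    multiplies the discriminant by the square of a number of norm below 1. *)
Lemma min_basis : (exists x, (forall j, x j \in oE) /\ \det (W x : 'M_6) != 0) ->
  exists x, oE_basis x.
Proof.
case/(@ex_min _ _ (fun x => nm (disc x))) => x [ox dW] xmin; exists x; split=> // y oy.
have [c qc ey] := coords y dW; exists c => // j0.
have [z zz nz] := zi_round (qc j0).
have [cz|cz] := eqVneq (c j0 - z) 0; first by move/eqP: cz; rewrite subr_eq0 => /eqP ->.
pose c' j := if j == j0 then c j0 - z else c j.
have qc' j : c' j \in qi by rewrite /c'; case: ifP => _ //; rewrite rpredB // zi_qi.
have ey' : y - z * x j0 = \sum_j c' j * x j.
  rewrite ey !(bigD1 j0 (P := predT)) //= /c' eqxx mulrBl addrAC; congr (_ + _).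
  by apply: eq_bigr => j /negPf ->.
have dx' := detW_subst x j0 qc'; rewrite -ey' /c' eqxx in dx'.
have ox' j : subst_at j0 (y - z * x j0) x j \in oE.
  by rewrite /subst_at; case: ifP => // _; rewrite rpredB ?rpredM // zi_oE.
have dW' : \det (W (subst_at j0 (y - z * x j0) x) : 'M_6) != 0 by rewrite dx' mulf_neq0.
have d0 : disc x != 0 by rewrite expf_neq0.
have dn0 : 0 < Nm (disc x) by rewrite lt_def Nm_ge0 andbT Nm_eq0 ?zi_qi ?disc_zi.
have := xmin _ (conj ox' dW'); rewrite -(ler_nat rat) -!nmE ?disc_zi //.
have qz : c j0 - z \in qi by rewrite rpredB // zi_qi.
rewrite [disc (subst_at _ _ _)]/disc dx' exprMn -/(disc x) [X in _ <= X]NmM ?(rpredX _ qz) ?(zi_qi (disc_zi ox)) //.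
rewrite leNgt NmX //; case/negP.
by rewrite -[ltRHS]mul1r ltr_pM2r // expr_lt1 // Nm_ge0.
Qed.

(** The characteristic polynomial p of x has coefficients in Q(i); with n a
    common denominator, n x is a root of the monic polynomial n^deg p(X / n). *)
Lemma clear_denom (x : E) : exists2 n : nat, n != 0%N & n%:R * x \in oE.
Proof.
pose f := ('X - x%:P) * ('X - (s x)%:P) * ('X - (s (s x))%:P).
pose p := f * map_poly t f.
have sf : map_poly s f = f.
  by rewrite /f !rmorphM !rmorphB /= !map_polyX !map_polyC /= s3; ring.
have fixp (g : {rmorphism E -> E}) : map_poly g p = p -> forall i, g p`_i = p`_i.
  by move=> e i; rewrite -{2}e coef_map.
have qp i : p`_i \in qi.
  apply: fixst; apply: fixp; rewrite /p rmorphM /=.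
    rewrite -map_poly_comp /= (@eq_map_poly _ _ (s \o t) (t \o s)) //.
    by rewrite map_poly_comp /= sf.
  have tt : map_poly (t \o t) f = f by apply: map_poly_id => z _; exact: t2.
  by rewrite -map_poly_comp /= tt mulrC.
have mf : f \is monic by rewrite /f !monicMr ?monicXsubC.
have mp : p \is monic by rewrite /p monicMr // map_monic.
have rp : root p x by rewrite /p /f !rootM root_XsubC eqxx.
have clr (q : E) : q \in qi -> exists2 n : nat, n != 0%N & n%:R * q \in oE.
  by move=> /qi_denom[n n0 z]; exists n; rewrite ?zi_oE.
have [n n0 hn] : exists2 n : nat, n != 0%N & forall i, n%:R * p`_i \in oE.
  suff H k : exists2 n : nat, n != 0%N & forall i, (i < k)%N -> n%:R * p`_i \in oE.
    have [n n0 h] := H (size p); exists n => // i; case: (ltnP i (size p)) => [/h //|le].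
    by rewrite nth_default // mulr0 rpred0.
  elim: k => [|k [n n0 hn]]; first by exists 1%N.
  have [m m0 hm] := clr _ (qp k); exists (n * m)%N; first by rewrite muln_eq0 negb_or n0.
  move=> i; rewrite ltnS leq_eqVlt natrM => /orP[/eqP ->|/hn h].
    by rewrite -mulrA rpredM ?rpred_nat.
  by rewrite mulrAC rpredM ?rpred_nat.
exists n => //.
have sp : (0 < size p)%N by rewrite lt0n size_poly_eq0 monic_neq0.
pose q := \poly_(i < size p) (n%:R ^+ ((size p).-1 - i) * p`_i).
have cq : q`_((size p).-1) = 1.
  by rewrite coef_poly prednK // leqnn subnn expr0 mul1r -(monicP mp).
have sq : size q = size p by rewrite size_poly_eq // -lead_coefE (monicP mp) subnn mulr1 oner_neq0.
apply/oEP; apply: (@integral_root_monic _ _ intr _ q).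
- by apply/monicP; rewrite lead_coefE sq cq.
- apply/rootP; rewrite horner_poly.
  have -> : \sum_(i < size p) n%:R ^+ ((size p).-1 - i) * p`_i * (n%:R * x) ^+ i
      = n%:R ^+ (size p).-1 * p.[x].
    rewrite horner_coef big_distrr /=; apply: eq_bigr => i _.
    have -> : n%:R ^+ (size p).-1 = n%:R ^+ ((size p).-1 - i) * n%:R ^+ i :> E.
      by rewrite -exprD subnK // -ltnS prednK.
    by rewrite exprMn mulrACA mulrA.
  by rewrite (rootP rp) mulr0.
apply/integral_poly => i; apply/oEP; rewrite coef_poly; case: ifP => [ip|_]; last exact: rpred0.
have [e|ne] := eqVneq i (size p).-1.
  by rewrite e subnn mul1r -lead_coefE (monicP mp) rpred1.
have -> : ((size p).-1 - i = ((size p).-1 - i).-1.+1)%N.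
  by rewrite prednK // subn_gt0 ltn_neqAle ne -ltnS prednK.
by rewrite exprSr -mulrA rpredM // rpredX ?rpred_nat.
Qed.

(** * The quadratic subfield *)

(** The products of the bases 1, th of L and 1, ka, ka^2 of K. *)
Definition kron (th ka : E) (a : 'I_(3 + 3)) : E :=
  match fintype.split a with inl k => ka ^+ k | inr k => th * ka ^+ k end.
Definition vand (x : E) := (x - s x) * (s x - s (s x)) * (s (s x) - x).
Definition dl (th : E) := (th - t th) ^+ 2.

(** W factors as a Kronecker product of the Vandermonde matrices of th and of
    ka, written as triangular blocks. *)
Lemma disc_kron th ka : s th = th -> t ka = ka -> disc (kron th ka) = dl th ^+ 3 * vand ka ^+ 4.
Proof.
move=> sth tka; pose V : 'M[E]_3 := \matrix_(j, k) (iter k s ka) ^+ j.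
have iX (k j : nat) x : iter k s (x ^+ j) = iter k s x ^+ j.
  by elim: k => //= k ->; rewrite rmorphXn.
have iM (k : nat) x : iter k s (th * x) = th * iter k s x.
  by elim: k => //= k ->; rewrite rmorphM sth.
have tk (k : nat) : t (iter k s ka) = iter k s ka by elim: k => //= k IH; rewrite -st IH.
have eW : (W (kron th ka) : 'M_(3 + 3)) =
    block_mx 1%:M 0 th%:M 1%:M *m block_mx 1%:M 1%:M 0 (t th - th)%:M *m block_mx V 0 0 V.
  rewrite !mulmx_block !mulmx1 !mul1mx !mul0mx !mulmx0 !add0r !addr0 -raddfD /= addrC subrK !mul_scalar_mx.
  apply/matrixP=> j a; rewrite -(splitK j) -(splitK a).
  case: (fintype.split j) => {}j; case: (fintype.split a) => {}a /=;
    rewrite ?(block_mxEul, block_mxEur, block_mxEdl, block_mxEdr) !mxE ?cj_l ?cj_r /kron.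
  - by rewrite (unsplitK (inl j)) iX mul1r.
  - by rewrite (unsplitK (inl j)) iX rmorphXn tk mul1r.
  - by rewrite (unsplitK (inr j)) iM iX.
  - by rewrite (unsplitK (inr j)) iM iX rmorphM rmorphXn tk.
have dV : \det V = vand ka.
  rewrite (@det3 _ V (fun j k => iter k s ka ^+ j)) /=; last by move=> i j; rewrite mxE.
  by rewrite /vand; ring.
rewrite /disc (_ : \det _ = (t th - th) ^+ 3 * vand ka ^+ 2); first by rewrite /dl; ring.
transitivity (\det (W (kron th ka) : 'M_(3+3))) => //.
rewrite eW !det_mulmx !det_ublock det_lblock !det1 dV det_scalar; ring.
Qed.

Lemma two_neq0 : 2%:R != 0 :> E. Proof. exact: natrE_neq0. Qed.
Lemma three_neq0 : 3%:R != 0 :> E. Proof. exact: natrE_neq0. Qed.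

Lemma opp_eq (x : E) : - x = x -> x = 0.
Proof.
move=> e; apply/eqP; have := two_neq0; apply: contraNT => x0.
by rewrite -(mulIr_eq0 _ (mulIf x0)) mulr2n mulrDl mul1r -{1}e addNr.
Qed.

Lemma ex_antisymmetric : exists2 y : E, y != 0 & s y = y /\ t y = - y.
Proof.
case: t_nid => x /eqP xt; have y0 : x - t x != 0 by rewrite subr_eq0 eq_sym.
exists (nL (x - t x)); first by rewrite /nL !mulf_neq0 ?fmorph_eq0.
split; first exact: s_nL.
by rewrite /nL !rmorphM -!st !rmorphB /= t2; ring.
Qed.

(** The integers that generate L, respectively K, over Q(i). *)
Definition adm_L x := [/\ x \in oE, s x = x & t x <> x].
Definition adm_K x := [/\ x \in oE, t x = x & s x <> x].

Lemma ex_L : exists x, adm_L x.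
Proof.
have [y y0 [sy ty]] := ex_antisymmetric; have [n n0 o] := clear_denom y.
exists (n%:R * y); split=> //; rewrite rmorphM rmorph_nat ?sy // ty mulrN => /opp_eq/eqP.
by rewrite mulf_eq0 (negPf y0) orbF; case: n n0 {o} => // n _; rewrite (negPf (natrE_neq0 _ _)).
Qed.

(** If s moves x but fixes x + t x, then it moves the square of y = x - t x,
    which is fixed by t. *)
Lemma ex_K : exists x, adm_K x.
Proof.
suff [y ty sy] : exists2 y, t y = y & s y <> y.
  have [n n0 o] := clear_denom y; exists (n%:R * y); split=> //.
    by rewrite rmorphM rmorph_nat ty.
  have nE : n%:R != 0 :> E by case: n n0 {o} => // n _; rewrite natrE_neq0.
  by rewrite rmorphM rmorph_nat => /(mulfI nE).
case: s_nid => x sx; have [e|] := eqVneq (s (x + t x)) (x + t x); last first.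
  by move/eqP=> h; exists (x + t x) => //; rewrite rmorphD /= t2 addrC.
pose y := x - t x; have ty : t y = - y by rewrite /y rmorphB /= t2; ring.
exists (y ^+ 2); first by rewrite rmorphXn ty sqrrN.
rewrite rmorphXn => /eqP; rewrite eqf_sqr => /orP[] /eqP h.
  have e2 : x * 2%:R = (x + t x) + y by rewrite /y; ring.
  apply: sx; apply: (mulIf two_neq0).
  transitivity (s (x * 2%:R)); first by rewrite rmorphM rmorph_nat.
  by rewrite e2 rmorphD e h.
have y0 : y = 0 by apply: opp_eq; rewrite -{2}[y]s3 h !rmorphN h rmorphN h !opprK.
have tx : x + t x = x * 2%:R.
  have -> : t x = x by apply/eqP; rewrite eq_sym -subr_eq0 -/y y0.
  by rewrite mulr_natr mulr2n.
apply: sx; apply: (mulIf two_neq0).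
transitivity (s (x * 2%:R)); first by rewrite rmorphM rmorph_nat.
by rewrite -tx e.
Qed.

Lemma ex_kron : exists x : 'I_6 -> E, (forall j, x j \in oE) /\ \det (W x : 'M_6) != 0.
Proof.
have [th [oth sth tth]] := ex_L; have [ka [oka tka ska]] := ex_K.
exists (kron th ka); split=> [j|].
  by rewrite /kron; case: fintype.split => k; rewrite ?rpredM ?rpredX.
suff : disc (kron th ka) != 0.
  by apply: contra => /eqP d0; rewrite /disc d0 expr0n.
rewrite disc_kron // mulf_neq0 ?expf_neq0 //.
  by rewrite subr_eq0; apply/eqP=> /esym.
have sk : s ka - ka != 0 by rewrite subr_eq0; apply/eqP.
have e1 : ka - s ka != 0 by rewrite -opprB oppr_eq0.
rewrite /vand !mulf_neq0 //; first by rewrite -rmorphB fmorph_eq0.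
by rewrite -{2}[ka]s3 -!rmorphB !fmorph_eq0.
Qed.

Lemma ex_oE_basis : exists x, oE_basis x.
Proof. exact: min_basis ex_kron. Qed.

Definition span_L th := forall y, y \in oE -> s y = y ->
  exists a b, [/\ a \in zi, b \in zi & y = a + b * th].

Lemma dl_qi th : s th = th -> dl th \in qi.
Proof.
move=> sth; apply: fixst; rewrite /dl rmorphXn rmorphB /= ?t2 ?st ?sth //.
by rewrite -opprB sqrrN.
Qed.
Lemma dl_zi th : adm_L th -> dl th \in zi.
Proof.
move=> [o sth _]; apply: qi_oE_zi; first exact: dl_qi.
by rewrite rpredX ?rpredB ?oE_map.
Qed.

(** A generator of least discriminant: subtracting from y the rounded multiple
    of th leaves a remainder y', whose discriminant would be smaller unless y'
    lies in Q(i). *)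
Lemma L_struct : exists2 th, adm_L th & span_L th.
Proof.
have [th ath thmin] := @ex_min _ _ (fun x => nm (dl x)) ex_L.
exists th => // y oy sy; have [oth sth /eqP tth] := ath.
have d0 : th - t th != 0 by rewrite subr_eq0 eq_sym.
pose b := (y - t y) / (th - t th).
have qb : b \in qi.
  apply: fixst; rewrite /b fmorph_div !rmorphB /= ?st ?sy ?sth // !t2.
  by rewrite -[y - t y]opprB -[th - t th]opprB invrN mulrNN.
have [z zz nz] := zi_round qb.
have tz : t z = z by rewrite t_qi ?zi_qi.
have sz : s z = z by rewrite s_qi ?zi_qi.
pose y' := y - z * th.
have oy' : y' \in oE by rewrite rpredB ?rpredM // zi_oE.
have sy' : s y' = y' by rewrite rmorphB rmorphM /= sy sz sth.
have ey' : y' - t y' = (b - z) * (th - t th).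
  by rewrite /y' rmorphB rmorphM /= tz mulrBl divfK //; ring.
have [bz|bz] := eqVneq (b - z) 0; last first.
  have /thmin : adm_L y'.
    by split=> // /eqP; rewrite eq_sym -subr_eq0 ey' mulf_eq0 (negPf bz) (negPf d0).
  have zy : dl y' \in zi.
    by apply: dl_zi; split=> // /eqP; rewrite eq_sym -subr_eq0 ey' mulf_eq0 (negPf bz) (negPf d0).
  rewrite -(ler_nat rat) -(nmE zy) -(nmE (dl_zi ath)) [dl y']/dl ey' exprMn -/(dl th).
  have qbz : b - z \in qi by rewrite rpredB // zi_qi.
  rewrite [X in _ <= X]NmM ?(rpredX _ qbz) ?(dl_qi sth) // leNgt NmX //; case/negP.
  rewrite -[ltRHS]mul1r ltr_pM2r ?expr_lt1 ?Nm_ge0 //.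
  by rewrite lt_def Nm_ge0 andbT Nm_eq0 ?(dl_qi sth) // expf_neq0.
have eb : b = z by apply/eqP; rewrite -subr_eq0 bz.
exists y', z; split=> //; last by rewrite /y' subrK.
apply: fix_zi => //; apply/eqP; rewrite eq_sym -subr_eq0 ey' bz mul0r //.
Qed.

Lemma dl_class th : adm_L th -> exists e n, [/\ e \in zi, n \in zi & dl th = e ^+ 2 - 4%:R * n].
Proof.
move=> [o sth _]; exists (th + t th), (th * t th); split; last by rewrite /dl; ring.
  by apply: fix_zi; rewrite ?rpredD ?oE_map // rmorphD /= ?t2 ?st ?sth // addrC.
by apply: fix_zi; rewrite ?rpredM ?oE_map // rmorphM /= ?t2 ?st ?sth // mulrC.
Qed.

Lemma dl_nonsq th w : adm_L th -> w \in qi -> dl th <> w ^+ 2.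
Proof.
move=> [_ sth tth] qw /eqP; rewrite /dl eqf_sqr => h.
have tw := t_qi qw.
have h' : t (th - t th) = th - t th by case/orP: h => /eqP ->; rewrite ?rmorphN tw.
apply: tth; apply/eqP; rewrite eq_sym -subr_eq0; apply/eqP/opp_eq.
by rewrite -{2}h' rmorphB t2 opprB.
Qed.

(** A number e^2 - 4 n is congruent to a square modulo 4. *)
Lemma zi_class (d e n : E) : e \in zi -> n \in zi -> d = e ^+ 2 - 4%:R * n ->
  (forall w, w \in zi -> d <> w ^+ 2) -> [/\ (9 <= nm d)%N, nm d <> 13%N & nm d <> 26%N].
Proof.
case/ziP=> e1 [e2 ->] /ziP[n1 [n2 ->]] ed nsq.
have [p [r [Ep hr]]] : exists p r, e1 = 2 * p + r /\ (r = 0 \/ r = 1).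
  by exists (e1 %/ 2)%Z, (e1 %% 2)%Z; lia.
have [q [u [Eq hu]]] : exists q u, e2 = 2 * q + u /\ (u = 0 \/ u = 1).
  by exists (e2 %/ 2)%Z, (e2 %% 2)%Z; lia.
have e4 : 4%:R = cplx E 4%:~R 0 by rewrite /cplx rmorph0 mul0r addr0 rmorph_int.
pose A := p ^+ 2 - q ^+ 2 + p * r - q * u - n1.
pose B := 2 * p * q + p * u + q * r - n2.
have {}ed : d = cplx E (4 * A + (r ^+ 2 - u ^+ 2))%:~R (4 * B + 2 * r * u)%:~R.
  rewrite ed e4 expr2 !cplxM cplxB /A /B Ep Eq; congr cplx;
    by rewrite !(rmorphD, rmorphB, rmorphM, rmorphXn) /=; ring.
move: A B ed => A B ed.
have nsqi x y : cplx E x%:~R y%:~R \in zi by apply/ziP; exists x, y.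
have sq0 := nsq _ (nsqi 0 0); have sq1 := nsq _ (nsqi 1 0); have sq2 := nsq _ (nsqi 0 1).
have sq3 := nsq _ (nsqi 1 1); have sq4 := nsq _ (nsqi 1 (-1)).
have no x y z w : cplx E x%:~R y%:~R ^+ 2 = cplx E z%:~R w%:~R -> d <> cplx E x%:~R y%:~R ^+ 2 ->
    ~ (4 * A + (r ^+ 2 - u ^+ 2) = z /\ 4 * B + 2 * r * u = w).
  by move=> e1' h [h1 h2]; apply: h; rewrite ed h1 h2 e1'.
have n0 := no 0 0 0 0; have n1' := no 1 0 1 0; have n2' := no 0 1 (-1) 0.
have n3 := no 1 1 0 2; have n4 := no 1 (-1) 0 (-2).
have E0 x y z w : x ^+ 2 - y ^+ 2 = z -> 2 * x * y = w -> cplx E x%:~R y%:~R ^+ 2 = cplx E z%:~R w%:~R.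
  move=> <- <-; rewrite expr2 cplxM; congr cplx; rewrite !(rmorphB, rmorphM, rmorphXn) /=; ring.
have {}n0 := n0 (E0 0 0 0 0 erefl erefl) sq0.
have {}n1' := n1' (E0 1 0 1 0 erefl erefl) sq1.
have {}n2' := n2' (E0 0 1 (-1) 0 erefl erefl) sq2.
have {}n3 := n3 (E0 1 1 0 2 erefl erefl) sq3.
have {}n4 := n4 (E0 1 (-1) 0 (-2) erefl erefl) sq4.
rewrite ed nm_cplx; set a := 4 * A + _ in n0 n1' n2' n3 n4 *; set b := 4 * B + _ in n0 n1' n2' n3 n4 *.
have ab : (a = 4 * A + (r ^+ 2 - u ^+ 2)) /\ b = 4 * B + 2 * r * u by [].
clearbody a b.
have {}ab : (a = 4 * A /\ b = 4 * B) \/ (a = 4 * A - 1 /\ b = 4 * B) \/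
    (a = 4 * A + 1 /\ b = 4 * B) \/ (a = 4 * A /\ b = 4 * B + 2).
  by case: ab => -> ->; case: hr hu => -> [] ->; lia.
have [g1 g2 g3] := square_class_int ab n0 n1' n2' n3 n4.
by clear -g1 g2 g3; split; lia.
Qed.

(** If p^2 divides dl, then (th - t th) / p is an integer a + b th of L, and
    applying 1 - t gives 2 = b p. *)
Lemma dl_sqfree th p : adm_L th -> span_L th -> p \in zi -> p != 0 ->
  zdvd (p ^+ 2) (dl th) -> zdvd p 2%:R.
Proof.
move=> [oth sth /eqP tth] sp zp p0 [c zc ec].
have sP := s_qi (zi_qi zp); have tP := t_qi (zi_qi zp).
have d0 : th - t th != 0 by rewrite subr_eq0 eq_sym.
have o : (th - t th) / p \in oE.
  by apply: sqr_oE; rewrite exprMn -/(dl th) ec exprVn mulfK ?expf_neq0 // zi_oE.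
have [|a [b [za zb e]]] := sp _ o; first by rewrite fmorph_div rmorphB /= st sth sP.
exists b => //.
have e' : th - t th = a * p + b * p * th.
  by rewrite -[LHS](divfK p0) e; ring.
have : (th - t th) - t (th - t th) = b * p * (th - t th).
  transitivity (a * p + b * p * th - t (a * p + b * p * th)); first by rewrite -e'.
  by rewrite rmorphD !rmorphM /= tP (t_qi (zi_qi za)) (t_qi (zi_qi zb)); ring.
have -> : (th - t th) - t (th - t th) = 2%:R * (th - t th) by rewrite rmorphB t2; ring.
by move/(mulIf d0).
Qed.

(** 1 / (th - t th) is in the inverse different: the trace from L to Q(i) of
    (a + b th) / (th - t th) is b. Its norm from E is - 1 / dl^3. *)
Lemma dl3_dvd th x : adm_L th -> span_L th -> (forall j, x j \in oE) -> zdvd (dl th ^+ 3) (disc x).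
Proof.
move=> ath sp ox; have [oth sth /eqP tth] := ath.
have d0 : th - t th != 0 by rewrite subr_eq0 eq_sym.
have tdm : t (th - t th) = - (th - t th) by rewrite rmorphB t2 opprB.
have sdm : s (th - t th) = th - t th by rewrite rmorphB /= st sth.
have h y : y \in oE -> Tr ((th - t th)^-1 * y) \in zi.
  move=> oy; have [||a [b [za zb e]]] := sp (trL y); first by rewrite /trL !rpredD ?oE_map.
    exact: s_trL.
  have -> : Tr ((th - t th)^-1 * y) = b; last by [].
  have -> : Tr ((th - t th)^-1 * y) = (th - t th)^-1 * trL y + t ((th - t th)^-1 * trL y).
    by rewrite /Tr; have -> // : trL ((th - t th)^-1 * y) = (th - t th)^-1 * trL y;
      rewrite /trL !rmorphM !fmorphV /= !sdm !mulrDr.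
  rewrite rmorphM fmorphV /= tdm e rmorphD rmorphM /= (t_qi (zi_qi za)) (t_qi (zi_qi zb)); field.
  by rewrite oppr_eq0 d0.
have := disc_twist h ox.
have -> : Nr (th - t th)^-1 = - (dl th ^+ 3)^-1.
  rewrite /Nr /nL !fmorphV /= !sdm !rmorphM !fmorphV /= tdm /dl; field.
  by rewrite oppr_eq0 d0.
rewrite mulrN => zd; exists (- - (disc x / dl th ^+ 3)); first by rewrite rpredN.
by rewrite opprK divfK // expf_neq0 // /dl expf_neq0.
Qed.

(** * The cubic subfield *)

(** A nontrivial zero would give a primitive cube root of 1 in K; since s
    permutes the two of them and has odd order, it would lie in Q(i). *)
Lemma anisotropic u v : t u = u -> t v = v -> u ^+ 2 + u * v + v ^+ 2 = 0 -> v = 0.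
Proof.
move=> tu tv e; apply/eqP/negPn/negP => v0; pose w := u / v.
have tw : t w = w by rewrite /w fmorph_div tu tv.
have ew : w ^+ 2 + w + 1 = 0.
  apply: (mulIf (expf_neq0 2 v0)); rewrite mul0r -[RHS]e /w; field => //.
have sw : s w = w.
  have : (s w - w) * (s w + w + 1) = 0.
    have := congr1 s ew; rewrite !rmorphD rmorphXn rmorph1 rmorph0 => ew'.
    by rewrite -[RHS](subrr 0) -{1}ew' -ew; ring.
  move/eqP; rewrite mulf_eq0 => /orP[|/eqP h]; first by rewrite subr_eq0 => /eqP.
  have h1 : s w = - w - 1 by apply/eqP; rewrite -subr_eq0; apply/eqP; rewrite -[RHS]h; ring.
  have h2 : s (s w) = w by rewrite h1 rmorphB rmorphN rmorph1 h1; ring.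
  by rewrite -[RHS]s3 h2.
apply: (@three_nonsq E (2%:R * w + 1)).
  by rewrite rpredD ?rpred1 // rpredM ?rpred_nat // fixst.
apply/eqP; rewrite -subr_eq0; apply/eqP.
transitivity (4%:R * (w ^+ 2 + w + 1)); [ring|by rewrite ew mulr0].
Qed.

(** The product of the two Lagrange resolvents x + w s x + w^2 s (s x), for w a
    primitive cube root of 1; also half the sum of the squared differences of
    the conjugates, hence invariant under translations by Q(i). *)
Definition fK (x : E) : E := x ^+ 2 + s x ^+ 2 + s (s x) ^+ 2 - x * s x - s x * s (s x) - s (s x) * x.
Definition aK (x : E) : E := (2%:R * x - s x - s (s x)) * (2%:R * s x - s (s x) - x) * (2%:R * s (s x) - x - s x).
Definition kK (x : E) : E := vand x / fK x.
Definition mK (x : E) : E := aK x / fK x.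

Lemma fK_qi x : t x = x -> fK x \in qi.
Proof.
by move=> tx; apply: fixst; rewrite /fK !(rmorphB, rmorphD, rmorphM, rmorphXn) /= ?s3 -?st ?tx //; ring.
Qed.
Lemma aK_qi x : t x = x -> aK x \in qi.
Proof.
by move=> tx; apply: fixst; rewrite /aK !(rmorphB, rmorphM) /= ?s3 -?st ?tx ?rmorph_nat //; ring.
Qed.
Lemma fK_zi x : x \in oE -> t x = x -> fK x \in zi.
Proof.
by move=> o tx; apply: qi_oE_zi (fK_qi tx) _; rewrite !(rpredB, rpredD, rpredM, rpredX) ?oE_map.
Qed.

Lemma fK_neq0 x : t x = x -> s x <> x -> fK x != 0.
Proof.
move=> tx sx; apply/eqP=> f0; apply: sx.
have : s x - s (s x) = 0.
  apply: (@anisotropic (x - s x)); rewrite ?rmorphB /= -?st ?tx //.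
  by rewrite -[RHS]f0 /fK; ring.
by move/eqP; rewrite subr_eq0 => /eqP/fmorph_inj/esym.
Qed.

(** The classical expression of the discriminant of a cubic, vand^2, by the
    sum and the product of the cubes of its Lagrange resolvents. *)
Lemma disc_relation x : aK x ^+ 2 + 27%:R * vand x ^+ 2 = 4%:R * fK x ^+ 3.
Proof. by rewrite /aK /vand /fK; ring. Qed.

Lemma fK_lin a b c x : a \in qi -> b \in qi -> c \in qi ->
  fK (a * x + b * s x + c) = (a ^+ 2 - a * b + b ^+ 2) * fK x.
Proof.
move=> qa qb qc; rewrite /fK !(rmorphD, rmorphM) /= s3 (s_qi qa) (s_qi qb) (s_qi qc) (s_qi qa) (s_qi qb) (s_qi qc); ring.
Qed.

(** The coordinates of y on x and s x in the basis 1, x, s x of K: they solve two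
    linear equations for s y - y and s (s y) - s y, of determinant - fK x. *)
Definition c1 (x y : E) : E := - (y * (s (s x) - x) + s y * (x - s x) + s (s y) * (s x - s (s x))) / fK x.
Definition c2 (x y : E) : E := - (y * (s (s x) - s x) + s y * (x - s (s x)) + s (s y) * (s x - x)) / fK x.

Lemma c12_qi x y : t x = x -> t y = y -> c1 x y \in qi /\ c2 x y \in qi.
Proof.
move=> tx ty; have q := fK_qi tx; split; rewrite /c1 /c2 rpred_div //; apply: fixst;
  rewrite !(rmorphN, rmorphB, rmorphD, rmorphM) /= ?s3 -?st ?tx ?ty //; ring.
Qed.

Lemma c0_fix x y : t x = x -> s x <> x -> t y = y ->
  y - c1 x y * x - c2 x y * s x \in qi.
Proof.
move=> tx sx ty; have f0 := fK_neq0 tx sx; have [q1 q2] := c12_qi tx ty.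
have e1 := divfK f0 (- (y * (s (s x) - x) + s y * (x - s x) + s (s y) * (s x - s (s x)))).
have e2 := divfK f0 (- (y * (s (s x) - s x) + s y * (x - s (s x)) + s (s y) * (s x - x))).
rewrite -/(c1 x y) in e1; rewrite -/(c2 x y) in e2.
move: (c1 x y) (c2 x y) e1 e2 q1 q2 => a b e1 e2 q1 q2.
apply: fixst; last by rewrite !(rmorphB, rmorphM) /= (t_qi q1) (t_qi q2) -st tx ty.
rewrite !(rmorphB, rmorphM) /= (s_qi q1) (s_qi q2); apply: (mulIf f0); apply/eqP.
rewrite -subr_eq0; apply/eqP.
transitivity ((s y - y) * fK x - a * fK x * (s x - x) - b * fK x * (s (s x) - s x)); first by ring.
by rewrite e1 e2 /fK; ring.
Qed.

Definition span_K th := forall y, y \in oE -> t y = y ->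
  exists a b c, [/\ a \in zi, b \in zi, c \in zi & y = a + b * th + c * s th].

(** Rounding the coordinates on th and s th in Z[i][w] leaves a remainder for
    which fK is smaller than fK th, unless it lies in Q(i). *)
Lemma K_span th : adm_K th -> (forall y, adm_K y -> (nm (fK th) <= nm (fK y))%N) -> span_K th.
Proof.
move=> [oth tth sth] thmin y oy ty.
have f0 := fK_neq0 tth sth; have [q1 q2] := c12_qi tth ty; have q0 := c0_fix tth sth ty.
have [z [w [zz zw nzw]]] := eisenstein_round q1 q2.
pose y' := y - z * th - w * s th.
have [qz qw] := (zi_qi zz, zi_qi zw).
have qd1 : c1 th y - z \in qi by rewrite rpredB.
have qd2 : c2 th y - w \in qi by rewrite rpredB.
have oy' : y' \in oE by rewrite !rpredB ?rpredM // ?oE_map // zi_oE.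
have ty' : t y' = y' by rewrite /y' !rmorphB !rmorphM /= -st tth ty (t_qi qz) (t_qi qw).
have ey' : y' = (c1 th y - z) * th + (c2 th y - w) * s th + (y - c1 th y * th - c2 th y * s th).
  by rewrite /y'; ring.
have [sy'|/eqP sy'] := eqVneq (s y') y'; last first.
  have ay' : adm_K y' by [].
  have := thmin _ ay'; rewrite -(ler_nat rat) -(nmE (fK_zi oy' ty')) -(nmE (fK_zi oth tth)).
  have qn (u v : E) : u \in qi -> v \in qi -> u ^+ 2 - u * v + v ^+ 2 \in qi.
    by move=> hu hv; rewrite rpredD ?rpredB ?rpredM ?rpredX.
  rewrite {1}ey' fK_lin // (NmM (qn _ _ qd1 qd2) (fK_qi tth)).
  rewrite leNgt; case/negP; rewrite -[ltRHS]mul1r ltr_pM2r //.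
  by rewrite lt_def Nm_ge0 andbT Nm_eq0 ?fK_qi.
exists y', z, w; split=> //; first exact: fix_zi.
by rewrite /y'; ring.
Qed.

(** Among the generators with least norm of fK, a second choice minimises the
    norm of kK; the units act on this set and their moves bound kK. *)
Lemma K_struct : exists2 th, adm_K th & [/\ span_K th,
  forall y, adm_K y -> (nm (fK th) <= nm (fK y))%N &
  forall y, adm_K y -> nm (fK y) = nm (fK th) -> (nm (kK th) <= nm (kK y))%N].
Proof.
have [x ax xmin] := @ex_min _ _ (fun x => nm (fK x)) ex_K.
have [|y [ay ey] ymin] := @ex_min _ (fun y => adm_K y /\ nm (fK y) = nm (fK x)) (fun x => nm (kK x)).
  by exists x.
have fmin z : adm_K z -> (nm (fK y) <= nm (fK z))%N by move=> az; rewrite ey xmin.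
exists y => //; split=> // [|z az ez]; first exact: K_span.
by apply: ymin; rewrite -ey.
Qed.

(** kK th is minus the coordinate of th^2 on s th. *)
Lemma kK_zi th : adm_K th -> span_K th -> kK th \in zi.
Proof.
move=> [oth tth sth] sp; have f0 := fK_neq0 tth sth.
have [||a [b [c [za zb zc e]]]] := sp (th ^+ 2); first by rewrite rpredX.
  by rewrite rmorphXn tth.
suff -> : kK th = - c by rewrite rpredN.
apply: (mulIf f0); rewrite divfK //.
have e2 := congr1 s e; have e3 := congr1 s e2.
rewrite !(rmorphD, rmorphM, rmorphXn) /= s3 !(s_qi (zi_qi za), s_qi (zi_qi zb), s_qi (zi_qi zc)) in e2 e3.
have -> : vand th = th ^+ 2 * (s (s th) - s th) + s th ^+ 2 * (th - s (s th)) + s (s th) ^+ 2 * (s th - th).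
  by rewrite /vand; ring.
by rewrite e e2 e3 /fK; ring.
Qed.

Lemma vand_neq0 th : s th <> th -> vand th != 0.
Proof.
move=> /eqP sth; have sk : s th - th != 0 by rewrite subr_eq0.
have e1 : th - s th != 0 by rewrite -opprB oppr_eq0.
rewrite /vand !mulf_neq0 //; first by rewrite -rmorphB fmorph_eq0.
by rewrite -{2}[th]s3 -!rmorphB !fmorph_eq0.
Qed.

Lemma kK_neq0 th : adm_K th -> kK th != 0.
Proof. by move=> [_ tth sth]; rewrite /kK mulf_neq0 ?invr_eq0 ?fK_neq0 ?vand_neq0. Qed.

Lemma norm_equation th : adm_K th -> 4%:R * fK th = mK th ^+ 2 + 27%:R * kK th ^+ 2.
Proof.
move=> [_ tth sth]; have f0 := fK_neq0 tth sth.
apply: (mulIf (expf_neq0 2 f0)); transitivity (4%:R * fK th ^+ 3); first by ring.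
by rewrite -disc_relation /mK /kK; field.
Qed.

(** The square 4 fK - 27 kK^2 is integral. *)
Lemma mK_zi th : adm_K th -> span_K th -> mK th \in zi.
Proof.
move=> ad sp; have [oth tth sth] := ad; apply: qi_oE_zi.
  by rewrite /mK rpred_div ?aK_qi ?fK_qi.
apply: sqr_oE; have -> : mK th ^+ 2 = 4%:R * fK th - 27%:R * kK th ^+ 2.
  by rewrite norm_equation // addrK.
have zf := fK_zi oth tth; have zk := kK_zi ad sp; apply: zi_oE.
exact: rpredB (rpredM (rpred_nat _ _) zf) (rpredM (rpred_nat _ _) (rpredX _ zk)).
Qed.

(** When w acts as s, u th + v s th is the multiple of th by u + v w, whose
    relative norm u^2 - u v + v^2 is i: it is another generator with the same
    norm of fK, and minimality of kK th applies to it. *)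
Lemma kK_move th (u v e : E) : adm_K th -> span_K th ->
  (forall y, adm_K y -> nm (fK y) = nm (fK th) -> (nm (kK th) <= nm (kK y))%N) ->
  (forall y, adm_K y -> nm (fK y) = nm (fK th) -> kK y \in zi) ->
  u \in zi -> v \in zi -> e \in zi -> nm e = 1%N ->
  u ^+ 2 - u * v + v ^+ 2 = gf_i E ->
  2%:R * vand (u * th + v * s th) = - (1 + gf_i E) * (5%:R * vand th + e * aK th) ->
  (2 * nm (kK th) <= nm (5%:R * kK th + e * mK th)%R)%N.
Proof.
set I := gf_i E.
move=> ad sp kmin kzi zu zv ze ne euv eV; have [oth tth sth] := ad.
have [qu qv] := (zi_qi zu, zi_qi zv).
pose y := u * th + v * s th; have f0 := fK_neq0 tth sth.
have I0 : I != 0 by apply/eqP => h; have := gf_i2E E; rewrite -/I h mul0r => /eqP; rewrite eq_sym oppr_eq0 oner_eq0.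
have fy : fK y = I * fK th by have := @fK_lin u v 0 th qu qv (rpred0 _); rewrite addr0 euv.
have ay : adm_K y.
  split; first exact: rpredD (rpredM (zi_oE zu) oth) (rpredM (zi_oE zv) (oE_map s oth)).
    by rewrite rmorphD !rmorphM /= -st tth (t_qi qu) (t_qi qv).
  move=> sy; have : fK y = 0 by rewrite /fK !sy; ring.
  by rewrite fy => /eqP; rewrite mulf_eq0 (negPf I0) (negPf f0).
have zf : fK th \in zi by exact: fK_zi.
have nf : nm (fK y) = nm (fK th) by rewrite fy nmM ?i_zi // nmi mul1n.
have k1 := kmin _ ay nf; have zk := kzi _ ay nf.
have ek : 2%:R * I * kK y = - (1 + I) * (5%:R * kK th + e * mK th).
  have := eV; rewrite -/y => eV'.
  rewrite /kK fy [mK th]/mK; apply: (mulIf f0).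
  have -> : 2%:R * I * (vand y / (I * fK th)) * fK th = 2%:R * vand y by field; rewrite I0 f0.
  by rewrite eV'; field.
have zz : 5%:R * kK th + e * mK th \in zi.
  exact: rpredD (rpredM (rpred_nat _ _) (kK_zi ad sp)) (rpredM ze (mK_zi ad sp)).
have n1 : nm (1 + I) = 2%N.
  have -> : 1 + I = cplx E 1%:~R 1%:~R by rewrite /cplx /= rmorph1 mul1r.
  by rewrite nm_cplx.
have z1 : 1 + I \in zi by rewrite rpredD ?rpred1 ?i_zi.
have z2 : 2%:R * I \in zi by rewrite rpredM ?rpred_nat ?i_zi.
have z1N : - (1 + I) \in zi by rewrite rpredN.
have := congr1 (@nm E) ek; rewrite (nmM z2 zk) (nmM (rpred_nat _ _) (i_zi _)) (nmM z1N zz) (nmN z1).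
rewrite n1 nmi nm_nat muln1 => hh; clear -k1 hh; lia.
Qed.

(** Dividing by k, the hypotheses become |5 + x|^2 >= 2 for x = i m / k and for
    its opposite, and 4 f / k^2 = 27 - x^2. *)
Lemma f_lower th : adm_K th -> span_K th ->
  (2 * nm (kK th) <= nm (5%:R * kK th + gf_i E * mK th)%R)%N ->
  (2 * nm (kK th) <= nm (5%:R * kK th + - gf_i E * mK th)%R)%N ->
  (25 * nm (kK th) ^ 2 <= 2 * nm (fK th))%N.
Proof.
move=> ad sp h1 h2; have [oth tth sth] := ad.
have zk := kK_zi ad sp; have zm := mK_zi ad sp; have k0 := kK_neq0 ad; have zf := fK_zi oth tth.
set k := kK th in zk k0 h1 h2 *; set m := mK th in zm h1 h2 *; set I := gf_i E in h1 h2 *.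
have [x [y exy]] : exists x y, I * m / k = cplx E x y.
  apply/qiP; exact: rpred_div (rpredM (zi_qi (i_zi _)) (zi_qi zm)) (zi_qi zk).
have em : I * m = k * cplx E x y by rewrite -exy; field.
have n5 : 5%:R = cplx E 5%:R 0 by rewrite /cplx rmorph0 mul0r addr0 rmorph_nat.
have n27 : 27%:R = cplx E 27%:R 0 by rewrite /cplx rmorph0 mul0r addr0 rmorph_nat.
have kq : k \in qi by exact: zi_qi.
have cq u v : cplx E u v \in qi by apply/qiP; exists u, v.
have kpos : 0 < Nm k by rewrite lt_def Nm_ge0 andbT Nm_eq0.
have zI := i_zi E; have n5z : 5%:R \in @zi E by rewrite rpred_nat.
have z1 : 5%:R * k + I * m \in zi by exact: rpredD (rpredM n5z zk) (rpredM zI zm).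
have z2 : 5%:R * k + - I * m \in zi by rewrite mulNr; exact: rpredB (rpredM n5z zk) (rpredM zI zm).
move: h1 h2; rewrite -!(ler_nat rat) !natrM -(nmE z1) -(nmE z2) -(nmE zk) -(nmE zf) mulNr em.
have -> : 5%:R * k + k * cplx E x y = k * cplx E (5%:R + x) (0 + y) by rewrite -cplxD -n5; ring.
have -> : 5%:R * k + - (k * cplx E x y) = k * cplx E (5%:R - x) (0 - y) by rewrite -cplxB -n5; ring.
rewrite !(NmM kq (cq _ _)) !Nm_cplx !add0r sqrrN ![2%:R * _]mulrC !(ler_pM2l kpos) => h1 h2.
have := unit_move_bound h1 h2.
have e4 : Nm (4%:R * fK th) = Nm k ^+ 2 * ((27%:R - (x ^+ 2 - y ^+ 2)) ^+ 2 + (2%:R * x * y) ^+ 2).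
  have -> : 4%:R * fK th = k * k * (27%:R - cplx E x y ^+ 2).
    transitivity (27%:R * k ^+ 2 - (k * cplx E x y) ^+ 2); last by ring.
    by rewrite -em (exprMn 2 I m) (gf_i2 E : I ^+ 2 = -1) norm_equation // -/k -/m; ring.
  rewrite expr2 cplxM n27 cplxB (NmM (rpredM kq kq) (cq _ _)) (NmM kq kq) Nm_cplx; ring.
move: e4; rewrite (NmM (rpred_nat _ _) (zi_qi zf)) Nm_nat => e4.
have k2 : 0 <= Nm k ^+ 2 by rewrite sqr_ge0.
move: ((27%:R - (x ^+ 2 - y ^+ 2)) ^+ 2 + (2%:R * x * y) ^+ 2) e4 => X e4 hX.
have := ler_wpM2l k2 hX; rewrite -e4 [Nm k ^+ 2]expr2; exact: scale_bound.
Qed.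

Lemma Tr_tfix d y : t d = d -> Tr (d * y) = trL (d * (y + t y)).
Proof. by move=> td; rewrite /Tr /trL !rmorphD !rmorphM !rmorphD /= -!st td; ring. Qed.
Lemma Nr_tfix d : t d = d -> Nr d = nL d ^+ 2.
Proof. by move=> td; rewrite /Nr /nL !rmorphM -!st td; ring. Qed.

(** dta is in the inverse different of K: Tr(dta y) is the coordinate on th of
    y + t y. Its norm is k^2 / f^4. *)
Lemma f4_dvd th x : adm_K th -> span_K th -> (forall j, x j \in oE) ->
  zdvd (fK th ^+ 4) (kK th ^+ 2 * disc x).
Proof.
move=> ad sp ox; have [oth tth sth] := ad; have f0 := fK_neq0 tth sth.
have fq := fK_qi tth.
pose dta := (th - s (s th)) / fK th.
have sf : s (fK th) = fK th by exact: s_qi. have tf : t (fK th) = fK th by exact: t_qi.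
have td : t dta = dta by rewrite /dta fmorph_div rmorphB /= -!st !tth tf.
have sd : s dta = (s th - th) / fK th by rewrite /dta fmorph_div sf rmorphB /= s3.
have ssd : s (s dta) = (s (s th) - s th) / fK th by rewrite sd fmorph_div sf rmorphB.
have h y : y \in oE -> Tr (dta * y) \in zi.
  move=> oy; have [||a [b [c [za zb zc e]]]] := sp (y + t y); first by rewrite rpredD ?oE_map.
    by rewrite rmorphD t2 addrC.
  rewrite Tr_tfix //.
  suff -> : trL (dta * (y + t y)) = b by [].
  have se : s (a + b * th + c * s th) = a + b * s th + c * s (s th).
    by rewrite !rmorphD !rmorphM (s_qi (zi_qi za)) (s_qi (zi_qi zb)) (s_qi (zi_qi zc)).
  have sse : s (s (a + b * th + c * s th)) = a + b * s (s th) + c * th.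
    by rewrite se !rmorphD !rmorphM s3 (s_qi (zi_qi za)) (s_qi (zi_qi zb)) (s_qi (zi_qi zc)).
  rewrite e /trL (rmorphM s) (rmorphM s (s dta)) sse se ssd sd /dta.
  by move: f0; rewrite /fK => f0; field.
have := disc_twist h ox.
have -> : Nr dta = kK th ^+ 2 / fK th ^+ 4.
  rewrite Nr_tfix //.
  have -> : nL dta = - kK th / fK th ^+ 2; last by field.
  rewrite /nL ssd sd /kK /dta /vand; field => //.
move=> zd; exists (disc x * (kK th ^+ 2 / fK th ^+ 4)) => //.
by rewrite -[RHS]mulrA divfK ?expf_neq0 // [RHS]mulrC.
Qed.

(** Both det W and th - t th are fixed by s and changed into their opposites
    by t; their product is a Gaussian integer. *)
Lemma disc_dl_sqr th x : adm_L th -> (forall j, x j \in oE) ->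
  exists2 w, w \in zi & disc x * dl th = w ^+ 2.
Proof.
move=> [oth sth tth] ox; exists (\det (W x : 'M_6) * (th - t th)); last by rewrite /disc /dl -exprMn.
apply: fix_zi.
- rewrite rpredM ?rpredB ?oE_map //; apply: rpred_det => i j; rewrite mxE /cj.
  by case: fintype.split => k; rewrite ?oE_map //; elim: (k : nat) => [|n IH] //=; rewrite oE_map.
- by rewrite rmorphM /= s_detW rmorphB /= st sth.
- by rewrite rmorphM /= t_detW rmorphB /= t2 mulNr -mulrN opprB.
Qed.

(** * The lower bound for the discriminant *)

Lemma zprime_dvdM (p a b : E) : zprime p -> a \in zi -> b \in zi -> zdvd p (a * b) -> zdvd p a \/ zdvd p b.
Proof.
move=> pp za zb h; have [zp _ _] := pp; have [?|npa] := pselect (zdvd p a); first by left.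
by right; apply: (zcop_gauss zb zp (zprime_cop pp za npa)).
Qed.

(** Since p divides dl exactly once and disc * dl is a square, p divides disc to
    an odd power. *)
Lemma ramified_parity th x p e : adm_L th -> span_L th -> (forall j, x j \in oE) ->
  zprime p -> (13 <= nm p)%N -> e \in zi -> disc x = p ^+ 4 * e -> zdvd p (dl th) ->
  exists2 h, [/\ h \in zi, dl th = h * p & ~ zdvd p h] & zdvd p e.
Proof.
move=> ad sp ox pp np ze eD [h zh eh]; have [zp p0 _] := pp.
have nph : ~ zdvd p h.
  move=> [h' zh' eh']; have : zdvd p 2%:R.
    by apply: (dl_sqfree ad) => //; exists h' => //; rewrite eh eh' expr2 mulrA.
  move/(zdvd_nm zp (rpred_nat _ _)); rewrite nm_nat => /dvdn_leq -/(_ isT).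
  by rewrite leqNgt (leq_trans _ np).
exists h => //; have [w zw ew] := disc_dl_sqr ad ox.
have p20 : p ^+ 2 != 0 by rewrite expf_neq0.
have ew' : (w / p ^+ 2) ^+ 2 = e * h * p.
  by rewrite expr_div_n -ew eD eh; field.
have zw' : w / p ^+ 2 \in zi.
  apply: qi_oE_zi; first by rewrite rpred_div ?zi_qi ?rpredX.
  by apply: sqr_oE; rewrite ew' zi_oE // !rpredM.
have [v zv ev] : zdvd p (w / p ^+ 2).
  have : zdvd p ((w / p ^+ 2) * (w / p ^+ 2)) by exists (e * h); rewrite ?rpredM // -ew' expr2.
  by case/(zprime_dvdM pp zw' zw').
have : zdvd p (e * h).
  exists (v ^+ 2); first by rewrite rpredX.
  by apply: (mulIf p0); rewrite -ew' ev; ring.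
by case/(zprime_dvdM pp ze zh).
Qed.

(** If p does not divide dl, then N(d) >= N(p)^4 9^3, and 9^3 = 3^6. If it
    does, write dl = h p; then p^5 h^3 divides d. For N(p) = 13 the cofactor has
    norm at least 4, because N(dl) is neither 13 nor 26, and norms are never
    3. *)
Lemma prime_case th x p : adm_L th -> span_L th -> (forall j, x j \in oE) -> disc x != 0 ->
  zprime p -> nm p = 13%N \/ (37 <= nm p)%N -> zdvd (p ^+ 4) (disc x) ->
  (3 ^ 6 * 13 ^ 4 <= nm (disc x))%N.
Proof.
move=> ad sp ox D0 pp np pD; have [zp p0 _] := pp; have zD := disc_zi ox.
have zd := dl_zi ad; have dD := dl3_dvd ad sp ox.
have [e0 [n0 [ze0 zn0 ed]]] := dl_class ad.
have nsq w : w \in zi -> dl th <> w ^+ 2 by move=> zw; apply: dl_nonsq => //; exact: zi_qi.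
have [n9 n13 n26] := zi_class ze0 zn0 ed nsq.
have np13 : (13 <= nm p)%N by case: np => [->|/(leq_trans _)->].
have [pd|npd] := pselect (zdvd p (dl th)); last first.
  have cop : zcop (p ^+ 4) (dl th ^+ 3) by apply: zcopX => //; exact: zprime_cop.
  have := zdvd_le (rpredM (rpredX 4 zp) (rpredX 3 zd)) zD D0 (zcop_dvd zD cop pD dD).
  rewrite (nmM (rpredX 4 zp) (rpredX 3 zd)) (nmX 4 zp) (nmX 3 zd); apply: leq_trans.
  by rewrite mulnC; apply: leq_mul; rewrite ?leq_exp2r // (@leq_exp2r 9 _ 3).
have [e ze eD] := pD; rewrite mulrC in eD.
have [h [zh eh nph] pe] := ramified_parity ad sp ox pp np13 ze eD pd.
have p5D : zdvd (p ^+ 5) (disc x).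
  by case: pe => g zg eg; exists g => //; rewrite eD eg; ring.
have hD : zdvd (h ^+ 3) (disc x).
  by case: dD => g zg eg; exists (g * p ^+ 3); rewrite ?rpredM ?rpredX // eg eh; ring.
have cop : zcop (p ^+ 5) (h ^+ 3) by apply: zcopX => //; exact: zprime_cop.
have := zdvd_le (rpredM (rpredX 5 zp) (rpredX 3 zh)) zD D0 (zcop_dvd zD cop p5D hD).
rewrite (nmM (rpredX 5 zp) (rpredX 3 zh)) (nmX 5 zp) (nmX 3 zh); apply: leq_trans.
have nd : nm (dl th) = (nm h * nm p)%N by rewrite eh nmM.
have h0 : (0 < nm h)%N by rewrite nd in n9; case: (nm h) n9.
case: np => [e13|p37]; last first.
  apply: (leq_trans num37); apply: leq_trans (leq_pmulr _ _); first by rewrite leq_exp2r.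
  by rewrite expn_gt0 h0.
rewrite e13 in nd *; have h4 : (4 <= nm h)%N.
  have h3 : nm h <> 3%N.
    by case/ziP: zh => a [b ->]; rewrite nm_cplx; exact: (@sum_sq_not3 a b 0).
  by clear -nd n13 n26 h0 h3; lia.
apply: (leq_trans num13); rewrite leq_mul2l; apply/orP; right.
by rewrite leq_exp2r.
Qed.

Lemma zprime_of_norm (p : E) : p \in zi -> nm p = 13%N \/ nm p = 37%N \/ nm p = 49%N \/ nm p = 61%N -> zprime p.
Proof.
move=> zp [e|[e|[e|e]]]; try by apply: prime_zprime => //; rewrite e.
apply: zprime_of; rewrite ?e // => a b h.
have [|[e7|e49]] : absz (a ^+ 2 + b ^+ 2) = 1%N \/ absz (a ^+ 2 + b ^+ 2) = 7%N \/ absz (a ^+ 2 + b ^+ 2) = 49%N.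
- have {}h : (absz (a ^+ 2 + b ^+ 2)%R %| 7 ^ 2)%N by [].
  have [m m2 ->] := dvdn_pfactor _ _ (isT : prime 7) h.
  by case: m m2 => [|[|[|m]]] // _; [left|right; left|right; right].
- by left.
- by have := @sum_sq_not3 a b 1.
- by right.
Qed.

Lemma lower_bound x : oE_basis x -> (3 ^ 6 * 13 ^ 4 <= nm (disc x))%N.
Proof.
move=> [ox dW _]; have D0 : disc x != 0 by rewrite expf_neq0.
have zD := disc_zi ox; have [thL adL spL] := L_struct.
have [th ad [sp fmin kmin]] := K_struct; have [oth tth sth] := ad.
have zk := kK_zi ad sp; have zm := mK_zi ad sp; have k0 := kK_neq0 ad; have zf := fK_zi oth tth.
have f0 := fK_neq0 tth sth; have fD := f4_dvd ad sp ox; have eqn := norm_equation ad.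
have zI := i_zi E.
have kap : (25 * nm (kK th) ^ 2 <= 2 * nm (fK th))%N.
  have kzi y : adm_K y -> nm (fK y) = nm (fK th) -> kK y \in zi.
    move=> ay ey; apply: kK_zi (ay) _; apply: K_span => // z az; rewrite ey.
    exact: fmin.
  (* - i - (1 + i) w and 1 + (1 + i) w have relative norm i *)
  have e1 : 2%:R * vand (- gf_i E * th + - (1 + gf_i E) * s th) =
      - (1 + gf_i E) * (5%:R * vand th + - gf_i E * aK th).
    by rewrite /vand /aK !(rmorphD, rmorphN, rmorphM) /= s3 rmorph1 !sI; ring: (gf_i2E E).
  have e2 : 2%:R * vand (1 * th + (1 + gf_i E) * s th) =
      - (1 + gf_i E) * (5%:R * vand th + gf_i E * aK th).
    by rewrite /vand /aK !(rmorphD, rmorphN, rmorphM) /= s3 !rmorph1 !sI; ring: (gf_i2E E).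
  have zNI : - gf_i E \in zi by rewrite rpredN.
  have z1I : 1 + gf_i E \in zi by rewrite rpredD ?rpred1.
  have zN1I : - (1 + gf_i E) \in zi by rewrite rpredN.
  apply: f_lower => //.
    apply: (kK_move ad sp kmin kzi (rpred1 _) z1I zI (nmi _) _ e2).
    by ring: (gf_i2E E).
  apply: (kK_move ad sp kmin kzi zNI zN1I zNI _ _ e1); first by rewrite nmN ?nmi.
  by ring: (gf_i2E E).
have ND : (0 < nm (disc x))%N by rewrite nm_gt0.
have kpos : (0 < nm (kK th))%N by rewrite nm_gt0.
have zkD : kK th ^+ 2 * disc x \in zi by exact: rpredM (rpredX 2 zk) zD.
have kD0 : kK th ^+ 2 * disc x != 0 by rewrite mulf_neq0 // expf_neq0.
have f4N : (nm (fK th) ^ 4 %| nm (kK th) ^ 2 * nm (disc x))%N.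
  rewrite -(nmX 4 zf) -(nmX 2 zk) -(nmM (rpredX 2 zk) zD).
  exact: zdvd_nm (rpredX 4 zf) zkD fD.
have f4le : (nm (fK th) ^ 4 <= nm (kK th) ^ 2 * nm (disc x))%N.
  by apply: dvdn_leq f4N; rewrite muln_gt0 expn_gt0 kpos.
have prc p := prime_case adL spL ox D0 (p := p).
have k3 : nm (kK th) <> 3%N.
  by case/ziP: (zk) => a [b ->]; rewrite nm_cplx; exact: (@sum_sq_not3 a b 0).
have [k4|k4] := leqP 4 (nm (kK th)).
  exact: disc_bound_large_k num200 erefl kap k4 f4le.
have [k1 [k2 ek]] : exists k1 k2 : int, kK th = cplx E k1%:~R k2%:~R by apply/ziP.
have [a [b em]] : exists a b : int, mK th = cplx E a%:~R b%:~R by apply/ziP.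
have [f1 [f2 ef]] : exists f1 f2 : int, fK th = cplx E f1%:~R f2%:~R by apply/ziP.
have eqc : 4%:R * cplx E f1%:~R f2%:~R =
    cplx E a%:~R b%:~R ^+ 2 + 27%:R * cplx E k1%:~R k2%:~R ^+ 2 by rewrite -ef -em -ek.
have [eq1 eq2] := norm_eq_coords eqc.
have nk : nm (kK th) = absz (k1 ^+ 2 + k2 ^+ 2) by rewrite ek nm_cplx.
have nf : (nm (fK th))%:Z = f1 ^+ 2 + f2 ^+ 2.
  by rewrite ef nm_cplx gez0_abs // addr_ge0 ?sqr_ge0.
have huv := unit_cases kpos k4 k3 nk.
have low : 25 * ((nm (kK th))%:Z ^+ 2) <= 2 * (f1 ^+ 2 + f2 ^+ 2).
  by rewrite -nf; clear -kap; lia.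
have [up|up] := ltP (f1 ^+ 2 + f2 ^+ 2) 96; last first.
  have f96 : (96 <= nm (fK th))%N by clear -up nf; lia.
  exact: disc_bound_large_f num96 f96 k4 k3 f4le.
have := norm_eq_enum eq1 eq2 huv low up; rewrite -nf.
have [e1|ne1] := eqVneq (nm (kK th)) 1%N.
  have unk : (kK th)^-1 \in zi by exact: nm_unit.
  case=> [h68|h].
    have f68 : (68 <= nm (fK th))%N by clear -h68; lia.
    apply: (leq_trans num68); apply: leq_trans (_ : nm (fK th) ^ 4 <= _)%N.
      by rewrite leq_exp2r.
    by apply: leq_trans f4le _; rewrite e1 exp1n mul1n.
  have {}h : nm (fK th) = 13%N \/ nm (fK th) = 37%N \/ nm (fK th) = 49%N \/ nm (fK th) = 61%N.
    by move: h; rewrite !inE; clear; lia.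
  apply: (prc (fK th)); first exact: zprime_of_norm.
    by clear -h; lia.
  case: fD => c zc ec; exists ((kK th)^-1 ^+ 2 * c); first by rewrite rpredM ?rpredX.
  by rewrite -mulrA -ec mulrA -exprMn mulVf // expr1n mul1r.
have e2 : nm (kK th) = 2%N by clear -ne1 k4 k3 kpos; lia.
rewrite !inE => /orP[/eqP h|/eqP h]; last first.
  have {}h : nm (fK th) = 81%N by clear -h; lia.
  apply: (leq_trans num81); apply: dvdn_leq => //.
  rewrite -(@Gauss_dvdr _ (2 ^ 2)); last by rewrite coprimeXl // coprimeXr.
  by rewrite -h -[X in (X ^ 2 * _)%N]e2.
have [g1 [g2 [eg1 eg2]]] : exists g1 g2, f1 = 2 * g1 /\ f2 = 2 * g2.
  by apply: even_pair; rewrite -nf h.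
have zp : cplx E g1%:~R g2%:~R \in zi by apply/ziP; exists g1, g2.
have efp : fK th = 2%:R * cplx E g1%:~R g2%:~R.
  by rewrite ef eg1 eg2 /cplx !rmorphM /= !rmorph_nat; ring.
have np : nm (cplx E g1%:~R g2%:~R) = 13%N.
  have := nmM (rpred_nat _ 2) zp; rewrite -efp nm_nat; clear -h; lia.
have pp : zprime (cplx E g1%:~R g2%:~R) by apply: zprime_of_norm => //; left.
apply: (prc _ pp); first by left.
apply: (@zcop_gauss _ _ (kK th ^+ 2)) => //; first by rewrite rpredX.
  apply: zcopX => //; apply: zprime_cop => // /(zdvd_nm zp zk).
  by rewrite np e2.
case: fD => c zc ec; exists (c * 2%:R ^+ 4); first by rewrite rpredM ?rpredX ?rpred_nat.
by rewrite ec efp; ring.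
Qed.

(** * The discriminant of the natural order *)

Section NaturalOrder.
Variable g : E.
Local Notation mul := (cyc_mul s g).

Lemma cyc_mul00 (x y : 'rV[E]_3) : mul x y 0 0 =
  x 0 0 * y 0 0 + g * (s (s (x 0 1)) * y 0 2%:R + s (x 0 2%:R) * y 0 1).
Proof.
rewrite mxE; under eq_bigr => j _ do rewrite big_mkcond.
rewrite !big_ord_recl !big_ord0 /=.
have -> : lift ord0 ord0 = 1 :> 'I_3 by exact/val_inj.
have -> : lift ord0 (lift ord0 ord0) = 2%:R :> 'I_3 by exact/val_inj.
rewrite /bump /= /divn /=; ring.
Qed.

Lemma reduced_trace3 (x : 'rV[E]_3) : reduced_trace s g x = trL (x 0 0).
Proof.
rewrite /reduced_trace /mxtrace /cyc_splitting.
under eq_bigr => k _.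
  rewrite !mxE; under eq_bigr => j _ do rewrite big_mkcond.
  over.
rewrite !big_ord_recl !big_ord0 /= !mxE /= /bump /= /divn /= /trL; ring.
Qed.

(** The trace form over Q(i), for which only the coordinate of u^0 matters. *)
Definition tform (x y : 'rV[E]_3) := Tr (mul x y 0 0).
Definition tdet n (x : 'I_n -> 'rV[E]_3) := \det (\matrix_(j < n, k < n) tform (x j) (x k)).

Lemma TrD x y : Tr (x + y) = Tr x + Tr y.
Proof. by rewrite /Tr /trL !rmorphD; ring. Qed.
Lemma TrZ a x : a \in qi -> Tr (a * x) = a * Tr x.
Proof. by move=> qa; rewrite /Tr /trL !rmorphD !rmorphM !(s_qi qa) !(t_qi qa); ring. Qed.

Lemma tformDl x x' y : tform (x + x') y = tform x y + tform x' y.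
Proof. by rewrite /tform !cyc_mul00 !mxE -TrD !rmorphD; congr Tr; ring. Qed.
Lemma tformDr x y y' : tform x (y + y') = tform x y + tform x y'.
Proof. by rewrite /tform !cyc_mul00 !mxE -TrD; congr Tr; ring. Qed.
Lemma tformZl a x y : a \in qi -> tform (a *: x) y = a * tform x y.
Proof.
by move=> qa; rewrite /tform !cyc_mul00 !mxE -TrZ // !rmorphM !(s_qi qa); congr Tr; ring.
Qed.
Lemma tformZr a x y : a \in qi -> tform x (a *: y) = a * tform x y.
Proof. by move=> qa; rewrite /tform !cyc_mul00 !mxE -TrZ //; congr Tr; ring. Qed.

Lemma tform_suml n (c : 'I_n -> E) (x : 'I_n -> 'rV[E]_3) y : (forall j, c j \in qi) ->
  tform (\sum_j c j *: x j) y = \sum_j c j * tform (x j) y.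
Proof.
move=> qc; have z0 : tform 0 y = 0.
  by rewrite -(scale0r (0 : 'rV[E]_3)) tformZl ?rpred0 ?mul0r.
rewrite (big_morph (fun x => tform x y) (fun a b => tformDl a b y) z0).
by apply: eq_bigr => j _; rewrite tformZl.
Qed.
Lemma tform_sumr n (c : 'I_n -> E) x (y : 'I_n -> 'rV[E]_3) : (forall j, c j \in qi) ->
  tform x (\sum_j c j *: y j) = \sum_j c j * tform x (y j).
Proof.
move=> qc; have z0 : tform x 0 = 0.
  by rewrite -(scale0r (0 : 'rV[E]_3)) tformZr ?rpred0 ?mul0r.
rewrite (big_morph (tform x) (tformDr x) z0).
by apply: eq_bigr => j _; rewrite tformZr.
Qed.

Local Notation basis := (is_basis_over (gaussian (gf_i E)) (@natural_order E 3)).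

Lemma basis_span n (x : 'I_n -> 'rV[E]_3) y : basis x -> natural_order y ->
  exists2 c : 'I_n -> E, forall j, c j \in zi & y = \sum_j c j *: x j.
Proof. by case=> h _ /h[c zc e]; exists c => // j; apply/asboolP. Qed.

Lemma basis_mem n (x : 'I_n -> 'rV[E]_3) j : basis x -> natural_order (x j).
Proof.
move=> [h _]; apply/h; exists (fun k => (k == j)%:R).
  by move=> k; apply/asboolP; exact: (rpred_nat zi).
rewrite (bigD1 j) //= eqxx scale1r big1 ?addr0 // => k /negPf ->; exact: scale0r.
Qed.

Lemma basis_free n (x : 'I_n -> 'rV[E]_3) (c : 'I_n -> E) : basis x -> (forall j, c j \in zi) ->
  \sum_j c j *: x j = 0 -> forall j, c j = 0.
Proof. by move=> [_ h] zc; apply: h => j; apply/asboolP/zc. Qed.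

Lemma basis_change n m (x : 'I_n -> 'rV[E]_3) (y : 'I_m -> 'rV[E]_3) : basis x -> basis y ->
  exists2 C : 'M[E]_(m, n), forall j k, C j k \in zi & forall j, y j = \sum_k C j k *: x k.
Proof.
move=> bx by_.
have /choice[c hc] : forall j, exists c : 'I_n -> E, (forall k, c k \in zi) /\ y j = \sum_k c k *: x k.
  by move=> j; have [c zc e] := basis_span bx (basis_mem j by_); exists c.
exists (\matrix_(j, k) c j k) => [j k|j]; first by rewrite mxE (hc j).1.
by rewrite (hc j).2; apply: eq_bigr => k _; rewrite mxE.
Qed.

Lemma basis_change_inv n m (x : 'I_n -> 'rV[E]_3) (y : 'I_m -> 'rV[E]_3)
    (C : 'M[E]_(m, n)) (D : 'M[E]_(n, m)) : basis x ->
  (forall j k, C j k \in zi) -> (forall j k, D j k \in zi) ->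
  (forall j, y j = \sum_k C j k *: x k) -> (forall j, x j = \sum_k D j k *: y k) ->
  D *m C = 1%:M :> 'M[E]_n.
Proof.
move=> bx zC zD hy hx; apply/matrixP=> j l.
pose c k := (D *m C) j k - (1%:M : 'M[E]_n) j k.
suff /(_ l) /eqP : forall k, c k = 0 by rewrite subr_eq0 => /eqP.
apply: (basis_free bx) => [k|].
  by rewrite /c !mxE rpredB ?rpred_nat // rpred_sum // => i _; rewrite rpredM.
have -> : \sum_k c k *: x k = \sum_k (D *m C) j k *: x k - \sum_k (1%:M : 'M[E]_n) j k *: x k.
  by rewrite -sumrB; apply: eq_bigr => k _; rewrite scalerBl.
have -> : \sum_k (1%:M : 'M[E]_n) j k *: x k = x j.
  rewrite (bigD1 j) //= mxE eqxx scale1r big1 ?addr0 // => k; rewrite mxE eq_sym => /negPf ->.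
  exact: scale0r.
apply/eqP; rewrite subr_eq0; apply/eqP; rewrite [RHS]hx.
have -> : \sum_k D j k *: y k = \sum_k \sum_i (D j k * C k i) *: x i.
  by apply: eq_bigr => k _; rewrite hy scaler_sumr; apply: eq_bigr => i _; rewrite scalerA.
by rewrite exchange_big /=; apply: eq_bigr => k _; rewrite mxE scaler_suml.
Qed.

(** The transition matrices in both directions are inverse to each other, so
    the sizes agree, and u is the square of a determinant. *)
Lemma tdet_change n m (x : 'I_n -> 'rV[E]_3) (y : 'I_m -> 'rV[E]_3) : basis x -> basis y ->
  exists2 u, u \in zi & tdet y = u * tdet x.
Proof.
move=> bx by_; have [C zC hC] := basis_change bx by_; have [D zD hD] := basis_change by_ bx.
have DC := basis_change_inv bx zC zD hC hD; have CD := basis_change_inv by_ zD zC hD hC.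
have enm : m = n.
  apply/eqP; rewrite eqn_leq; apply/andP; split.
    by rewrite -[X in (X <= _)%N](mxrank1 E m) -CD (leq_trans (mxrankM_maxr _ _)) // rank_leq_row.
  by rewrite -[X in (X <= _)%N](mxrank1 E n) -DC (leq_trans (mxrankM_maxr _ _)) // rank_leq_row.
subst m; exists (\det C ^+ 2); first by rewrite rpredX // rpred_det.
have -> : tdet y = \det (C *m (\matrix_(j, k) tform (x j) (x k)) *m C^T).
  congr (\det _); apply/matrixP=> j k; rewrite !mxE (hC j) tform_suml => [|l]; last exact/zi_qi.
  have -> : \sum_l C j l * tform (x l) (y k) = \sum_l \sum_i C j l * (C k i * tform (x l) (x i)).
    apply: eq_bigr => l _; rewrite (hC k) tform_sumr => [|i]; last exact/zi_qi.
    by rewrite big_distrr.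
  rewrite exchange_big /=; apply: eq_bigr => i _; rewrite !mxE big_distrl /=.
  by apply: eq_bigr => l _; rewrite mxE; ring.
by rewrite !det_mulmx det_tr /tdet; ring.
Qed.

Definition nat_basis (x : 'I_6 -> E) (a : 'I_(6 + (6 + 6))) : 'rV[E]_3 :=
  match fintype.split a with
  | inl j => x j *: delta_mx 0 0
  | inr b => match fintype.split b with
             | inl j => x j *: delta_mx 0 1
             | inr j => x j *: delta_mx 0 2%:R end
  end.

Lemma nat_basis0 x j : nat_basis x (lshift _ j) = x j *: delta_mx 0 0.
Proof. by rewrite /nat_basis (unsplitK (inl j)). Qed.
Lemma nat_basis1 x j : nat_basis x (rshift _ (lshift _ j)) = x j *: delta_mx 0 1.
Proof. by rewrite /nat_basis (unsplitK (inr (lshift 6 j))) (unsplitK (inl j)). Qed.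
Lemma nat_basis2 x j : nat_basis x (rshift _ (rshift _ j)) = x j *: delta_mx 0 2%:R.
Proof. by rewrite /nat_basis (unsplitK (inr (rshift 6 j))) (unsplitK (inr j)). Qed.

Lemma nat_basis_sum x (c : 'I_(6 + (6 + 6)) -> E) (k : 'I_3) : (\sum_a c a *: nat_basis x a) 0 k =
  \sum_j c (if k == 0 then lshift _ j else if k == 1 then rshift _ (lshift _ j)
            else rshift _ (rshift _ j)) * x j.
Proof.
have h0 j : (c (lshift _ j) *: nat_basis x (lshift _ j)) 0 k = c (lshift _ j) * x j * (k == 0)%:R.
  by rewrite nat_basis0 !mxE mulrA.
have h1 j : (c (rshift _ (lshift _ j)) *: nat_basis x (rshift _ (lshift _ j))) 0 k
    = c (rshift _ (lshift _ j)) * x j * (k == 1)%:R.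
  by rewrite nat_basis1 !mxE mulrA.
have h2 j : (c (rshift _ (rshift _ j)) *: nat_basis x (rshift _ (rshift _ j))) 0 k
    = c (rshift _ (rshift _ j)) * x j * (k == 2%:R)%:R.
  by rewrite nat_basis2 !mxE mulrA.
rewrite summxE big_split_ord big_split_ord (eq_bigr _ (fun j _ => h0 j)).
rewrite (eq_bigr _ (fun j _ => h1 j)) (eq_bigr _ (fun j _ => h2 j)) -!big_distrl /=.
have [e0|[e1|e2]] : k = 0 \/ k = 1 \/ k = 2%:R.
- by case: k {h0 h1 h2} => -[|[|[|]]] // hk; [left|right; left|right; right]; apply/val_inj.
- by rewrite e0 /= !mulr0 mulr1 !addr0.
- by rewrite e1 /= !mulr0 mulr1 addr0 add0r.
- by rewrite e2 /= !mulr0 mulr1 !add0r.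
Qed.

Lemma nat_basisP x : oE_basis x -> basis (nat_basis x).
Proof.
move=> [ox dW spx]; split=> [y|c zc e].
  split=> [ny|[c zc ->] k].
    have h k : y 0 k \in oE by apply/oEP/ny.
    have [c0 z0 e0] := spx _ (h 0); have [c1' z1 e1] := spx _ (h 1); have [c2' z2 e2] := spx _ (h 2%:R).
    exists (fun a => match fintype.split a with inl j => c0 j | inr b =>
       match fintype.split b with inl j => c1' j | inr j => c2' j end end).
      by move=> a; apply/asboolP; case: fintype.split => [j|b]; [exact: z0|case: fintype.split => j; [exact: z1|exact: z2]].
    apply/rowP => k; rewrite nat_basis_sum.
    case: k => -[|[|[|]]] //= hk.
    - rewrite (_ : Ordinal hk = 0) ?e0; last exact/val_inj.
      by apply: eq_bigr => j _; rewrite (unsplitK (inl j)).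
    - rewrite (_ : Ordinal hk = 1) ?e1; last exact/val_inj.
      by apply: eq_bigr => j _; rewrite (unsplitK (inr (lshift 6 j))) (unsplitK (inl j)).
    - rewrite (_ : Ordinal hk = 2%:R) ?e2; last exact/val_inj.
      by apply: eq_bigr => j _; rewrite (unsplitK (inr (rshift 6 j))) (unsplitK (inr j)).
  apply/oEP; rewrite nat_basis_sum rpred_sum // => j _; rewrite rpredM // zi_oE //.
  by apply/asboolP; exact: zc.
have zc' a : c a \in qi by apply: zi_qi; apply/asboolP/zc.
have key (f : 'I_6 -> 'I_(6 + (6 + 6))) : \sum_j c (f j) * x j = 0 -> forall j, c (f j) = 0.
  by move=> h; apply: (W_indep dW) h => j; exact: zc'.
have h k := congr1 (fun v : 'rV[E]_3 => v 0 k) e.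
move=> a; rewrite -(splitK a); case: (fintype.split a) => [j|b] /=.
  by have := h 0; rewrite /= nat_basis_sum mxE /= => /key.
rewrite -(splitK b); case: (fintype.split b) => j /=.
  by have := h 1; rewrite /= nat_basis_sum mxE /= => /key.
by have := h 2%:R; rewrite /= nat_basis_sum mxE /= => /key.
Qed.

Lemma sW x : (W (fun j => s (x j)) : 'M_6) = map_mx s (W x : 'M_6).
Proof.
apply/matrixP=> j a; rewrite !mxE /cj; have i k y : iter k s (s y) = s (iter k s y) by rewrite -iterSr.
by case: fintype.split => k; rewrite i ?st.
Qed.

Lemma tform_delta a b (p q : 'I_3) : tform (a *: delta_mx 0 p) (b *: delta_mx 0 q) =
  Tr (a * b * ((p == 0)%:R * (q == 0)%:R) +
      g * (s (s a) * b * ((p == 1)%:R * (q == 2%:R)%:R) + s a * b * ((p == 2%:R)%:R * (q == 1)%:R))).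
Proof.
rewrite /tform cyc_mul00 !mxE /= ![_ == p]eq_sym ![_ == q]eq_sym !rmorphM !rmorph_nat.
by congr Tr; ring.
Qed.

(** The Gram matrix is block antidiagonal in u and u^2: the blocks are the trace
    form of O_E, and two copies of it twisted by g and by a power of s, which
    leaves det W unchanged. *)
Lemma tdet_nat_basis x : tdet (nat_basis x) = Nr g ^+ 2 * disc x ^+ 3.
Proof.
have detS d y : \det (\matrix_(j < 6, k < 6) Tr (d * (s (y j) * x k))) = \det (W y : 'M_6) * Nr d * \det (W x : 'M_6).
  by rewrite (det_twist d (fun j => s (y j))) sW det_map_mx s_detW.
pose A := \matrix_(j < 6, k < 6) Tr (g * (s (s (x j)) * x k)).
pose B := \matrix_(j < 6, k < 6) Tr (g * (s (x j) * x k)).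
have -> : tdet (nat_basis x) =
    \det (block_mx (\matrix_(j < 6, k < 6) Tr (x j * x k)) 0 0 (block_mx A 0 0 B *m block_mx 0 1%:M 1%:M 0)).
  congr (\det _); rewrite mulmx_block !mulmx0 !mul0mx !mulmx1 !add0r addr0.
  have zT : Tr 0 = 0 by rewrite /Tr /trL !(rmorph0, addr0).
  apply/matrixP=> a b; rewrite [LHS]mxE -(splitK a) -(splitK b).
  pose sim := (mulr0, mul0r, mulr1, add0r, addr0).
  case: (fintype.split a) => [j|{}a]; case: (fintype.split b) => [k|{}b] /=.
  - by rewrite block_mxEul mxE !nat_basis0 tform_delta /= !sim.
  - rewrite block_mxEur [RHS]mxE -(splitK b) nat_basis0.
    by case: (fintype.split b) => k /=; rewrite ?nat_basis1 ?nat_basis2 tform_delta /= !sim zT.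
  - rewrite block_mxEdl [RHS]mxE -(splitK a) nat_basis0.
    by case: (fintype.split a) => j /=; rewrite ?nat_basis1 ?nat_basis2 tform_delta /= !sim zT.
  rewrite block_mxEdr -(splitK a) -(splitK b).
  case: (fintype.split a) => j; case: (fintype.split b) => k /=.
  - by rewrite block_mxEul [RHS]mxE !nat_basis1 tform_delta /= !sim zT.
  - by rewrite block_mxEur [RHS]mxE nat_basis1 nat_basis2 tform_delta /= !sim.
  - by rewrite block_mxEdl [RHS]mxE nat_basis1 nat_basis2 tform_delta /= !sim.
  - by rewrite block_mxEdr [RHS]mxE !nat_basis2 tform_delta /= !sim zT.
rewrite det_ublock det_mulmx det_ublock det_swap disc_trace !detS sW det_map_mx s_detW.
rewrite /disc -signr_odd /=; ring.
Qed.

Lemma disc_order_norm x : g \in oE -> g != 0 -> oE_basis x ->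
  ideal_norm (gaussian (gf_i E)) [set z | exists n (y : 'I_n -> 'rV[E]_3), basis y /\
     exists2 a, gaussian (gf_i E) a & z = a * tdet y]%classic
  = (nm (Nr g) ^ 2 * nm (disc x) ^ 3)%N.
Proof.
move=> og g0 bx; have [ox dW _] := bx; have zD := disc_zi ox; have zN := Nr_zi og.
have bX := nat_basisP bx.
have N0 : Nr g != 0 by rewrite /Nr /nL !(mulf_neq0, fmorph_eq0).
have D0 : disc x != 0 by rewrite expf_neq0.
have zT : tdet (nat_basis x) \in zi by rewrite tdet_nat_basis; exact: rpredM (rpredX 2 zN) (rpredX 3 zD).
have T0 : tdet (nat_basis x) != 0 by rewrite tdet_nat_basis; apply: mulf_neq0; apply: expf_neq0.
have -> : (nm (Nr g) ^ 2 * nm (disc x) ^ 3)%N = nm (tdet (nat_basis x)).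
  by rewrite tdet_nat_basis (nmM (rpredX 2 zN) (rpredX 3 zD)) (nmX 2 zN) (nmX 3 zD).
rewrite -(ideal_norm_zi zT T0); congr (ideal_norm _ _); rewrite eqEsubset; split=> z /=.
  case=> n [y [by_ [a za ->]]]; have [u zu ->] := tdet_change bX by_.
  by exists (a * u); [apply/asboolP; apply: rpredM (zu); apply/asboolP|rewrite mulrA].
by case=> a za ->; exists (6 + (6 + 6))%N, (nat_basis x); split=> //; exists a.
Qed.
End NaturalOrder.
End Sextic.

(** * A criterion for division algebras of index 3 *)

Section Division.
Variables (E : fieldType) (s : {rmorphism E -> E}) (g : E).
Hypothesis s3 : forall x, s (s (s x)) = x.
Hypothesis sg : s g = g.
Local Notation mul := (@cyc_mul E s g 3).
Local Notation "2'" := (2%:R : 'I_3).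

Lemma ord3 (k : 'I_3) : [\/ k = 0, k = 1 | k = 2'].
Proof.
by case: k => -[|[|[|]]] // hk; [apply: Or31|apply: Or32|apply: Or33]; apply/val_inj.
Qed.

Lemma cyc_mul_coord (x y : 'rV[E]_3) : [/\
  mul x y 0 0 = x 0 0 * y 0 0 + g * s (x 0 2') * y 0 1 + g * s (s (x 0 1)) * y 0 2',
  mul x y 0 1 = x 0 1 * y 0 0 + s (x 0 0) * y 0 1 + g * s (s (x 0 2')) * y 0 2' &
  mul x y 0 2' = x 0 2' * y 0 0 + s (x 0 1) * y 0 1 + s (s (x 0 0)) * y 0 2'].
Proof.
have e1 : lift ord0 ord0 = 1 :> 'I_3 by exact/val_inj.
have e2 : lift ord0 (lift ord0 ord0) = 2' by exact/val_inj.
split; rewrite mxE; under eq_bigr => j _ do rewrite big_mkcond;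
  rewrite !big_ord_recl !big_ord0 /= e1 e2 /bump /= /divn /=; ring.
Qed.

Lemma row3P (x y : 'rV[E]_3) : x 0 0 = y 0 0 -> x 0 1 = y 0 1 -> x 0 2' = y 0 2' -> x = y.
Proof. by move=> h0 h1 h2; apply/rowP => k; case: (ord3 k) => ->. Qed.

Lemma cyc_mulA x y z : mul x (mul y z) = mul (mul x y) z.
Proof.
have [a0 a1 a2] := cyc_mul_coord x y; have [b0 b1 b2] := cyc_mul_coord y z.
have [c0 c1 c2] := cyc_mul_coord x (mul y z); have [d0 d1 d2] := cyc_mul_coord (mul x y) z.
by apply: row3P; rewrite ?(c0, c1, c2) ?(d0, d1, d2) a0 a1 a2 b0 b1 b2 !(rmorphD, rmorphM) /= ?sg ?s3; ring.
Qed.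

Lemma cyc_one_coord : [/\ cyc_one E 3 0 0 = 1, cyc_one E 3 0 1 = 0 & cyc_one E 3 0 2' = 0].
Proof. by rewrite !mxE. Qed.

Lemma cyc_mul1 x : mul x (cyc_one E 3) = x.
Proof.
have [c0 c1 c2] := cyc_mul_coord x (cyc_one E 3); have [o0 o1 o2] := cyc_one_coord.
by apply: row3P; rewrite ?(c0, c1, c2) o0 o1 o2; ring.
Qed.
Lemma cyc_1mul x : mul (cyc_one E 3) x = x.
Proof.
have [c0 c1 c2] := cyc_mul_coord (cyc_one E 3) x; have [o0 o1 o2] := cyc_one_coord.
by apply: row3P; rewrite ?(c0, c1, c2) o0 o1 o2 !(rmorph0, rmorph1); ring.
Qed.

(** shiftc v is the product v u in the algebra, so that it commutes with left
    multiplications; shiftr is its transpose on functionals. *)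
Definition shiftc (v : 'rV[E]_3) : 'rV[E]_3 :=
  \row_k (if k == 0 then g * s (v 0 2') else if k == 1 then s (v 0 0) else s (v 0 1)).
Definition shiftr (v : 'rV[E]_3) : 'rV[E]_3 :=
  \row_k (if k == 0 then s (s (v 0 1)) else if k == 1 then s (s (v 0 2')) else g * s (s (v 0 0))).

Lemma shiftcE v : (shiftc v 0 0 = g * s (v 0 2')) * (shiftc v 0 1 = s (v 0 0)) *
  (shiftc v 0 2' = s (v 0 1)).
Proof. by rewrite !mxE. Qed.
Lemma shiftrE v : (shiftr v 0 0 = s (s (v 0 1))) * (shiftr v 0 1 = s (s (v 0 2'))) *
  (shiftr v 0 2' = g * s (s (v 0 0))).
Proof. by rewrite !mxE. Qed.
Lemma scaleE (a : E) (v : 'rV[E]_3) k : (a *: v) 0 k = a * v 0 k.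
Proof. by rewrite mxE. Qed.

Lemma shiftcZ a v : shiftc (a *: v) = s a *: shiftc v.
Proof. by apply: row3P; rewrite !(shiftcE, scaleE) !rmorphM; ring. Qed.
Lemma shiftc3 v : shiftc (shiftc (shiftc v)) = g *: v.
Proof. by apply: row3P; rewrite !(shiftcE, scaleE) ?rmorphM ?sg ?s3. Qed.
Lemma shiftrZ a v : shiftr (a *: v) = s (s a) *: shiftr v.
Proof. by apply: row3P; rewrite !(shiftrE, scaleE) !rmorphM; ring. Qed.
Lemma shiftr3 v : shiftr (shiftr (shiftr v)) = g *: v.
Proof. by apply: row3P; rewrite !(shiftrE, scaleE) ?rmorphM ?sg ?s3 ?sg ?s3. Qed.

Lemma scaler_inj (v : 'rV[E]_3) a b : v != 0 -> a *: v = b *: v -> a = b.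
Proof.
move=> v0 /eqP; rewrite -subr_eq0 -scalerBl scaler_eq0 (negPf v0) orbF subr_eq0.
by move/eqP.
Qed.

(** An invariant line generated by v with v u = e v exhibits g as a norm. *)
Lemma shiftc_line v e : v != 0 -> shiftc v = e *: v -> e * s e * s (s e) = g.
Proof.
move=> v0 h; apply: (scaler_inj v0).
by rewrite -shiftc3 !(shiftcZ, h, scalerA) ?rmorphM; congr (_ *: _); ring.
Qed.
Lemma shiftr_line v e : v != 0 -> shiftr v = e *: v -> e * s e * s (s e) = g.
Proof.
move=> v0 h; apply: (scaler_inj v0).
by rewrite -shiftr3 !(shiftrZ, h, scalerA) ?rmorphM ?s3; congr (_ *: _); ring.
Qed.

Lemma rank1_line (V : 'M[E]_3) (u w : 'rV[E]_3) : \rank V = 1%N -> u != 0 ->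
  (u <= V)%MS -> (w <= V)%MS -> exists e, w = e *: u.
Proof.
move=> rV u0 uV wV; have /sub_rVP[e ->] : (w <= u)%MS; last by exists e.
apply: submx_trans wV _.
by have := mxrank_leqif_sup uV; rewrite rV rank_rV u0 => -[_ <-].
Qed.

Hypothesis g_not_norm : forall e, e * s e * s (s e) <> g.

Definition left_mx (x : 'rV[E]_3) : 'M[E]_3 := cyc_splitting s g x.

Lemma left_mxE x (y : 'rV[E]_3) : mul x y = y *m (left_mx x)^T.
Proof.
have e (k : 'I_3) : (left_mx x)^T k = fun l => mul x (delta_mx 0 k) 0 l.
  by apply: funext => l; rewrite !mxE.
have [c0 c1 c2] := cyc_mul_coord x y.
have e1 : lift ord0 ord0 = 1 :> 'I_3 by exact/val_inj.
have e2 : lift ord0 (lift ord0 ord0) = 2' by exact/val_inj.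
apply: row3P; rewrite ?(c0, c1, c2) mxE !big_ord_recl !big_ord0 /= e1 e2 !e.
- have [-> _ _] := cyc_mul_coord x (delta_mx 0 ord0); have [-> _ _] := cyc_mul_coord x (delta_mx 0 1).
  by have [-> _ _] := cyc_mul_coord x (delta_mx 0 2'); rewrite !mxE /=; ring.
- have [_ -> _] := cyc_mul_coord x (delta_mx 0 ord0); have [_ -> _] := cyc_mul_coord x (delta_mx 0 1).
  by have [_ -> _] := cyc_mul_coord x (delta_mx 0 2'); rewrite !mxE /=; ring.
- have [_ _ ->] := cyc_mul_coord x (delta_mx 0 ord0); have [_ _ ->] := cyc_mul_coord x (delta_mx 0 1).
  by have [_ _ ->] := cyc_mul_coord x (delta_mx 0 2'); rewrite !mxE /=; ring.
Qed.

Lemma mul_shift x v : mul x (shiftc v) = shiftc (mul x v).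
Proof.
have [a0 a1 a2] := cyc_mul_coord x (shiftc v); have [b0 b1 b2] := cyc_mul_coord x v.
by apply: row3P; rewrite ?(a0, a1, a2) !shiftcE ?(b0, b1, b2) !(rmorphD, rmorphM) /= ?sg ?s3; ring.
Qed.

Lemma shiftr_dual (l v : 'rV[E]_3) :
  (shiftr l *m v^T) 0 0 = s (s ((l *m (shiftc v)^T) 0 0)).
Proof.
have e1 : lift ord0 ord0 = 1 :> 'I_3 by exact/val_inj.
have e2 : lift ord0 (lift ord0 ord0) = 2' by exact/val_inj.
rewrite !mxE !big_ord_recl !big_ord0 /= e1 e2 !mxE /= !(rmorphD, rmorphM, rmorph0) /= !sg !s3.
ring.
Qed.

(** The image of a singular left multiplication is stable under the shift. If
    its rank is 1, it is an invariant line; if its rank is 2, the functionals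
    that vanish on it are one. Both make g a norm. *)
Lemma left_unit x : x != 0 -> left_mx x \in unitmx.
Proof.
move=> x0; set M := left_mx x; rewrite -unitmx_tr.
have mx y : (mul x y <= M^T)%MS by rewrite left_mxE submxMl.
have := rank_leq_row M^T; rewrite leq_eqVlt => /orP[r3|]; first by rewrite -row_free_unit.
rewrite ltnS leq_eqVlt => /orP[/eqP r2|]; last rewrite ltnS leq_eqVlt => /orP[/eqP r1|].
- (* the annihilator of the right ideal x A is a line *)
  have rk : \rank (kermx M) = 1%N by rewrite mxrank_ker -mxrank_tr r2.
  have /rowV0Pn[l lk l0] : kermx M != 0 by rewrite -mxrank_eq0 rk.
  have lP (w : 'rV[E]_3) : (w <= kermx M)%MS <-> forall y, (w *m (mul x y)^T) 0 0 = 0.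
    split=> [/sub_kermxP h y|h].
      by rewrite left_mxE trmx_mul trmxK mulmxA h mul0mx mxE.
    apply/sub_kermxP/rowP => k; have := h (delta_mx 0 k); rewrite left_mxE trmx_mul trmxK mulmxA.
    by rewrite trmx_delta -colE !mxE.
  have /(rank1_line rk l0 lk)[e /(shiftr_line l0)/g_not_norm//] : (shiftr l <= kermx M)%MS.
  apply/lP => y; rewrite shiftr_dual -mul_shift; have /lP -> := lk.
  by rewrite !rmorph0.
- have [e /(shiftc_line x0)/g_not_norm//] : exists e, shiftc x = e *: x.
  have xM := mx (cyc_one E 3); have sM := mx (shiftc (cyc_one E 3)).
  rewrite mul_shift cyc_mul1 in sM; rewrite cyc_mul1 in xM; exact: rank1_line sM.
rewrite ltnS leqn0 mxrank_eq0 => /eqP M0.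
by case/eqP: x0; rewrite -[x]cyc_mul1 left_mxE -/M M0 mulmx0.
Qed.

Lemma cyc_right_inv x : x != 0 -> exists y, mul x y = cyc_one E 3.
Proof.
move=> /left_unit u; exists (cyc_one E 3 *m invmx (left_mx x)^T).
by rewrite left_mxE mulmxKV // unitmx_tr.
Qed.

Lemma cyc_divisionP : cyc_division s g 3.
Proof.
move=> x x0; have [y xy] := cyc_right_inv x0.
have y0 : y != 0.
  apply/eqP => y0; have := congr1 (fun w : 'rV[E]_3 => w 0 0) xy.
  rewrite y0 left_mxE mul0mx !mxE /= => /esym/eqP; by rewrite oner_eq0.
have [z yz] := cyc_right_inv y0; exists y => //.
suff -> : x = z by [].
by rewrite -[LHS]cyc_mul1 -yz cyc_mulA xy cyc_1mul.
Qed.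
End Division.

(** * From Galois groups to pairs of commuting automorphisms *)

Section GaussianExtension.
Variables (F : fieldExtType rat) (i : F).
Hypothesis i_sq : i ^+ 2 = -1.
Hypothesis F_gen : <<1; i>>%VS = {:F}%VS.

Lemma F_coords (x : F) : exists a b : rat, x = a%:A + b%:A * i.
Proof.
have : x \in <<1; i>>%VS by rewrite F_gen memvf.
case/Fadjoin_polyP => p /polyOverP hp ->; rewrite horner_coef.
have ii : i * i = -1 by rewrite -expr2.
pose r : {rmorphism rat -> F} := in_alg F.
pose Q (y : F) := exists a b : rat, y = r a + r b * i.
have Q0 a : Q (r a) by exists a, 0; rewrite rmorph0 mul0r addr0.
have QD y z : Q y -> Q z -> Q (y + z).
  by case=> a [b ->] [c [d ->]]; exists (a + c), (b + d); rewrite !rmorphD; ring.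
have QM y z : Q y -> Q z -> Q (y * z).
  case=> a [b ->] [c [d ->]]; exists (a * c - b * d), (a * d + b * c).
  by rewrite !(rmorphD, rmorphN, rmorphM) /=; ring: ii.
suff : Q (\sum_(k < size p) p`_k * i ^+ k) by [].
apply: (big_ind Q) => // [|k _]; first by rewrite -(rmorph0 r).
apply: (QM); first by have /vlineP[a ->] := hp k; exact: (Q0 a).
elim: (k : nat) => [|n IH]; first by rewrite expr0 -(rmorph1 r).
by rewrite exprS; apply: (QM) => //; exists 0, 1; rewrite rmorph0 rmorph1 mul1r add0r.
Qed.

Variable E : fieldExtType F.

Definition alg_rat : {rmorphism rat -> E} := in_alg E \o in_alg F.

Lemma alg_i_sq : (i%:A : E) ^+ 2 = -1.
Proof. by rewrite -[_%:A]/(in_alg E i) -rmorphXn i_sq rmorphN1. Qed.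

Definition gext : gaussian_field := GaussianField alg_rat alg_i_sq.

Lemma mem1_qi (x : E) : x \in 1%VS -> (x : gext) \in qi.
Proof.
case/vlineP=> c ->; have [a [b ->]] := F_coords c; apply/(@qiP gext); exists a, b.
by rewrite /cplx /= -[LHS]/(in_alg E _) rmorphD rmorphM.
Qed.

End GaussianExtension.

Section Bridge.
Variables (F : fieldExtType rat) (i : F).
Hypothesis i_sq : i ^+ 2 = -1.
Hypothesis F_gen : <<1; i>>%VS = {:F}%VS.
Variable E : splittingFieldType F.
Local Notation gext := (gext i_sq E).
Variables (L : {subfield E}) (s : gal_of {:E}).
Hypothesis galE : galois 1 {:E}.
Hypothesis cycE : cyclic 'Gal({:E} / 1).
Hypothesis dimE : \dim {:E} = 6%N.
Hypothesis dimL : \dim_L {:E} = 3%N.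
Hypothesis genL : 'Gal({:E} / L)%g = <[s]>%g.

Lemma galL : galois L {:E}.
Proof. by apply: galoisS galE; rewrite sub1v subvf. Qed.

Lemma fixL a : (a \in L) = (s a == a).
Proof.
have /galois_fixedField eL := galL; rewrite -{1}eL; apply/fixedFieldP/eqP; rewrite ?memvf //.
  by apply; rewrite genL cycle_id.
move=> sa x; rewrite genL => /cycleP[k ->]; elim: k => [|k IH]; first by rewrite gal_id.
by rewrite expgS galM ?memvf // sa.
Qed.

Lemma order_s : #[s]%g = 3%N.
Proof. by rewrite orderE -genL -galois_dim // galL. Qed.

Lemma sK3 x : s (s (s x)) = x.
Proof.
have := expg_order s; rewrite order_s => e.
by have := congr1 (fun f : gal_of {:E} => f x) e; rewrite !expgS expg0 mulg1 !galM ?memvf // gal_id.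
Qed.

Lemma order_gal : #|'Gal({:E} / 1)|%g = 6%N.
Proof. by rewrite -galois_dim // dimv1 divn1. Qed.

Lemma gal_nid (x : gal_of {:E}) : x != 1%g -> exists a, x a <> a.
Proof.
move=> x1; apply: contrapT => h; case/eqP: x1; apply/eqP/gal_eqP => a _; rewrite gal_id.
by apply: contrapT => ha; apply: h; exists a.
Qed.

(** t is the cube of a generator of the cyclic group of order 6; the square of
    that generator spans the same subgroup as s. *)
Lemma involution : exists t : gal_of {:E}, [/\ t \in 'Gal({:E} / 1)%g, forall x, t (t x) = x,
  forall x, s (t x) = t (s x), forall x, s x = x -> t x = x -> x \in 1%VS &
  exists x, t x <> x].
Proof.
have [t0 eG] := cyclicP cycE; have ot0 : #[t0]%g = 6%N by rewrite orderE -eG order_gal.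
have sG : s \in 'Gal({:E} / 1)%g.
  have /fintype.subsetP h := galS {:E}%AS (sub1v L); by apply: h; rewrite genL cycle_id.
pose t := (t0 ^+ 3)%g.
have tG : t \in 'Gal({:E} / 1)%g by rewrite eG mem_cycle.
have ot : #[t]%g = 2%N by rewrite orderXdiv ot0.
have t2G : (t0 ^+ 2)%g \in 'Gal({:E} / 1)%g by rewrite eG mem_cycle.
have e2 : <[t0 ^+ 2]>%g = <[s]>%g.
  apply/eqP; rewrite (eq_subG_cyclic cycE) -?orderE ?order_s ?orderXdiv ?ot0 //.
    by rewrite cycle_subG.
  by rewrite cycle_subG.
have comm : commute s t.
  by have /centsP := cyclic_abelian cycE; apply.
exists t; split=> // [x|x|x sx tx|].
- have := expg_order t; rewrite ot => e.
  by have := congr1 (fun f : gal_of {:E} => f x) e; rewrite !expgS expg0 mulg1 !galM ?memvf // gal_id.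
- have := congr1 (fun f : gal_of {:E} => f x) comm; by rewrite !galM ?memvf.
- have := galE => /galois_fixedField <-; apply/fixedFieldP; first exact: memvf.
  have h2 : (t0 ^+ 2)%g x = x.
    have : (t0 ^+ 2)%g \in <[s]>%g by rewrite -e2 cycle_id.
    case/cycleP=> k ->; elim: k => [|k IH]; first by rewrite gal_id.
    by rewrite expgS galM ?memvf // sx.
  have h1 : t0 x = x by rewrite -{2}tx /t expgSr galM ?memvf // h2.
  move=> y; rewrite eG => /cycleP[k ->]; elim: k => [|k IH]; first by rewrite gal_id.
  by rewrite expgS galM ?memvf // h1.
- by apply: gal_nid; rewrite -order_eq1 ot.
Qed.

(** The restriction of t to L generates Gal(L / Q(i)), which has order 2. *)
Lemma galTrace_L (t : gal_of {:E}) a : t \in 'Gal({:E} / 1)%g -> (forall x, t (t x) = x) ->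
  (forall x, s x = x -> t x = x -> x \in 1%VS) -> a \in L -> galTrace 1 L a = a + t a.
Proof.
move=> tG t2 fixst aL.
have nL : ('Gal({:E} / L) <| 'Gal({:E} / 1))%g.
  by rewrite -sub_abelian_normal ?galS ?sub1v ?cyclic_abelian.
have gL : galois 1 L.
  by have := normal_fixedField_galois galE nL; have /galois_fixedField -> := galL.
have [_ _ normL] := and3P gL.
have sub : (1 <= L <= {:E})%VS by rewrite sub1v subvf.
have oL : #|'Gal(L / 1)|%g = 2%N.
  rewrite -galois_dim // dimv1 divn1; have := field_dimS (subvf L).
  move=> /dvdnP[k ek]; move: dimL; rewrite ek mulnK ?adim_gt0 // => k3.
  by move: ek; rewrite dimE k3 => ek; apply/eqP; rewrite -(eqn_pmul2l (isT : 0 < 3)%N) -ek.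
pose c := normalField_cast L t.
have cE : {in L, c =1 t} := normalField_cast_eq sub normL tG.
have cG : c \in 'Gal(L / 1)%g.
  by rewrite -(normalField_img galE sub normL); apply: mem_morphim.
have c1 : c != 1%g.
  apply/eqP => e.
  have h x : x \in L -> x \in 1%VS.
    move=> xL; apply: fixst; first by apply/eqP; rewrite -fixL.
    by rewrite -cE // e gal_id.
  have L1 : (L <= 1%AS)%VS by apply/subvP.
  have /subset_leq_card := galS {:E}%AS L1.
  by rewrite order_gal genL -orderE order_s.
have eG : 'Gal(L / 1)%g = [set 1%g; c].
  apply/esym/eqP; rewrite eqEcard oL cards2 eq_sym c1 andbT.
  by apply/fintype.subsetP => x /set2P[] ->.
rewrite /galTrace eG big_setU1 ?inE 1?eq_sym //= big_set1 gal_id; congr (_ + _).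
exact: cE.
Qed.
(** A Galois automorphism seen as a ring endomorphism of the Gaussian field. *)
Definition grm (x : gal_of {:E}) : {rmorphism gext -> gext} := (x : {rmorphism E -> E}).

Definition sextic_pair (t : gal_of {:E}) :=
  [/\ forall x, t (t x) = x, forall x, s (t x) = t (s x),
      forall x : gext, grm s x = x -> grm t x = x -> x \in qi, exists x, s x <> x
    & exists x, t x <> x].

Lemma sextic_pairP : exists2 t, sextic_pair t & forall a, a \in L -> galTrace 1 L a = a + t a.
Proof.
have [t [tG t2 st fixst tn]] := involution; exists t; last by move=> a; exact: galTrace_L.
split=> //; first by move=> x sx tx; apply: (mem1_qi i_sq F_gen); exact: fixst.
by apply: gal_nid; rewrite -order_eq1 order_s.
Qed.

Lemma grm_i (x : gal_of {:E}) : grm x (gf_i gext) = gf_i gext.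
Proof. by rewrite /= linearZ /= rmorph1. Qed.

Section Pair.
Variable t : gal_of {:E}.
Hypothesis st_pair : sextic_pair t.
Hypothesis tr_t : forall a, a \in L -> galTrace 1 L a = a + t a.

Lemma exists_basis : exists x, oE_basis (grm s) (grm t) x.
Proof.
have [t2 st fixst sn tn] := st_pair.
exact: (@ex_oE_basis gext (grm s) (grm t) sK3 t2 st fixst (grm_i s) (grm_i t) sn tn).
Qed.

Lemma basis_bound x : oE_basis (grm s) (grm t) x -> (3 ^ 6 * 13 ^ 4 <= nm (disc (grm s) (grm t) x))%N.
Proof.
have [t2 st fixst sn tn] := st_pair.
exact: (@lower_bound gext (grm s) (grm t) sK3 t2 st fixst (grm_i s) (grm_i t) sn tn).
Qed.

Lemma disc_normE (g : E) x : g \in L -> alg_integer g -> g != 0 -> oE_basis (grm s) (grm t) x ->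
  disc_norm i L s g 3 = (nm (Nr (grm s) (grm t) g) ^ 2 * nm (disc (grm s) (grm t) x) ^ 3)%N.
Proof.
have [t2 st fixst sn tn] := st_pair.
rewrite fixL => /eqP sg ig g0 bx; have og : (g : gext) \in oE by apply/oEP.
rewrite -(@disc_order_norm gext (grm s) (grm t) sK3 t2 st fixst (grm_i s) (grm_i t) g x og g0 bx).
rewrite /disc_norm; congr (ideal_norm _ _).
have trE n (y : 'I_n -> 'rV[E]_3) : trace_det L s g y = tdet (E := gext) (grm s) (grm t) g y.
  congr (\det _); apply/matrixP => j k; rewrite !mxE.
  rewrite (reduced_trace3 (E := gext) (grm s) g) tr_t // fixL; apply/eqP.
  exact: (s_trL (E := gext) (s := grm s) sK3).
apply/seteqP; split=> z [n [y [by_ [a za ->]]]]; exists n, y; split=> //; exists a => //.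
  by rewrite trE.
by rewrite trE.
Qed.
End Pair.

Lemma disc_norm_bound (g : E) : g \in L -> alg_integer g -> g != 0 ->
  (3 ^ 18 * 13 ^ 12 <= disc_norm i L s g 3)%N.
Proof.
move=> gL ig g0; have [t tp tr] := sextic_pairP; have [x bx] := exists_basis tp.
rewrite (disc_normE tp tr gL ig g0 bx); have bnd := basis_bound tp bx.
have [t2 st fixst sn tn] := tp.
have zN : (Nr (grm s) (grm t) g : gext) \in zi.
  by apply: (Nr_zi (E := gext) sK3 t2 st fixst); apply/oEP.
have N0 : Nr (grm s) (grm t) g != 0.
  by rewrite /Nr /nL !(mulf_neq0, fmorph_eq0).
have -> : (3 ^ 18 * 13 ^ 12 = (3 ^ 6 * 13 ^ 4) ^ 3)%N by rewrite expnMn -!expnM.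
apply: leq_trans (leq_pmull _ _); first by rewrite leq_exp2r.
by rewrite expn_gt0 nm_gt0.
Qed.
End Bridge.

(** * A sixth root of unity that is not a norm *)

(** As 9 = - 4 modulo 13, the divisibility reads r^3 = 4 q^3, and 4 is not a cube
    modulo 13. *)
Lemma cubes_mod13 (a b : int) : exists r q : nat * int,
  [/\ a = 13 * r.2 + r.1%:Z, b = 13 * q.2 + q.1%:Z &
   (13 %| r.1 ^ 3 + 9 * q.1 ^ 3)%N -> r.1 = 0%N /\ q.1 = 0%N].
Proof.
have chk : all (fun r => all (fun q => (13 %| r ^ 3 + 9 * q ^ 3)%N ==> (r == 0%N) && (q == 0%N))
  (iota 0 13)) (iota 0 13) by vm_compute.
have res c : exists r : nat * int, c = 13 * r.2 + r.1%:Z /\ (r.1 < 13)%N.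
  by exists (absz (c %% 13)%Z, (c %/ 13)%Z) => /=; lia.
have [r [er hr]] := res a; have [q [eq hq]] := res b; exists r, q; split; [exact: er|exact: eq|].
move/allP: chk => /(_ r.1); rewrite mem_iota => /(_ hr)/allP/(_ q.1); rewrite mem_iota => /(_ hq).
by move/implyP => h /h/andP[/eqP-> /eqP->].
Qed.

Section NonNorm.
Variables (E : gaussian_field) (g : E).
Local Notation I := (gf_i E).
Hypothesis g2 : g * g = g - 1.
Hypothesis gq : g \notin qi.

Lemma g_free (u v : E) : u \in qi -> v \in qi -> u + v * g = 0 -> u = 0 /\ v = 0.
Proof.
move=> qu qv e; have [v0|v0] := eqVneq v 0; first by move: e; rewrite v0 mul0r addr0.
case/negP: gq; have -> : g = - u / v.
  by apply: (mulfI v0); rewrite mulrCA divff // mulr1 -[LHS]add0r -(subrr u) -addrA addrCA e addr0.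
by rewrite rpred_div ?rpredN.
Qed.

(** The ring Z[i][g], where g is a primitive 6th root of unity. *)
Definition lam : {pred E} := fun x => `[< exists u v, [/\ u \in zi, v \in zi & x = u + v * g] >].
Lemma lamP x : reflect (exists u v, [/\ u \in zi, v \in zi & x = u + v * g]) (x \in lam).
Proof. exact: asboolP. Qed.

Lemma lam_subring : subring_closed lam.
Proof.
split.
- by apply/lamP; exists 1, 0; rewrite rpred0 rpred1 mul0r addr0.
- move=> x y /lamP[u [v [zu zv ->]]] /lamP[p [q [zp zq ->]]]; apply/lamP.
  by exists (u - p), (v - q); rewrite !rpredB //; split=> //; ring.
- move=> x y /lamP[u [v [zu zv ->]]] /lamP[p [q [zp zq ->]]]; apply/lamP.
  exists (u * p - v * q), (u * q + v * p + v * q); rewrite !(rpredB, rpredD, rpredM) //.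
  by split=> //; ring: g2.
Qed.
HB.instance Definition _ := GRing.isSubringClosed.Build E lam lam_subring.

Lemma zi_lam x : x \in zi -> x \in lam.
Proof. by move=> zx; apply/lamP; exists x, 0; rewrite rpred0 mul0r addr0. Qed.
Lemma g_lam : g \in lam.
Proof. by apply/lamP; exists 0, 1; rewrite rpred0 rpred1 mul1r add0r. Qed.
Lemma i_lam : I \in lam. Proof. by rewrite zi_lam ?i_zi. Qed.

Lemma lamD x y : x \in lam -> y \in lam -> x + y \in lam. Proof. exact: rpredD. Qed.
Lemma lamB x y : x \in lam -> y \in lam -> x - y \in lam. Proof. exact: rpredB. Qed.
Lemma lamM x y : x \in lam -> y \in lam -> x * y \in lam. Proof. exact: rpredM. Qed.
Lemma lamN x : x \in lam -> - x \in lam. Proof. by rewrite rpredN. Qed.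
Lemma lamX x n : x \in lam -> x ^+ n \in lam. Proof. exact: rpredX. Qed.
Lemma lam_nat n : n%:R \in lam. Proof. exact: rpred_nat. Qed.
Lemma lam_int (n : int) : n%:~R \in lam. Proof. exact: rpred_int. Qed.

Ltac lam_closed := repeat first [ assumption | exact: g_lam | exact: i_lam | exact: lam_nat | exact: lam_int
  | exact: (lam_nat 1)
  | match goal with
    | |- is_true (- _ \in _) => apply: lamN
    | |- is_true (_ + - _ \in _) => apply: lamB
    | |- is_true (_ + _ \in _) => apply: lamD
    | |- is_true (_ * _ \in _) => apply: lamM
    | |- is_true (_ ^+ _ \in _) => apply: lamX
    end ].

(** A generator of a prime of Z[i][g] above 13, with residue field of 13
    elements, in which i is 5 and g is 4. *)
Definition vpi : E := 1 - I + g.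

Lemma vpi_neq0 : vpi != 0.
Proof.
apply/eqP => e; have : 1 - I + 1 * g = 0 by rewrite mul1r.
case/g_free; rewrite ?rpred1 ?rpredB ?rpred1 ?zi_qi ?i_zi // => _ /eqP; by rewrite oner_eq0.
Qed.

Definition vdvd x := exists2 w, w \in lam & x = vpi * w.

Lemma vdvdD x y : vdvd x -> vdvd y -> vdvd (x + y).
Proof. by case=> w lw -> [z lz ->]; exists (w + z); rewrite ?rpredD ?mulrDr. Qed.
Lemma vdvdM x y : x \in lam -> vdvd y -> vdvd (x * y).
Proof. by move=> lx [w lw ->]; exists (x * w); rewrite ?rpredM // mulrCA. Qed.
Lemma vdvd13 : vdvd 13%:R.
Proof.
exists ((7%:R + 4%:R * I) + (- 2%:R - 3%:R * I) * g); last by rewrite /vpi; ring: (gf_i2E E) g2.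
by lam_closed.
Qed.

Lemma lam_res x : x \in lam -> exists n : int, vdvd (x - n%:~R).
Proof.
case/lamP=> _ [_ [/ziP[a [b ->]] /ziP[c [d ->]] ->]].
exists (a + 5 * b + 4 * c + 20 * d).
exists ((b%:~R + 4 * d%:~R) * (- 3%:R - I + (1 + I) * g) + (c%:~R + d%:~R * I) * (- 2%:R - I + (1 + I) * g)).
  by lam_closed.
rewrite /cplx !rmorph_int !rmorphD !rmorphM /= /vpi. ring: (gf_i2E E) g2.
Qed.

(** Comparing coordinates in n = vpi (u + v g) gives n = (- 2 + 3 i) v, and
    - 2 + 3 i has norm 13. *)
Lemma vdvd_int (n : int) : vdvd n%:~R -> (13 %| absz n)%N.
Proof.
case=> w /lamP[u [v [zu zv ->]]] e; have zI := i_zi E.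
have [|||e1 e2] := @g_free ((1 - I) * u - v - n%:~R) (u + (2%:R - I) * v).
- by rewrite zi_qi // !(rpredB, rpredM, rpred1, rpred_int).
- by rewrite zi_qi // rpredD // rpredM // rpredB // rpred_nat.
- by rewrite e /vpi; ring: g2.
have en : n%:~R = (- 2%:R + 3%:R * I) * v.
  apply/eqP; rewrite -subr_eq0; apply/eqP.
  transitivity (((1 - I) * u - v - n%:~R) * -1 + (1 - I) * (u + (2%:R - I) * v)); last by rewrite e1 e2; ring.
  by ring: (gf_i2E E).
have zc : - 2%:R + 3%:R * I \in (zi : {pred E}) by rewrite rpredD ?rpredN ?rpredM ?rpred_nat.
have nc : nm (- 2%:R + 3%:R * I : E) = 13%N.
  have -> : - 2%:R + 3%:R * I = cplx E (-2)%:~R 3%:~R by rewrite /cplx !rmorph_int.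
  by rewrite nm_cplx.
have : (13 %| absz n ^ 2)%N.
  have <- : nm (n%:~R : E) = (absz n ^ 2)%N.
    by rewrite /nm Nm_int -rmorphXn /= numq_int abszX.
  by rewrite en nmM // nc dvdn_mulr.
by rewrite Euclid_dvdX // => /andP[].
Qed.

Lemma vdvd_cubes x y : x \in lam -> y \in lam -> vdvd (x ^+ 3 - g * y ^+ 3) -> vdvd x /\ vdvd y.
Proof.
move=> lx ly h; have [n hn] := lam_res lx; have [m hm] := lam_res ly.
have [r [q [en em chk]]] := cubes_mod13 n m.
have mod13 z k (p : nat * int) : k = 13 * p.2 + p.1%:Z -> vdvd (z - k%:~R) -> vdvd (z - p.1%:R).
  move=> -> hz; have -> : z - p.1%:R = z - (13 * p.2 + p.1%:Z)%:~R + p.2%:~R * 13%:R.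
    by rewrite rmorphD rmorphM /=; ring.
  by apply: vdvdD hz (vdvdM _ vdvd13); rewrite rpred_int.
have hr := mod13 _ _ _ en hn; have hq := mod13 _ _ _ em hm.
have [r0 q0] : r.1 = 0%N /\ q.1 = 0%N.
  apply: chk; apply: (@vdvd_int (r.1 ^ 3 + 9 * q.1 ^ 3)%N%:Z).
  rewrite -[_%:~R]/(_%:R) natrD natrM !natrX.
  have -> : r.1%:R ^+ 3 + 9%:R * q.1%:R ^+ 3 = 13%:R * q.1%:R ^+ 3 + (x ^+ 3 - g * y ^+ 3)
    + (- (x ^+ 2 + x * r.1%:R + r.1%:R ^+ 2)) * (x - r.1%:R) + g * (y ^+ 2 + y * q.1%:R + q.1%:R ^+ 2) * (y - q.1%:R)
    + q.1%:R ^+ 3 * (g - 4%:R) by ring.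
  have hg : vdvd (g - 4%:R).
    exists (- 2%:R - I + (1 + I) * g); last by rewrite /vpi; ring: (gf_i2E E) g2.
    by lam_closed.
  have lg := g_lam.
  apply: vdvdD (vdvdD (vdvdD (vdvdD _ h) _) _) _; last 3 first.
  - by apply: vdvdM hr; lam_closed.
  - by apply: vdvdM hq; rewrite rpredM ?rpredD ?rpredM ?rpredX ?rpred_nat.
  - by apply: vdvdM hg; rewrite rpredX ?rpred_nat.
  by rewrite mulrC; apply: vdvdM vdvd13; rewrite rpredX ?rpred_nat.
by move: hr hq; rewrite r0 q0 !subr0.
Qed.

(** alp is the cube of the Lagrange resolvent of the cubic (root_resolvent). It
    is divisible by vpi exactly once, with cofactor bet. *)
Definition bet : E := (8%:R + 30%:R * I) + (7%:R - 16%:R * I) * g.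
Definition alp : E := (31%:R + 38%:R * I) + (6%:R - 9%:R * I) * g.

Lemma alp_vpi : alp = vpi * bet.
Proof. by rewrite /alp /vpi /bet; ring: (gf_i2E E) g2. Qed.
Lemma bet_lam : bet \in lam.
Proof. by rewrite /bet; lam_closed. Qed.
(** c is invertible modulo vpi, with inverse k. *)
Lemma vdvd_inv (c k x : E) : c \in lam -> k \in lam -> x \in lam ->
  vdvd (1 - k * c) -> vdvd (c * x ^+ 3) -> vdvd x.
Proof.
move=> lc lk lx h1 h2; have l0 : 0 \in lam by exact: (lam_nat 0).
apply: (fun h => (vdvd_cubes lx l0 h).1).
have -> : x ^+ 3 - g * 0 ^+ 3 = x ^+ 3 * (1 - k * c) + k * (c * x ^+ 3) by ring.
by apply: vdvdD; [apply: vdvdM h1|apply: vdvdM h2]; lam_closed.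
Qed.

Lemma bet_inv : vdvd (1 - 3%:R * bet).
Proof.
exists (1 - 53%:R * I + (- 29%:R + 36%:R * I) * g); first by lam_closed.
by rewrite /bet /vpi; ring: (gf_i2E E) g2.
Qed.

(** The left-hand side is the norm of y0 + y1 R + y2 R^2 when R^3 = alp. Modulo
    vpi it is y0^3, so vdvd_cubes gives vpi | y0 and vpi | a + b g; comparing the
    valuations of the other terms gives vpi | y1, then vpi | y2, and dividing by
    vpi^3 gives a smaller solution. The measure is the norm of
    a^2 + a b + b^2, which is the relative norm of a + b g. *)
Lemma descent N (a b y0 y1 y2 : E) : a \in zi -> b \in zi -> y0 \in lam -> y1 \in lam -> y2 \in lam ->
  (nm (a ^+ 2 + a * b + b ^+ 2) < N)%N ->
  y0 ^+ 3 + alp * y1 ^+ 3 + alp ^+ 2 * y2 ^+ 3 - 3%:R * alp * (y0 * y1 * y2) = g * (a + b * g) ^+ 3 ->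
  a = 0 /\ b = 0.
Proof.
elim: N => [//|N IH] in a b y0 y1 y2 *; move=> za zb l0 l1 l2 hN; rewrite alp_vpi => eqn.
have [q0|q0] := eqVneq (a ^+ 2 + a * b + b ^+ 2) 0.
  have /eqP : (a + b * g) * (a + b + (- b) * g) = 0 by rewrite -q0; ring: g2.
  rewrite mulf_eq0 => /orP[] /eqP/g_free; first by case; rewrite ?zi_qi.
  case; rewrite ?rpredN ?rpredD ?zi_qi // => + /eqP; rewrite oppr_eq0 => + /eqP b0.
  by rewrite b0 addr0.
have v0 := vpi_neq0; have lb := bet_lam; have lg := g_lam; have zI := i_zi E.
have lv : vpi \in lam by rewrite /vpi; lam_closed.
have lm : a + b * g \in lam by apply/lamP; exists a, b.
have [|[z0 lz0 e0] [w /lamP[a' [b' [za' zb' ew]]] em]] := vdvd_cubes l0 lm.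
  exists (bet * (3%:R * (y0 * y1 * y2) - y1 ^+ 3 - vpi * bet * y2 ^+ 3)); first by lam_closed.
  by rewrite -eqn; ring.
have lw : w \in lam by rewrite ew; apply/lamP; exists a', b'.
rewrite em e0 in eqn.
have [|z1 lz1 e1] := @vdvd_inv bet 3%:R y1 lb (lam_nat 3) l1 bet_inv.
  exists (g * vpi * w ^+ 3 - vpi * z0 ^+ 3 - bet ^+ 2 * y2 ^+ 3 + 3%:R * bet * (z0 * y1 * y2)).
    by lam_closed.
  apply: (mulfI v0); transitivity (g * (vpi * w) ^+ 3 -
    ((vpi * z0) ^+ 3 + (vpi * bet) ^+ 2 * y2 ^+ 3 - 3%:R * (vpi * bet) * (vpi * z0 * y1 * y2))).
    by rewrite -eqn; ring.
  by ring.
rewrite e1 in eqn.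
have [||z2 lz2 e2] := @vdvd_inv (bet ^+ 2) 9%:R y2 (lamX 2 lb) (lam_nat 9) l2.
- have -> : 1 - 9%:R * bet ^+ 2 = (1 + 3%:R * bet) * (1 - 3%:R * bet) by ring.
  by apply: vdvdM bet_inv; lam_closed.
- exists (g * w ^+ 3 - z0 ^+ 3 - vpi * bet * z1 ^+ 3 + 3%:R * bet * (z0 * z1 * y2)).
    by lam_closed.
  apply: (mulfI (mulf_neq0 v0 v0)); transitivity (g * (vpi * w) ^+ 3 -
    ((vpi * z0) ^+ 3 + (vpi * bet) * (vpi * z1) ^+ 3 - 3%:R * (vpi * bet) * (vpi * z0 * (vpi * z1) * y2))).
    by rewrite -eqn; ring.
  by ring.
rewrite e2 in eqn.
have [ea eb] : a = (1 - I) * a' - b' /\ b = a' + (2%:R - I) * b'.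
  have [|||/eqP ea /eqP eb] := @g_free (a - ((1 - I) * a' - b')) (b - (a' + (2%:R - I) * b')).
  - by rewrite zi_qi // rpredB // rpredB // rpredM // rpredB // rpred1.
  - by rewrite zi_qi // rpredB // rpredD // rpredM // rpredB // rpred_nat.
  - transitivity ((a + b * g) - vpi * w); first by rewrite ew /vpi; ring: g2.
    by rewrite em subrr.
  by move: ea eb; rewrite !subr_eq0 => /eqP-> /eqP->.
have zq' : a' ^+ 2 + a' * b' + b' ^+ 2 \in zi.
  by rewrite rpredD ?rpredX // rpredD ?rpredX // rpredM.
have eq : a ^+ 2 + a * b + b ^+ 2 = (2%:R - 3%:R * I) * (a' ^+ 2 + a' * b' + b' ^+ 2).
  by rewrite ea eb; ring: (gf_i2E E).
have n13 : nm (2%:R - 3%:R * I : E) = 13%N.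
  have -> : 2%:R - 3%:R * I = cplx E (2)%:~R (- 3)%:~R by rewrite /cplx !rmorph_int mulNr.
  by rewrite nm_cplx.
have zc : 2%:R - 3%:R * I \in (zi : {pred E}) by rewrite rpredB ?rpredM ?rpred_nat.
have q0' : a' ^+ 2 + a' * b' + b' ^+ 2 != 0.
  by apply: contraNneq q0 => h; rewrite eq h mulr0.
have [||a0 b0] := IH a' b' z0 z1 z2 za' zb' lz0 lz1 lz2.
- have := nm_gt0 zq' q0'; move: hN; rewrite eq nmM // n13; clear; lia.
- rewrite alp_vpi -ew; apply: (mulfI (expf_neq0 3 v0)).
  by transitivity (g * (vpi * w) ^+ 3); [rewrite -eqn|]; ring.
by rewrite ea eb a0 b0 !mulr0 subr0 addr0.
Qed.

Variable s : {rmorphism E -> E}.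
Hypothesis s3 : forall x, s (s (s x)) = x.
Hypothesis sg : s g = g.
Hypothesis fixs : forall x, s x = x -> exists u v, [/\ u \in qi, v \in qi & x = u + v * g].
Variable R : E.
Hypothesis R3 : R ^+ 3 = alp.
Hypothesis sR : s R = - g * R.

Lemma lam_denom (x : E) : s x = x -> exists2 n : nat, n != 0%N & n%:R * x \in lam.
Proof.
case/fixs=> u [v [/qi_denom[n n0 zn] /qi_denom[m m0 zm] ->]].
exists (n * m)%N; first by rewrite muln_eq0 negb_or n0.
apply/lamP; exists (m%:R * (n%:R * u)), (n%:R * (m%:R * v)).
by split; [rewrite rpredM ?rpred_nat|rewrite rpredM ?rpred_nat|rewrite natrM; ring].
Qed.

(** The Lagrange resolvents T0, T1, T2 of e are eigenvectors of s, with the same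
    eigenvalues as 1, R, R^2; so e has coordinates in L on these powers. *)
Lemma not_norm e : e * s e * s (s e) <> g.
Proof.
move=> eg; have R0 : R != 0.
  have : R ^+ 3 != 0.
    rewrite R3 /alp; apply/eqP => /g_free[].
    - by rewrite zi_qi // rpredD ?rpredM ?rpred_nat ?i_zi.
    - by rewrite zi_qi // rpredB ?rpredM ?rpred_nat ?i_zi.
    move=> h _; have : cplx E 31%:R 38%:R = 0 by rewrite /cplx !rmorph_nat.
    by case/cplx_eq0 => /eqP; rewrite pnatr_eq0.
  by rewrite expf_eq0.
have t3 := three_neq0 E.
have g0 : g != 0.
  by apply/eqP => h; move: g2; rewrite h mul0r sub0r => /esym/eqP; rewrite oppr_eq0 oner_eq0.
pose T0 := e + s e + s (s e).
pose T1 := e + (g - 1) * s e - g * s (s e).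
pose T2 := e - g * s e + (g - 1) * s (s e).
have sT0 : s T0 = T0 by rewrite /T0 !rmorphD s3; ring.
have sT1 : s T1 = - g * T1.
  by rewrite /T1 !(rmorphB, rmorphD, rmorphM, rmorph1) /= s3 sg; ring: g2.
have sT2 : s T2 = (g - 1) * T2.
  by rewrite /T2 !(rmorphB, rmorphD, rmorphM, rmorph1) /= s3 sg; ring: g2.
have g1 : g - 1 != 0 by rewrite -g2 mulf_neq0.
have f0 : s (T0 / 3%:R) = T0 / 3%:R by rewrite fmorph_div rmorph_nat sT0.
have f1 : s (T1 / R / 3%:R) = T1 / R / 3%:R.
  by rewrite !fmorph_div rmorph_nat sT1 sR; field; rewrite t3 R0 ?oppr_eq0 ?g0.
have f2 : s (T2 / R ^+ 2 / 3%:R) = T2 / R ^+ 2 / 3%:R.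
  rewrite !fmorph_div rmorphXn rmorph_nat sT2 sR.
  have -> : (- g * R) ^+ 2 = (g - 1) * R ^+ 2 by ring: g2.
  by field; rewrite t3 R0 g1.
set y0 := T0 / 3%:R in f0; set y1 := T1 / R / 3%:R in f1; set y2 := T2 / R ^+ 2 / 3%:R in f2.
have ee : e = y0 + y1 * R + y2 * R ^+ 2.
  by rewrite /y0 /y1 /y2 /T0 /T1 /T2; field; rewrite t3 R0.
clearbody y0 y1 y2.
have nrm : y0 ^+ 3 + alp * y1 ^+ 3 + alp ^+ 2 * y2 ^+ 3 - 3%:R * alp * (y0 * y1 * y2) = g.
  rewrite -eg ee !(rmorphD, rmorphM, rmorphXn) /= f0 f1 f2 !sR rmorphM rmorphN /= !sg !sR f0 f1 f2 -R3.
  by ring: g2.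
have [n0 nn0 l0] := lam_denom f0; have [n1 nn1 l1] := lam_denom f1; have [n2 nn2 l2] := lam_denom f2.
pose D : nat := (n0 * n1 * n2)%N.
have D0 : (D%:R : E) != 0.
  have Dp : (0 < D)%N by rewrite !muln_gt0 !lt0n nn0 nn1.
  by rewrite -(prednK Dp) natrE_neq0.
have k0 : D%:R * y0 \in lam.
  have -> : D%:R * y0 = n1%:R * n2%:R * (n0%:R * y0) by rewrite /D !natrM; ring.
  by lam_closed.
have k1 : D%:R * y1 \in lam.
  have -> : D%:R * y1 = n0%:R * n2%:R * (n1%:R * y1) by rewrite /D !natrM; ring.
  by lam_closed.
have k2 : D%:R * y2 \in lam.
  have -> : D%:R * y2 = n0%:R * n1%:R * (n2%:R * y2) by rewrite /D !natrM; ring.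
  by lam_closed.
have zD : D%:R \in (zi : {pred E}) by exact: rpred_nat.
have [|d0 _] := @descent _ D%:R 0 _ _ _ zD (rpred0 _) k0 k1 k2 (ltnSn _).
  rewrite mul0r addr0 -[in RHS]nrm; ring.
by rewrite d0 eqxx in D0.
Qed.
End NonNorm.

(** * The cyclic cubic polynomial *)

Section Cubic.
Variable E : gaussian_field.
Local Notation I := (gf_i E).

Definition is_root (b : E) : Prop := b * b * b = (1 + I) * (b * b) - 5%:R * I * b + (1 + 4%:R * I).
(** The discriminant of the cubic is the square of 2 - 3 i, so a second root is
    a polynomial in the first one. *)
Definition next_root (b : E) : E := (3%:R - 2%:R * I) * b ^+ 2 - (3%:R + 5%:R * I) * b + (5%:R + 11%:R * I).

Lemma next_root2 b : is_root b ->
  next_root (next_root b) = (- 3%:R + 2%:R * I) * b ^+ 2 + (2%:R + 5%:R * I) * b - (4%:R + 10%:R * I).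
Proof. by move=> hb; rewrite /next_root; ring: (gf_i2E E) hb. Qed.

Lemma next_root3 b : is_root b -> next_root (next_root (next_root b)) = b.
Proof. by move=> hb; rewrite next_root2 // /next_root; ring: (gf_i2E E) hb. Qed.

Lemma next_root_root b : is_root b -> is_root (next_root b).
Proof. by move=> hb; rewrite /is_root /next_root; ring: (gf_i2E E) hb. Qed.

Lemma root_factor b x : is_root b ->
  x * x * x - ((1 + I) * (x * x) - 5%:R * I * x + (1 + 4%:R * I)) = (x - b) * (x - next_root b) * (x - next_root (next_root b)).
Proof. by move=> hb; rewrite next_root2 // /next_root; ring: (gf_i2E E) hb. Qed.

Lemma root_cases b x : is_root b -> is_root x -> [\/ x = b, x = next_root b | x = next_root (next_root b)].
Proof.
move=> hb hx; have /eqP := root_factor x hb; rewrite -hx subrr eq_sym !mulf_eq0 -orbA !subr_eq0.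
by case/or3P => /eqP->; [constructor 1|constructor 2|constructor 3].
Qed.

Lemma root_vand b : is_root b ->
  (b - next_root b) * (next_root b - next_root (next_root b)) * (next_root (next_root b) - b) = - (2%:R - 3%:R * I) \/
  (b - next_root b) * (next_root b - next_root (next_root b)) * (next_root (next_root b) - b) = (2%:R - 3%:R * I).
Proof. by move=> hb; rewrite next_root2 // /next_root; first [left; ring: (gf_i2E E) hb|right; ring: (gf_i2E E) hb]. Qed.

Lemma next_root_neq b : is_root b -> next_root b <> b.
Proof.
move=> hb e; have c0 : cplx E 2%:R (- 3%:R) = 0 -> False.
  by case/cplx_eq0 => /eqP; rewrite pnatr_eq0.
have ec : 2%:R - 3%:R * I = cplx E 2%:R (- 3%:R) by rewrite /cplx rmorphN !rmorph_nat mulNr.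
case: (root_vand hb); rewrite e subrr !mul0r ec => /esym/eqP; last by move/eqP/c0.
by rewrite oppr_eq0 => /eqP/c0.
Qed.

Lemma root_resolvent b g : is_root b -> g * g = g - 1 ->
  (b + (g - 1) * next_root b - g * next_root (next_root b)) ^+ 3 = alp g.
Proof. by move=> hb hg; rewrite next_root2 // /next_root /alp; ring: (gf_i2E E) hb hg. Qed.

Lemma root_oE b : is_root b -> b \in oE.
Proof.
move=> hb; have oI := i_oE E.
have [o2 o1 o0] : [/\ 1 + I \in oE, 5%:R * I \in oE & 1 + 4%:R * I \in oE].
  by split; rewrite ?rpredD ?rpredM ?rpred_nat ?rpred1.
apply/oEP; pose q : {poly E} := 'X^3 - ((1 + I) *: 'X^2 - (5%:R * I) *: 'X + (1 + 4%:R * I)%:P).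
have sz : (size ((1 + I) *: 'X^2 - (5%:R * I) *: 'X + (1 + 4%:R * I)%:P : {poly E})%R <= 3)%N.
  apply: leq_trans (size_polyD _ _) _; rewrite geq_max (leq_trans (size_polyC_leq1 _)) // andbT.
  apply: leq_trans (size_polyD _ _) _; rewrite geq_max size_polyN.
  by rewrite !(leq_trans (size_scale_leq _ _)) ?size_polyXn ?size_polyX.
apply: (@integral_root_monic _ _ intr b q).
- by rewrite monicE lead_coefDl ?lead_coefXn // size_polyXn size_polyN.
- rewrite /root /q !(hornerD, hornerN, hornerZ, hornerXn, hornerX, hornerC); apply/eqP; ring: hb.
apply/integral_poly => i; apply/oEP; rewrite /q !(coefB, coefD, coefZ, coefXn, coefX, coefC).
by rewrite rpredB ?rpred_nat // rpredD ?rpredB ?rpredM ?rpred_nat //; case: ifP => _; rewrite ?rpred0.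
Qed.

(** Such a b would lie in Z[i]; modulo 1 + i the equation reads
    b^3 + b + 1 = 0, which has no solution in a field of two elements. *)
Lemma root_notin_qi b : is_root b -> b \notin qi.
Proof.
move=> hb; apply/negP => qb; have /ziP[x [y eb]] := qi_oE_zi qb (root_oE hb).
have : cplx E (x ^+ 3 - 3 * x * y ^+ 2 - (x ^+ 2 - y ^+ 2 - 2 * x * y) - 5 * y - 1)%:~R
   (3 * x ^+ 2 * y - y ^+ 3 - (x ^+ 2 - y ^+ 2 + 2 * x * y) + 5 * x - 4)%:~R = 0.
  transitivity (b * b * b - ((1 + I) * (b * b) - 5%:R * I * b + (1 + 4%:R * I))); last by rewrite hb subrr.
  by rewrite eb /cplx !rmorph_int !(rmorphB, rmorphD, rmorphM, rmorphXn) /=; ring: (gf_i2E E).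
case/cplx_eq0 => /eqP + /eqP; rewrite !intr_eq0 => /eqP e1 /eqP e2.
have [p [r [Ep hr]]] : exists p r, x = 2 * p + r /\ (r = 0 \/ r = 1).
  by exists (x %/ 2)%Z, (x %% 2)%Z; lia.
have [q [t [Eq ht]]] : exists q t, y = 2 * q + t /\ (t = 0 \/ t = 1).
  by exists (y %/ 2)%Z, (y %% 2)%Z; lia.
move: e1 e2; rewrite Ep Eq !exprS !expr0; move: hr ht; clear.
by case=> -> [] ->; lia.
Qed.
End Cubic.
(** * Discriminant and norms in the example *)

Section Example.
Variables (E : gaussian_field) (s t : {rmorphism E -> E}).
Local Notation I := (gf_i E).
Hypothesis s3 : forall x, s (s (s x)) = x.
Hypothesis t2 : forall x, t (t x) = x.
Hypothesis st : forall x, s (t x) = t (s x).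
Hypothesis fixst : forall x, s x = x -> t x = x -> x \in qi.
Hypothesis sI : s I = I.
Hypothesis tI : t I = I.
Variables (b g : E).
Hypothesis hb : is_root b.
Hypothesis g2 : g * g = g - 1.
Hypothesis sg : s g = g.
Hypothesis tg : t g <> g.
Hypothesis tb : t b = b.
Hypothesis sb : s b <> b.

Lemma conj_g : t g = 1 - g.
Proof.
have /eqP : (t g - g) * (t g - (1 - g)) = 0.
  have h : t g * t g = t g - 1 by rewrite -rmorphM g2 rmorphB rmorph1.
  by ring: h g2.
by rewrite mulf_eq0 !subr_eq0 => /orP[/eqP|/eqP].
Qed.

Lemma rmorph_next_root (f : {rmorphism E -> E}) x : f I = I -> f (next_root x) = next_root (f x).
Proof. by move=> fI; rewrite /next_root !(rmorph_nat, rmorphB, rmorphD, rmorphM, rmorphXn) /= ?rmorph_nat fI. Qed.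

Lemma rmorph_is_root (f : {rmorphism E -> E}) x : f I = I -> is_root x -> is_root (f x).
Proof.
move=> fI hx; rewrite /is_root -!rmorphM hx.
by rewrite !(rmorph_nat, rmorph1, rmorphB, rmorphD, rmorphM) /= fI.
Qed.

Lemma s_next_root : s b = next_root b \/ s b = next_root (next_root b).
Proof. by case: (root_cases hb (rmorph_is_root sI hb)) => [/sb//||]; [left|right]. Qed.

Lemma vand_example : vand s b = - (2%:R - 3%:R * I) \/ vand s b = 2%:R - 3%:R * I.
Proof.
rewrite /vand; case: s_next_root => e.
  by rewrite e rmorph_next_root // e; exact: root_vand.
have -> : s (s b) = next_root b by rewrite e !rmorph_next_root // e next_root3 //; exact: next_root_root.
by rewrite e; case: (root_vand hb) => h; [right|left]; rewrite -[RHS]opprK -h; ring.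
Qed.

Lemma g_notin_qi : g \notin qi.
Proof. by apply/negP => qg; apply: tg; rewrite (t_qi tI). Qed.

(** Either s or s o s maps b to next_root b, and e s(e) s(s(e)) is the same for
    both. *)
Lemma s_not_norm e : e * s e * s (s e) <> g.
Proof.
have fixs x : s x = x -> exists u v, [/\ u \in qi, v \in qi & x = u + v * g].
  move=> sx; have tgE := conj_g; have d0 : 2%:R * g - 1 != 0.
    by apply: contra_notN tg; rewrite subr_eq0 => /eqP e0; rewrite tgE -e0; ring.
  have t_neq0 : 2%:R != 0 :> E by exact: natrE_neq0.
  pose v := (x - t x) / (2%:R * g - 1).
  have qv : v \in qi.
    apply: fixst; first by rewrite /v fmorph_div !rmorphB rmorphM rmorph_nat rmorph1 st sx sg.
    rewrite /v fmorph_div !rmorphB rmorphM rmorph_nat rmorph1 t2 tgE.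
    have -> : 2%:R * (1 - g) - 1 = - (2%:R * g - 1) by ring.
    by rewrite invrN mulrN -mulNr opprB.
  exists (x - v * g), v; split=> //; last by ring.
  apply: fixst; first by rewrite rmorphB (rmorphM s v g) sx sg (s_qi sI qv).
  rewrite rmorphB (rmorphM t v g) tgE (t_qi tI qv).
  have e0 : x - t x = v * (2%:R * g - 1) by rewrite /v divfK.
  have -> : t x = x - v * (2%:R * g - 1) by rewrite -e0; ring.
  by ring.
have sb' := rmorph_next_root _ sI.
have resM (f : {rmorphism E -> E}) x y z : f g = g ->
    f (x + (g - 1) * y - g * z) = f x + (g - 1) * f y - g * f z.
  by move=> fg; rewrite !(rmorphB, rmorphD, rmorphM, rmorph1) /= !fg.
case: s_next_root => eb.
  apply: (@not_norm E g g2 g_notin_qi s s3 sg fixs (b + (g - 1) * next_root b - g * next_root (next_root b))).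
    exact: root_resolvent.
  by rewrite resM // !sb' eb next_root3 //; ring: g2.
pose s' : {rmorphism E -> E} := s \o s.
have eb' : s (s b) = next_root b by rewrite eb !sb' eb next_root3 //; exact: next_root_root.
have h : e * s' e * s' (s' e) = e * s e * s (s e) by rewrite /= s3; ring.
rewrite -h; apply: (@not_norm E g g2 g_notin_qi s' _ _ _ (b + (g - 1) * next_root b - g * next_root (next_root b))).
- by move=> x; rewrite /= !s3.
- by rewrite /= !sg.
- move=> x /= sx; apply: fixs; by rewrite -[in LHS]sx s3.
- exact: root_resolvent.
by rewrite resM /= ?sg // !sb' eb' next_root3 //; ring: g2.
Qed.

Lemma g_oE : g \in oE.
Proof.
apply/oEP; exists ('X^2 - ('X - 1)).
  by rewrite monicE lead_coefDl ?lead_coefXn // size_polyXn size_polyN size_XsubC.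
rewrite rmorphB rmorphB /= map_polyXn map_polyX rmorph1 /root !hornerE.
by rewrite expr2 g2 subrr.
Qed.

Lemma inv_g : g^-1 = 1 - g.
Proof.
have h : g * (1 - g) = 1 by ring: g2.
have g0 : g != 0 by apply: contra_eq_neq h => ->; rewrite mul0r eq_sym oner_eq0.
by apply: (mulfI g0); rewrite divff // h.
Qed.

Lemma Nr_g : Nr s t g = 1.
Proof. by rewrite /Nr /nL !sg !rmorphM conj_g; ring: g2. Qed.

Lemma nm_disc_kron : nm (disc s t (kron g b)) = (3 ^ 6 * 13 ^ 4)%N.
Proof.
rewrite disc_kron //.
have -> : dl t g = - 3%:R by rewrite /dl conj_g; ring: g2.
have zc : 2%:R - 3%:R * I \in (zi : {pred E}) by rewrite rpredB ?rpredM ?rpred_nat ?i_zi.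
have -> : vand s b ^+ 4 = (2%:R - 3%:R * I) ^+ 4.
  by case: vand_example => ->; ring.
have zn n : n%:R \in (zi : {pred E}) by exact: rpred_nat.
have n13 : nm (2%:R - 3%:R * I : E) = 13%N.
  have -> : 2%:R - 3%:R * I = cplx E (2)%:~R (- 3)%:~R by rewrite /cplx !rmorph_int mulNr.
  by rewrite nm_cplx.
have z3 : - 3%:R \in (zi : {pred E}) by rewrite rpredN.
have -> : (3 ^ 6 = (3 ^ 2) ^ 3)%N by rewrite -expnM.
rewrite nmM; [|exact: rpredX|exact: rpredX].
by rewrite (nmX 3 z3) (nmX 4 zc) nmN // nm_nat n13.
Qed.

(** The integral family kron g b has a discriminant of norm 3^6 13^4, which is
    a multiple of that of a basis; the lower bound gives the converse. *)
Lemma nm_disc_example x : oE_basis s t x -> nm (disc s t x) = (3 ^ 6 * 13 ^ 4)%N.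
Proof.
move=> bx; have [ox dW sp] := bx.
have ok : forall j, kron g b j \in oE.
  have ob := root_oE hb; have og := g_oE.
  by move=> j; rewrite /kron; case: fintype.split => k; rewrite ?rpredM ?rpredX.
have [C hC] : exists C : 'M[E]_6, (forall j k, C j k \in zi) /\
    forall j, kron g b j = \sum_k C j k * x k.
  have /choice[c hc] : forall j, exists c : 'I_6 -> E, (forall k, c k \in zi) /\
      kron g b j = \sum_k c k * x k.
    by move=> j; have [c zc e] := sp _ (ok j); exists c.
  exists (\matrix_(j, k) c j k); split=> [j k|j]; first by rewrite mxE; have [] := hc j.
  by have [_ ->] := hc j; apply: eq_bigr => k _; rewrite mxE.
case: hC => zC eC.
have eW : (W s t (kron g b) : 'M_6) = C *m (W s t x : 'M_6).
  apply/matrixP => j a; rewrite !mxE eC (cj_sum sI tI); apply: eq_bigr => k _.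
  by rewrite !mxE cjM (cj_qi sI tI) ?zi_qi.
have zdC : \det C \in zi by exact: rpred_det.
have eD : disc s t (kron g b) = \det C ^+ 2 * disc s t x by rewrite /disc eW det_mulmx exprMn.
have zD := disc_zi s3 t2 st fixst ox.
have nD := nm_disc_kron; rewrite eD (nmM (rpredX 2 zdC) zD) (nmX 2 zdC) in nD.
apply/eqP; rewrite eqn_leq; apply/andP; split; last first.
  by apply: (lower_bound s3 t2 st fixst sI tI _ _ bx); [exists b|exists g].
rewrite -nD leq_pmull // expn_gt0; apply/orP; left; rewrite lt0n; apply/eqP => d0.
by move: nD; rewrite d0 => /esym/eqP; rewrite muln_eq0 !expn_eq0.
Qed.
End Example.

(** * Galois theory of the example *)

Lemma size_cubic (F : fieldType) (i : F) : size (cubic_f i) = 4%N.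
Proof.
rewrite /cubic_f -!addrA size_polyDl size_polyXn // ltnS.
apply: leq_trans (size_polyD _ _) _; rewrite geq_max size_polyN (leq_trans (size_scale_leq _ _)) ?size_polyXn //=.
apply: leq_trans (size_polyD _ _) _; rewrite geq_max size_polyN (leq_trans (size_scale_leq _ _)) ?size_polyX //=.
exact: leq_trans (size_polyC_leq1 _) _.
Qed.

Lemma cubic_f_root (F : fieldType) (E : fieldExtType F) (i : F) (x : E) :
  root (map_poly (in_alg E) (cubic_f i)) x ->
  x * x * x = (1 + i%:A) * (x * x) - 5%:R * i%:A * x + (1 + 4%:R * i%:A).
Proof.
pose r : {rmorphism F -> E} := in_alg E; rewrite -[in_alg E]/(GRing.RMorphism.sort r).
have -> : map_poly r (cubic_f i) =
    'X^3 - (1 + r i) *: 'X^2 + (5%:R * r i) *: 'X - (1 + 4%:R * r i)%:P.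
  have [-> -> ->] : [/\ 1 + r i = r (1 + i), 5%:R * r i = r (5%:R * i) & 1 + 4%:R * r i = r (1 + 4%:R * i)].
    by rewrite !(rmorphD r 1) !(rmorphM r _%:R) !rmorph_nat rmorph1.
  by rewrite /cubic_f rmorphB rmorphD rmorphB /= map_polyXn !map_polyZ /= map_polyXn map_polyX map_polyC.
rewrite /root -[i%:A]/(r i) !(hornerD, hornerN, hornerZ, hornerXn, hornerX, hornerC).
move=> /eqP h; apply/eqP; rewrite -subr_eq0; apply/eqP; rewrite -{}h; ring.
Qed.

Section ConcreteExt.
Variables (F : fieldExtType rat) (i : F).
Hypothesis i_sq : i ^+ 2 = -1.
Hypothesis F_gen : <<1; i>>%VS = {:F}%VS.
Variables (E : fieldExtType F) (b : E).
Hypothesis root_b : root (map_poly (in_alg E) (cubic_f i)) b.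
Local Notation GE := (gext i_sq E).
Local Notation I := (gf_i GE).

Lemma hb : @is_root GE b.
Proof. exact: cubic_f_root. Qed.

Lemma root3_notin (r : GE) : r ^+ 2 = 3%:R -> r \notin qi.
Proof.
move=> r2; apply/negP => qr; apply: (@three_nonsq GE (I * r)).
  by rewrite rpredM // zi_qi ?i_zi.
by rewrite exprMn gf_i2 r2 mulN1r.
Qed.

Lemma b_notin1 x : root (map_poly (in_alg E) (cubic_f i)) x -> x \notin 1%VS.
Proof.
move=> /cubic_f_root hx; apply/negP => x1; have /negP := @root_notin_qi GE x hx; apply.
exact: (mem1_qi i_sq F_gen).
Qed.

Let q : {poly E} := map_poly (in_alg E) (cubic_f i).
Lemma size_q : size q = 4%N. Proof. by rewrite size_map_poly size_cubic. Qed.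

Lemma q_over (K : {subfield E}) : q \is a polyOver K.
Proof.
apply/polyOverP => k; rewrite coef_map /=; have /subvP := sub1v K; apply; exact: rpredZ (mem1v _).
Qed.

Lemma degb_le (K : {subfield E}) : (adjoin_degree K b <= 3)%N.
Proof.
rewrite -ltnS -size_minPoly -size_q; apply: dvdp_leq (minPoly_dvdp (q_over K) root_b).
by rewrite -size_poly_eq0 size_q.
Qed.

Lemma degb : \dim <<1; b>> = 3%N.
Proof.
have := degb_le 1; have : adjoin_degree 1 b != 1%N by rewrite adjoin_deg_eq1; exact: b_notin1.
have : (0 < \dim <<1; b>>)%N by exact: adim_gt0.
rewrite dim_Fadjoin dimv1 muln1; case e: (adjoin_degree 1 b) => [|[|[|[]]]] // _ _ _; exfalso.
(* a quadratic factor leaves a linear one, hence a root in the base field *)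
have dv := minPoly_dvdp (q_over 1) root_b; have q0 : q != 0 by rewrite -size_poly_eq0 size_q.
have m0 : minPoly 1 b != 0 by rewrite -size_poly_eq0 size_minPoly.
pose d := q %/ minPoly 1 b; have sd : size d = 2%N.
  by rewrite size_divp // size_q size_minPoly e.
have dO : d \is a polyOver 1%VS by rewrite divp_polyOver ?q_over ?minPolyOver.
have d1 : d`_1 != 0 by have := lead_coef_eq0 d; rewrite lead_coefE sd -size_poly_eq0 sd => ->.
pose x := - d`_0 / d`_1; have rx : root d x.
  have -> : d = (d`_0)%:P + (d`_1) *: 'X.
    apply/polyP => k; rewrite coefD coefC coefZ coefX; case: k => [|[|k]]; rewrite /= ?mulr0 ?mulr1 ?addr0 ?add0r //.
    by rewrite nth_default // sd.
  by rewrite /root hornerD hornerZ hornerC hornerX /x [_ * (_ / _)]mulrC divfK // subrr.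
have rqx : root q x by rewrite -(divpK dv) rootM rx.
by have := b_notin1 rqx; rewrite rpred_div ?rpredN ?(polyOverP dO).
Qed.

End ConcreteExt.

Section Concrete.
Variables (F : fieldExtType rat) (i : F).
Hypothesis i_sq : i ^+ 2 = -1.
Hypothesis F_gen : <<1; i>>%VS = {:F}%VS.
Variables (E : splittingFieldType F) (z b : E).
Hypothesis hz : 12.-primitive_root z.
Hypothesis root_b : root (map_poly (in_alg E) (cubic_f i)) b.
Hypothesis gen : <<<<1; z>>; b>>%VS = {:E}%VS.
Local Notation GE := (gext i_sq E).
Local Notation I := (gf_i GE).

Lemma z4 : z ^+ 4 = z ^+ 2 - 1.
Proof.
have z12 := prim_expr_order hz.
have n6 : z ^+ 6 - 1 != 0 by rewrite subr_eq0 -(prim_order_dvd hz).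
have n4 : z ^+ 4 - 1 != 0 by rewrite subr_eq0 -(prim_order_dvd hz).
have n2 : z ^+ 2 + 1 != 0.
  apply: contraNneq n4 => h; have -> : z ^+ 4 - 1 = (z ^+ 2 + 1) * (z ^+ 2 - 1) by ring.
  by rewrite h mul0r.
have /eqP : (z ^+ 6 - 1) * (z ^+ 2 + 1) * (z ^+ 4 - (z ^+ 2 - 1)) = 0.
  by transitivity (z ^+ 12 - 1); [ring|rewrite z12 subrr].
by rewrite !mulf_eq0 (negPf n6) (negPf n2) /= subr_eq0 => /eqP.
Qed.

Lemma z_cube : z ^+ 3 = i%:A \/ z ^+ 3 = - i%:A.
Proof.
have h4 : z * z * z * z = z * z - 1 by have := z4; rewrite !exprS expr0 mulr1 !mulrA.
have /eqP : (z ^+ 3) ^+ 2 = i%:A ^+ 2 by rewrite (alg_i_sq i_sq); ring: h4.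
by rewrite eqf_sqr => /orP[] /eqP ->; [left|right].
Qed.

(** z + 1 / z, which is a square root of 3. *)
Definition r0 : E := 2%:R * z - z ^+ 3.
Lemma r0_sq : r0 ^+ 2 = 3%:R.
Proof.
have h4 : z * z * z * z = z * z - 1 by have := z4; rewrite !exprS expr0 mulr1 !mulrA.
by rewrite /r0; ring: h4.
Qed.

Lemma root3_cases (r : E) : r ^+ 2 = 3%:R -> r = r0 \/ r = - r0.
Proof. by move=> e; have /eqP := e; rewrite -r0_sq eqf_sqr => /orP[] /eqP ->; [left|right]. Qed.

Lemma r0_L : r0 \in <<1; z>>%VS.
Proof. by rewrite rpredB ?rpredM ?rpredX ?rpred_nat ?memv_adjoin. Qed.

Lemma degz : \dim <<1; z>> = 2%N.
Proof.
have z1 : z \notin 1%VS.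
  apply/negP => z1; have /negP := @root3_notin F i i_sq E r0 r0_sq; apply.
  by apply: (mem1_qi i_sq F_gen); rewrite rpredB ?rpredM ?rpredX ?rpred_nat.
have : (adjoin_degree 1 z <= 2)%N.
  have h4 : z * z * z * z = z * z - 1 by have := z4; rewrite !exprS expr0 mulr1 !mulrA.
  have [e e1 ze] : exists2 e, e \in 1%VS & z ^+ 3 = e.
    by case: z_cube => ->; [exists i%:A|exists (- i%:A)]; rewrite ?rpredN ?rpredZ ?mem1v.
  pose q : {poly E} := 'X^2 - (e *: 'X + 1).
  have sq : (size (e *: 'X + 1)%R < size ('X^2 : {poly E}))%N.
    rewrite size_polyXn ltnS; apply: leq_trans (size_polyD _ _) _.
    by rewrite geq_max size_poly1 (leq_trans (size_scale_leq _ _)) ?size_polyX.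
  have q0 : q != 0 by rewrite -size_poly_eq0 size_polyDl ?size_polyN // size_polyXn.
  rewrite -ltnS -size_minPoly; apply: leq_trans (dvdp_leq q0 (minPoly_dvdp _ _)) _.
  - by rewrite rpredB ?rpredX ?polyOverX // rpredD ?rpred1 // polyOverZ ?polyOverX.
  - by rewrite /root !hornerE -ze; apply/eqP; ring: h4.
  by rewrite size_polyDl ?size_polyN // size_polyXn.
have : adjoin_degree 1 z != 1%N by rewrite adjoin_deg_eq1.
have : (0 < \dim <<1; z>>)%N by exact: adim_gt0.
rewrite dim_Fadjoin dimv1 muln1; case: (adjoin_degree 1 z) => [|[|[]]] //.
Qed.

Let hb : @is_root GE b := hb i_sq root_b.
Let degb : \dim <<1; b>> = 3%N := degb i_sq F_gen root_b.
Let L : {subfield E} := <<1; z>>%AS.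

Lemma dimE6 : \dim {:E} = 6%N.
Proof.
have d2 : (2 %| \dim {:E})%N by rewrite -degz field_dimS ?subvf.
have d3 : (3 %| \dim {:E})%N by rewrite -degb field_dimS ?subvf.
have := adim_gt0 {:E}%AS; have := degb_le root_b L.
have : \dim {:E} = (adjoin_degree L b * 2)%N by rewrite -degz -dim_Fadjoin gen.
move: (\dim _) (adjoin_degree _ _) d2 d3 => m n; clear; lia.
Qed.

Lemma dimLE : \dim_L {:E} = 3%N.
Proof. by rewrite dimE6 degz. Qed.

Lemma galoisE : galois 1 {:E}.
Proof.
rewrite /galois sub1v normalFieldf andbT /=; apply/separableP => y _.
apply: contraT => /separablePn_pchar[p cp _]; have := cp; rewrite inE => /andP[_ /eqP p0].
have := natrE_neq0 GE p.-1; rewrite prednK ?p0 ?eqxx //; exact: prime_gt0 (pcharf_prime cp).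
Qed.

Lemma gal_ext (x : gal_of {:E}) : x z = z -> x b = b -> x = 1%g.
Proof.
move=> xz xb; apply/eqP/gal_eqP => a _; rewrite gal_id.
have : a \in fixedField [set x].
  have /subvP : (<<<<1; z>>; b>> <= fixedField [set x])%VS; last by apply; rewrite gen memvf.
  have fx c : x c = c -> c \in fixedField [set x].
    by move=> xc; apply/fixedFieldP; rewrite ?memvf // => y /set1P->.
  apply/FadjoinP; split; last exact: fx.
  by apply/FadjoinP; split; [exact: sub1v|exact: fx].
by move/(fixedFieldP (memvf a)); apply; exact: set11.
Qed.

Lemma gal_i (x : gal_of {:E}) : x i%:A = i%:A.
Proof. by rewrite linearZ /= rmorph1. Qed.

Lemma gal_z3 (x : gal_of {:E}) : x (z ^+ 3) = z ^+ 3.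
Proof.
by case: z_cube => ->; [exact: gal_i|rewrite rmorphN; congr (- _); exact: gal_i].
Qed.

Lemma gal_b (x : gal_of {:E}) : [\/ x b = b, x b = @next_root GE b | x b = @next_root GE (@next_root GE b)].
Proof. by apply: (@root_cases GE b (x b) hb); apply: (@rmorph_is_root GE (grm i_sq x) b (grm_i i_sq x) hb). Qed.

Lemma gal_next_root (x : gal_of {:E}) c : x (@next_root GE c) = @next_root GE (x c).
Proof. exact: (@rmorph_next_root GE (grm i_sq x) c (grm_i i_sq x)). Qed.

Lemma gal_z (x : gal_of {:E}) : x z = z \/ x z = z ^+ 3 - z.
Proof.
have x3 : x z ^+ 3 = z ^+ 3.
  by rewrite -rmorphXn; exact: gal_z3.
have : (x r0) ^+ 2 = 3%:R by rewrite -rmorphXn r0_sq rmorph_nat.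
have n2 : 2%:R != 0 :> E by exact: (natrE_neq0 GE 1).
case/root3_cases; rewrite /r0 rmorphB rmorphM rmorph_nat rmorphXn x3 => h; [left|right].
  by apply: (mulfI n2); rewrite -[LHS](subrK (z ^+ 3)) h subrK.
by apply: (mulfI n2); rewrite -[LHS](subrK (z ^+ 3)) h; ring.
Qed.

(** An automorphism is determined by its values on z and b. It sends z to z or
    z^3 - z, and b to one of its iterates under next_root; these moves commute. *)
Lemma gal_comm (x y : gal_of {:E}) : (x * y = y * x)%g.
Proof.
have comm c : c = z \/ c = b -> x (y c) = y (x c).
  case=> ->.
    by case: (gal_z x) (gal_z y) => ex [] ey; rewrite ?(ex, ey) ?(rmorphB x, rmorphB y) /= ?gal_z3 ?(ex, ey).
  by case: (gal_b x) (gal_b y) => ex [] ey; rewrite ?(ex, ey) ?gal_next_root ?(ex, ey) ?gal_next_root ?(ex, ey).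
have fix1 c : c = z \/ c = b -> ((x * y) * (y * x)^-1)%g c = c.
  move=> /comm h; rewrite galM ?memvf // -[in RHS](gal_id {:E}%AS c) -(mulgV (y * x)%g) galM ?memvf //.
  by rewrite !galM ?memvf // h.
apply/(mulIg (y * x)^-1)%g; rewrite mulgV; apply: gal_ext; apply: fix1; [by left|by right].
Qed.

(** An abelian group of order 6 has commuting elements of orders 2 and 3. *)
Lemma cyclicE : cyclic 'Gal({:E} / 1).
Proof.
have oG : #|'Gal({:E} / 1)|%g = 6%N by rewrite -galois_dim ?galoisE // dimv1 divn1 dimE6.
have [x xG ox] : {x | x \in 'Gal({:E} / 1)%g & #[x]%g = 2%N} by apply: Cauchy; rewrite ?oG.
have [y yG oy] : {x | x \in 'Gal({:E} / 1)%g & #[x]%g = 3%N} by apply: Cauchy; rewrite ?oG.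
apply/cyclicP; exists (x * y)%g; apply/eqP; rewrite eq_sym eqEcard cycle_subG groupM //=.
by rewrite -orderE orderM ?ox ?oy ?oG //; exact: gal_comm.
Qed.
Section Sigma.
Variables (s : gal_of {:E}) (r : E).
Hypothesis genL : 'Gal({:E} / L)%g = <[s]>%g.
Hypothesis r2 : r ^+ 2 = 3%:R.
Let g : E := (1 + i%:A * r) / 2%:R.

Lemma r_L : r \in L.
Proof. by case: (root3_cases r2) => ->; rewrite ?rpredN r0_L. Qed.

Lemma i_L : (i%:A : E) \in L.
Proof. by rewrite rpredZ ?mem1v. Qed.

Lemma gen_L : g \in L.
Proof. by rewrite rpred_div ?rpred_nat // rpredD ?rpred1 // rpredM ?i_L ?r_L. Qed.

Lemma gen_sq : g * g = g - 1.
Proof.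
have t0 : 2%:R != 0 :> E by exact: (natrE_neq0 GE 1).
have ii : i%:A * i%:A = -1 :> E by rewrite -expr2; exact: (alg_i_sq i_sq).
have rr : r * r = 3%:R by rewrite -expr2.
apply: (mulfI (mulf_neq0 t0 t0)); rewrite /g.
transitivity ((1 + i%:A * r) ^+ 2); first by field.
by rewrite mulrBr; transitivity (2%:R * (1 + i%:A * r) - 2%:R * 2%:R); [ring: ii rr|field].
Qed.

Lemma example_conclusion : [/\ g \in L, alg_integer g, alg_integer g^-1,
  cyc_division s g 3 & disc_norm i L s g 3 = (3 ^ 18 * 13 ^ 12)%N].
Proof.
have g2 := gen_sq; have gL := gen_L; have gE := galoisE.
have [t tp tr] := sextic_pairP i_sq F_gen gE cyclicE dimE6 dimLE genL.
have s3 := sK3 gE dimLE genL.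
have [t2 st fixst [x sx] _] := tp.
have sgE : s g = g by apply/eqP; rewrite -(fixL gE genL).
have sz : s z = z by apply/eqP; rewrite -(fixL gE genL) memv_adjoin.
have sb : s b <> b.
  by move=> e; apply: sx; rewrite (gal_ext sz e) gal_id.
have sI := grm_i i_sq s; have tI := grm_i i_sq t.
have tg : t g <> g.
  move=> e; have qg : (g : GE) \in qi by exact: fixst.
  have t0 : 2%:R != 0 :> E by exact: (natrE_neq0 GE 1).
  apply: (@three_nonsq GE (2%:R * g - 1)).
    by rewrite rpredB ?rpred1 // rpredM ?rpred_nat.
  have h : (g : GE) * g = g - 1 by []. ring: h.
have tb : t b = b.
  have nr := @next_root_neq GE b hb.
  case: (gal_b t) => // e; exfalso; apply: nr; have := t2 b; rewrite e !gal_next_root e.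
    by move=> e2; rewrite -[RHS](@next_root3 GE b hb) e2.
  by rewrite (@next_root3 GE (@next_root GE b) (@next_root_root GE b hb)).
have og : (g : GE) \in oE by exact: (@g_oE GE g g2).
have iv : g^-1 = 1 - g := @inv_g GE g g2.
have g0 : g != 0 by apply: contra_eq_neq g2 => ->; rewrite mul0r sub0r eq_sym oppr_eq0 oner_eq0.
split=> //; first exact/(@oEP GE).
- by rewrite iv; apply/(@oEP GE); rewrite rpredB ?rpred1.
- apply: (@cyc_divisionP E s g s3 sgE) => e.
  exact: (@s_not_norm GE (grm i_sq s) (grm i_sq t) s3 t2 st fixst sI tI b g hb g2 sgE tg sb e).
have [y by_] := exists_basis gE dimLE genL tp.
rewrite (disc_normE gE dimLE genL tp tr gL _ g0 by_); last exact/(@oEP GE).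
rewrite (@Nr_g GE (grm i_sq s) (grm i_sq t) g g2 sgE tg) nm1.
rewrite (@nm_disc_example GE (grm i_sq s) (grm i_sq t) s3 t2 st fixst sI tI b g hb g2 sgE tg tb sb y by_).
by rewrite exp1n mul1n expnMn -!expnM.
Qed.
End Sigma.
End Concrete.

(** * Existence of the example *)

Lemma dvd12_eq m : (m %| 12)%N -> ~~ (m %| 6)%N -> ~~ (m %| 4)%N -> m = 12%N.
Proof. by move=> h; have := @dvdn_leq m 12 isT h; move: h; do 13?[case: m => [//|m]]. Qed.

Lemma quintic_split (R : comNzRingType) (X Z J B B1 B2 : R) : Z * Z = J * Z + 1 ->
  (X ^+ 2 - (J * X + 1)) * (X ^+ 3 - ((B + B1 + B2) * X ^+ 2 - (B * B1 + B * B2 + B1 * B2) * X + B * B1 * B2)) =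
  (X - Z) * ((X - (J - Z)) * ((X - B) * ((X - B1) * (X - B2)))).
Proof. by move=> hZ; ring: hZ. Qed.

Section Existence.
Variables (F : fieldExtType rat) (i : F).
Hypothesis i_sq : i ^+ 2 = -1.
Hypothesis F_gen : <<1; i>>%VS = {:F}%VS.

(** Its roots z satisfy z^3 = i; they are primitive 12th roots of unity. *)
Definition quad_z : {poly F} := 'X^2 - (i *: 'X + 1).

Lemma size_quad_z : size quad_z = 3%N.
Proof.
rewrite /quad_z size_polyDl ?size_polyXn // size_polyN ltnS.
apply: leq_trans (size_polyD _ _) _.
by rewrite geq_max size_poly1 (leq_trans (size_scale_leq _ _)) ?size_polyX.
Qed.

(** A root x in Q(i) would give the square root i (2 x - i) of -3. *)
Lemma quad_z_irr : irreducible_poly quad_z.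
Proof.
apply: cubic_irreducible => [|x]; first by rewrite size_quad_z.
rewrite /root /quad_z !(hornerD, hornerN, hornerZ, hornerXn, hornerX, hornerC).
apply/negP => /eqP hx; pose GF := @GaussianField F (in_alg F) i i_sq.
have ii : i * i = -1 by rewrite -expr2.
have xx : x * x = i * x + 1 by apply/eqP; rewrite -subr_eq0 -[x * x]expr2 hx.
apply: (@three_nonsq GF (i * (2%:R * x - i))); last by ring: ii xx.
by have [c [d ->]] := F_coords i_sq F_gen (i * (2%:R * x - i)); apply/(@qiP GF); exists c, d.
Qed.

(** A root would generate a subfield of degree 3 in a field of degree 2. *)
Lemma cubic_irr (K : fieldExtType F) : \dim {:K} = 2%N ->
  irreducible_poly (map_poly (in_alg K) (cubic_f i)).
Proof.
move=> dK; apply: cubic_irreducible => [|x]; first by rewrite size_map_poly size_cubic.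
apply/negP => hx; have := field_dimS (subvf <<1; x>>%AS).
by rewrite dK (degb i_sq F_gen hx).
Qed.

Lemma ex_tower : exists (E : fieldExtType F) (z b : E),
  [/\ root (map_poly (in_alg E) quad_z) z, root (map_poly (in_alg E) (cubic_f i)) b &
   <<<<1; z>>; b>>%VS = {:E}%VS].
Proof.
have [K dK [z1 rz1 gz1]] := irredp_FAdjoin quad_z_irr.
rewrite size_quad_z in dK.
have [L _ [b rb gb]] := irredp_FAdjoin (cubic_irr dK).
have inE p : map_poly (in_alg (baseFieldType L)) p = map_poly (in_alg L) (map_poly (in_alg K) p).
  by rewrite -map_poly_comp; apply: eq_map_poly => a /=; rewrite -baseField_scaleE.
exists (baseFieldType L), z1%:A, b; split.
- by rewrite inE; exact: (rmorph_root (in_alg L)).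
- by rewrite inE.
apply/eqP; rewrite eqEsubv subvf /=; apply/subvP => y _.
pose E : fieldExtType F := baseFieldType L.
pose zE : E := (z1%:A : L); pose bE : E := b.
pose V : {subfield E} := <<1; zE>>%AS; pose U : {subfield E} := <<V; bE>>%AS.
suff yU : (y : E) \in U by exact: yU.
have : (y : L) \in <<1; b>>%VS by rewrite gb memvf.
case/Fadjoin_polyP => p /polyOverP p1 ->.
have bU : bE \in U := memv_adjoin V bE.
have zU : zE \in U := subvP (subv_adjoin V bE) _ (memv_adjoin 1%AS zE).
have KU (k : K) : (k%:A : L) \in U.
  have : k \in <<1; z1>>%VS by rewrite gz1 memvf.
  case/Fadjoin_polyP => q /polyOverP q1 ->; rewrite -[_%:A]/(in_alg L _) horner_coef rmorph_sum /=.
  apply: rpred_sum => j _; have /vlineP[c ->] := q1 j.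
  have -> : (c%:A * z1 ^+ j)%:A = c *: zE ^+ j.
    transitivity (c%:A *: ((z1%:A : L) ^+ j)); last exact: (esym (baseField_scaleE c _)).
    by rewrite -scalerA; congr (_ *: _); exact: (rmorphXn (in_alg L)).
  by rewrite rpredZ // rpredX.
rewrite horner_coef; apply: (@rpred_sum E) => j _; have /vlineP[c ->] := p1 j.
by apply: (@rpredM E); [exact: KU|exact: (@rpredX E)].
Qed.

Lemma example_exists : exists (E : splittingFieldType F) (z b : E),
  [/\ 12.-primitive_root z, root (map_poly (in_alg E) (cubic_f i)) b
    & <<<<1; z>>; b>>%VS = {:E}%VS].
Proof.
have [E [z [b [rz rb gen]]]] := ex_tower.
pose GE := gext i_sq E; pose j : E := i%:A.
have jj : j * j = -1 by exact: (gf_i2E GE).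
have hb : @is_root GE b := cubic_f_root rb.
have ez : map_poly (in_alg E) quad_z = 'X^2 - (j *: 'X + 1).
  by rewrite /quad_z rmorphB rmorphD /= map_polyXn map_polyZ map_polyX rmorph1.
have ef : map_poly (in_alg E) (cubic_f i) =
    'X^3 - ((1 + j) *: 'X^2 - (5%:R * j) *: 'X + (1 + 4%:R * j)%:P).
  have [-> -> ->] : [/\ 1 + j = in_alg E (1 + i), 5%:R * j = in_alg E (5%:R * i) &
      1 + 4%:R * j = in_alg E (1 + 4%:R * i)].
    by rewrite !(rmorphD (in_alg E) 1) !(rmorphM (in_alg E) _%:R) !rmorph_nat rmorph1.
  rewrite /cubic_f rmorphB rmorphD rmorphB /= map_polyXn !map_polyZ /= map_polyXn map_polyX map_polyC /=.
  ring.
have zz : z * z = j * z + 1.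
  move: rz; rewrite ez /root !(hornerD, hornerN, hornerZ, hornerXn, hornerX, hornerC).
  by rewrite subr_eq0 => /eqP.
pose b1 : E := @next_root GE b; pose b2 : E := @next_root GE b1.
have sp : SplittingField.axiom E.
  exists (map_poly (in_alg E) (quad_z * cubic_f i)).
    by apply/polyOverP => k; rewrite coef_map /= rpredZ ?mem1v.
  exists [:: z; j - z; b; b1; b2].
    have e1 : b + b1 + b2 = 1 + j.
      rewrite /b2 /b1 (@next_root2 GE) // /next_root /=; ring.
    have e2 : b * b1 + b * b2 + b1 * b2 = 5%:R * j.
      rewrite /b2 /b1 (@next_root2 GE) // /next_root /=; ring: hb jj.
    have e3 : b * b1 * b2 = 1 + 4%:R * j.
      rewrite /b2 /b1 (@next_root2 GE) // /next_root /=; ring: hb jj.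
    have zP : z%:P * z%:P = j%:P * z%:P + 1 by rewrite -!polyCM zz polyCD.
    have eC : map_poly (in_alg E) (quad_z * cubic_f i) =
        ('X^2 - (j%:P * 'X + 1)) * ('X^3 - ((b%:P + b1%:P + b2%:P) * 'X^2
          - (b%:P * b1%:P + b%:P * b2%:P + b1%:P * b2%:P) * 'X + b%:P * b1%:P * b2%:P)).
      by rewrite (rmorphM (map_poly (in_alg E))) /= ez ef -!polyCM -!polyCD e1 e2 e3 !mul_polyC.
    rewrite eC (quintic_split _ _ _ _ zP) !big_cons big_nil polyCB mulr1; exact: eqpxx.
  apply/eqP; rewrite eqEsubv subvf -gen /=; apply/FadjoinP; split; last first.
    by apply: seqv_sub_adjoin; rewrite !inE eqxx !orbT.
  apply/FadjoinP; split; first exact: sub1v.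
  by apply: seqv_sub_adjoin; rewrite !inE eqxx.
pose S : splittingFieldType F := HB.pack (GRing.Field.sort E) (FieldExt_isSplittingField.Build F E sp).
exists S, z, b; split=> //.
have z3 : z ^+ 3 = j by ring: zz jj.
have z6 : z ^+ 6 = -1 by rewrite (exprM z 3 2) z3 expr2.
have [m pm m12] : {m | m.-primitive_root z & (m %| 12)%N}.
  by apply: prim_order_exists; rewrite // (exprM z 6 2) z6 sqrrN expr1n.
have n6 : ~~ (m %| 6)%N.
  rewrite (prim_order_dvd pm) z6 -subr_eq0 -opprD oppr_eq0; exact: (natrE_neq0 GE 1).
have n4 : ~~ (m %| 4)%N.
  rewrite (prim_order_dvd pm); apply/eqP => z4.
  have e1 : z * j = 1 by rewrite -z4 -z3 -exprS.
  have e2 : z = - j by rewrite -[z]mulr1 -[1]opprK -jj mulrN mulrA e1 mul1r.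
  have : (3%:R : E) = 0.
    have := zz; rewrite e2 => h; transitivity (3%:R + (- j * - j - (j * - j + 1))).
      by rewrite h subrr addr0.
    by ring: jj.
  exact/eqP/(natrE_neq0 GE 2).
by rewrite -(dvd12_eq m12 n6 n4).
Qed.
End Existence.

(** * Natural orders of cyclic division algebras of index 3 *)

Theorem theorem4 (F : fieldExtType rat) (i : F)
    (i_sq : i ^+ 2 = -1) (F_gen : <<1; i>>%VS = {:F}%VS) :
  (forall (E : splittingFieldType F) (L : {subfield E})
          (s : gal_of {:E}) (g : E),
     galois 1 {:E} -> cyclic 'Gal({:E} / 1) -> \dim {:E} = 6%N ->
     \dim_L {:E} = 3%N -> 'Gal({:E} / L)%g = <[s]>%g ->
     g \in L -> alg_integer g -> g != 0 ->
     cyc_division s g 3 ->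
     (3 ^ 18 * 13 ^ 12 <= disc_norm i L s g 3)%N)
  /\
  (exists (E : splittingFieldType F) (z b : E),
     [/\ 12.-primitive_root z, root (map_poly (in_alg E) (cubic_f i)) b
       & <<<<1; z>>; b>>%VS = {:E}%VS])
  /\
  (forall (E : splittingFieldType F) (z b : E),
     12.-primitive_root z -> root (map_poly (in_alg E) (cubic_f i)) b ->
     <<<<1; z>>; b>>%VS = {:E}%VS ->
     let L : {subfield E} := <<1; z>>%AS in
     [/\ galois 1 {:E}, cyclic 'Gal({:E} / 1), \dim {:E} = 6%N,
         \dim_L {:E} = 3%N &
       (exists2 r, r \in L & r ^+ 2 = 3%:R) /\
       forall (s : gal_of {:E}) (r : E),
         'Gal({:E} / L)%g = <[s]>%g -> r ^+ 2 = 3%:R ->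
         let g := (1 + i%:A * r) / 2%:R in
         [/\ g \in L, alg_integer g, alg_integer g^-1,
             cyc_division s g 3
           & disc_norm i L s g 3 = (3 ^ 18 * 13 ^ 12)%N]]).

Proof.
split; [|split].
- move=> E L s g galE cycE dimE dimL genL gL ig g0 _.
  exact: (disc_norm_bound i_sq F_gen galE cycE dimE dimL genL gL ig g0).
- exact: example_exists.
move=> E z b hz rb gen L; split.
- exact: (galoisE i_sq E).
- exact: (cyclicE i_sq F_gen hz rb gen).
- exact: (dimE6 i_sq F_gen hz rb gen).
- exact: (dimLE i_sq F_gen hz rb gen).
split; first by exists (r0 z); [exact: r0_L|exact: (r0_sq hz)].
move=> s r genL r2 g; exact: (example_conclusion i_sq F_gen hz rb gen genL r2).
Qed.
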